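(* Let $n\ge 2$, $0\le\alpha<1$, $\mu\ge 0$ and let $1<p<p_c'(n,\alpha,\mu)$ or $1<p<p_0'(n,\alpha,\mu)$. Assume that $u_0\in C^2(\mathbb{R}^n)$ and $u_1\in C^1(\mathbb{R}^n)$ are nonnegative, nontrivial and $\operatorname{supp}u_0,\ \operatorname{supp}u_1\subset\{|x|\le R\}$ with $R>0$. Suppose that the Cauchy problem $$u_{tt}-\frac{1}{t^{2\alpha}}\Delta u+\frac{\mu}{t}u_t=|\nabla_x u|^p,\quad t>1,\ x\in\mathbb{R}^n,\qquad u(1,x)=\varepsilon u_0(x),\quad u_t(1,x)=\varepsilon u_1(x),\quad x\in\mathbb{R}^n,$$ has a classical solution $u\in C^2([1,T)\times\mathbb{R}^n)$. Then $T<\infty$, and there exists a constant $\varepsilon_0>0$ depending on $p,\alpha,\mu,R,u_0,u_1$ such that the lifespan $T_\varepsilon$ has to satisfy $$T_\varepsilon\le C\varepsilon^{\frac{-2p(p-1)}{(1-\alpha)\gamma'(n,p,\alpha,\mu)}}\quad\text{if }1<p<p_c'(n,\alpha,\mu),$$ $$T_\varepsilon\le C\varepsilon^{-\frac{p-1}{\{1-\mu-(n+1)(1-\alpha)\}(p-1)+1+\alpha}}\quad\text{if }1<p<p_0'(n,\alpha,\mu)$$ for $0<\varepsilon\le\varepsilon_0$, where $C>0$ is a constant independent of $\varepsilon$.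
   Context: Here $\Delta=\sum_{j=1}^n\partial^2/\partial x_j^2$, $\nabla_x u=(\partial u/\partial x_1,\dots,\partial u/\partial x_n)$ and $\varepsilon>0$ is a small parameter. The lifespan $T_\varepsilon$ is the supremum of all $T$ such that the Cauchy problem has a solution for $x\in\mathbb{R}^n$ and $1\le t<T$. Define $$\gamma'(n,p,\alpha,\mu)=-p^2\left(n+1+\frac{\mu-\alpha}{1-\alpha}\right)+p\left(n+1+\frac{\mu+3\alpha}{1-\alpha}\right)+2 .$$ $p_c'(n,\alpha,\mu)$ denotes the positive root $p$ of $\gamma'(n,p,\alpha,\mu)=0$; the condition $1<p<p_c'(n,\alpha,\mu)$ presupposes that this root exists, i.e. that $n+1+\frac{\mu-\alpha}{1-\alpha}>0$. Also $$p_0'(n,\alpha,\mu)=1+\frac{1+\alpha}{(n+1)(1-\alpha)+\mu-1}.$$ *)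

(* Defs.v *)
From HB Require Import structures.
From mathcomp Require Import all_boot all_order all_algebra.
From mathcomp Require Import all_classical all_reals all_analysis.
From mathcomp Require Import ring lra.

Set Implicit Arguments.
Unset Strict Implicit.
Unset Printing Implicit Defensive.

Import Order.TTheory GRing.Theory Num.Theory numFieldNormedType.Exports.

Local Open Scope classical_set_scope.
Local Open Scope ring_scope.

(* The library norm on row vectors is the sup norm. *)
Definition enorm (R : realType) (n : nat) (x : 'rV[R]_n) : R :=
  Num.sqrt (\sum_(i < n) x 0 i ^+ 2).

Definition supported_in_ball (R : realType) (n : nat) (f : 'rV[R]_n -> R)
    (rad : R) : Prop :=
  closure [set x | f x != 0] `<=` [set x | enorm x <= rad].

(* Derivatives relative to a set D: the same difference quotients as in
   [derivable] and [derive], restricted to the increments that stay in D. They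
   are one-sided at boundary points and depend only on the values of f on D. *)
Definition derivable_in (R : realType) (V : normedModType R) (D : set V)
    (f : V -> R) (a v : V) : Prop :=
  cvg ((fun h : R => h^-1 *: ((f \o shift a) (h *: v) - f a))
         @ within [set h | D (h *: v + a)] 0^').

Definition derive_in (R : realType) (V : normedModType R) (D : set V)
    (f : V -> R) (a v : V) : R :=
  lim ((fun h : R => h^-1 *: ((f \o shift a) (h *: v) - f a))
         @ within [set h | D (h *: v + a)] 0^').

(* f is of class C^k on D: all iterated partial derivatives of order at most k,
   along the coordinate directions B, exist and are continuous on D, where
   continuity refers to the topology induced on D. *)
Fixpoint Ck (R : realType) (V : normedModType R) (B : set V) (k : nat)
    (D : set V) (f : V -> R) : Prop :=
  {within D, continuous f} /\
  (if k is k'.+1 then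
     forall e, B e ->
       (forall z, D z -> derivable_in D f z e) /\
       Ck B k' D (fun z => derive_in D f z e)
   else True).

Section Coordinates.
Variables (R : realType) (n : nat).

Definition space_dir (i : 'I_n) : 'rV[R]_n := delta_mx 0 i.

Definition st_t : R * 'rV[R]_n := (1, 0).
Definition st_x (i : 'I_n) : R * 'rV[R]_n := (0, space_dir i).

Definition Ck_space (k : nat) (f : 'rV[R]_n -> R) : Prop :=
  Ck (range space_dir) k [set: 'rV[R]_n] f.

(* [1, T) x R^n, where T may be +oo. *)
Definition slab (T : \bar R) : set (R * 'rV[R]_n) :=
  [set z | 1 <= z.1 /\ (z.1%:E < T)%E].

Definition Ck_slab (k : nat) (T : \bar R) (u : R * 'rV[R]_n -> R) : Prop :=
  Ck (st_t |` range st_x) k (slab T) u.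

Definition dt (T : \bar R) (u : R * 'rV[R]_n -> R) (z : R * 'rV[R]_n) : R :=
  derive_in (slab T) u z st_t.

Definition dx (T : \bar R) (i : 'I_n) (u : R * 'rV[R]_n -> R)
    (z : R * 'rV[R]_n) : R :=
  derive_in (slab T) u z (st_x i).

Definition grad_x (T : \bar R) (u : R * 'rV[R]_n -> R) (z : R * 'rV[R]_n) :
    'rV[R]_n :=
  \row_(i < n) dx T i u z.

Definition laplacian (T : \bar R) (u : R * 'rV[R]_n -> R)
    (z : R * 'rV[R]_n) : R :=
  \sum_(i < n) dx T i (dx T i u) z.

Definition classical_solution (p alpha mu eps : R) (u0 u1 : 'rV[R]_n -> R)
    (T : \bar R) (u : R * 'rV[R]_n -> R) : Prop :=
  [/\ Ck_slab 2 T u,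
      (forall (t : R) (x : 'rV[R]_n), 1 < t -> (t%:E < T)%E ->
         dt T (dt T u) (t, x)
           - 1 / (t `^ (2 * alpha)) * laplacian T u (t, x)
           + mu / t * dt T u (t, x)
         = enorm (grad_x T u (t, x)) `^ p),
      (forall x : 'rV[R]_n, u (1, x) = eps * u0 x) &
      (forall x : 'rV[R]_n, dt T u (1, x) = eps * u1 x)].

(* The bound 1 < T keeps the interval [1, T) nonempty; if there is no local
   classical solution at all, the lifespan is -oo. *)
Definition lifespan (p alpha mu eps : R) (u0 u1 : 'rV[R]_n -> R) : \bar R :=
  ereal_sup [set T : \bar R | (1%:E < T)%E /\
    exists u, classical_solution p alpha mu eps u0 u1 T u].

End Coordinates.

Section Exponents.
Variables (R : realType) (n : nat).

Definition gamma' (p alpha mu : R) : R :=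
  - p ^+ 2 * (n%:R + 1 + (mu - alpha) / (1 - alpha))
  + p * (n%:R + 1 + (mu + 3 * alpha) / (1 - alpha)) + 2.

(* The positive root of gamma', with the junk value 0 when there is none, so
   that 1 < p < pc' alpha mu forces its existence. *)
Definition pc' (alpha mu : R) : R :=
  xget 0 [set q | 0 < q /\ gamma' q alpha mu = 0].

(* When the denominator is not positive (in particular when it is 0, since
   0^-1 = 0), this is at most 1 and 1 < p < p0' alpha mu is impossible. *)
Definition p0' (alpha mu : R) : R :=
  1 + (1 + alpha) / ((n%:R + 1) * (1 - alpha) + mu - 1).

Lemma gamma'_pos_root_uniq (alpha mu q r : R) :
  0 <= alpha -> alpha < 1 -> 0 <= mu ->
  0 < q -> gamma' q alpha mu = 0 -> 0 < r -> gamma' r alpha mu = 0 -> q = r.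
Proof.
move=> a0 a1 mu0 q0 hq r0 hr.
have b0 : 0 < 1 - alpha by rewrite subr_gt0.
have n0 : 0 <= n%:R :> R by [].
have B0 : 0 < n%:R + 1 + (mu + 3 * alpha) / (1 - alpha).
  have : 0 <= (mu + 3 * alpha) / (1 - alpha).
    by apply: divr_ge0; [lra | exact: ltW].
  lra.
move: hq hr B0; rewrite /gamma'.
set A := (n%:R + 1 + (mu - alpha) / _); set B := (n%:R + 1 + _) => hq hr B0.
have A0 : 0 < A.
  rewrite -(pmulr_rgt0 _ (exprn_gt0 2 q0)).
  have := mulr_gt0 q0 B0; nra.
have : (q - r) * (A * (q * r) + 2) = 0.
  have -> : (q - r) * (A * (q * r) + 2) =
     q * (- r ^+ 2 * A + r * B + 2) - r * (- q ^+ 2 * A + q * B + 2) by ring.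
  by rewrite hq hr !mulr0 subrr.
move/eqP; rewrite mulf_eq0 => /orP[|]; first by rewrite subr_eq0 => /eqP.
by rewrite gt_eqF// ltr_wpDl// ltW// mulr_gt0// mulr_gt0.
Qed.

End Exponents.

(* Main.v *)
Require Import Defs.
From HB Require Import structures.
From mathcomp Require Import all_boot all_order all_algebra.
From mathcomp Require Import all_classical all_reals all_analysis.
From mathcomp Require Import ring lra.
Import Order.TTheory GRing.Theory Num.Theory numFieldNormedType.Exports.
Local Open Scope classical_set_scope.
Local Open Scope ring_scope.

(* The sums over space of u, u_t and u_tt against the plane wave exp (lam x_1),
   whose Laplacian is lam^2 times itself, reduce the equation to an ordinary
   differential inequality. Finite speed of propagation confines u to
   |x| <= A(t) + rad with A(t) = (t^(1-alpha) - 1)/(1-alpha), and on that ball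
   the plane wave has mass O(A^(n/2) exp (lam A)), so Jensen's inequality bounds
   the nonlinear term below and G = sum exp (lam x_1) u satisfies
     G'' + mu/t G' >= lam^2 t^(-2 alpha) G + c t^(-q) exp (-(p-1) lam A) G^p
   with q = (1-alpha) n (p-1)/2. Comparing the Riccati variable
   t^alpha G'/(lam G) with an explicit barrier forces blow-up before a time of
   order eps^(-(p-1)/E), for each
     0 < E < 1 + alpha - (p-1) ((1-alpha) n + mu - alpha)/2,
   and both exponents in the theorem are of this form. All integrals over space
   are Riemann sums over a fine grid: for C^2 functions the divergence terms only
   leave an arbitrarily small error, which the nonlinear term absorbs as long as
   G stays above its initial size. *)

Set Implicit Arguments.
Unset Strict Implicit.
Unset Printing Implicit Defensive.

(** * One-variable calculus *)

(** Heuristics for the rate: let X be the ratio of the nonlinear term to lam^2 t^(-2 alpha) G. While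
    X is negligible, the Riccati variable tends to 1 with correction -(mu - alpha)/(2 lam)
    t^(alpha-1), so G behaves like eps t^(-(mu-alpha)/2) exp (lam A). The exponentials in X then
    cancel and X is of order eps^(p-1) t^(2 alpha - q - (p-1)(mu-alpha)/2). Blow-up is expected once
    the integral of t^(-alpha) X reaches order 1, which gives the supremum of the admissible E. The
    barrier loses a further t^(-eta), and small eta is paid for by large lam. The nonlinear term is
    reached through |grad u| >= |d_1 u|: summation by parts turns the sum of exp (lam x_1) d_1 u
    into -lam G. Finite sums commute with d/dt, so nothing is differentiated under an integral. The
    price is that the grid is chosen after u and the final time, so every constant of the final
    bound has to be independent of the grid, the box and that time. *)

Section RealDerivatives.
Context {R : realType}.
Implicit Types (f g : R -> R) (x d : R).

Definition has_der f x d := is_derive x (1 : R) f d.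

Lemma der_eq f x d d' : has_der f x d -> d = d' -> has_der f x d'.
Proof. by move=> h <-. Qed.

Lemma der_cst (c x : R) : has_der (fun=> c) x 0.
Proof. exact: is_derive_cst. Qed.

Lemma der_id x : has_der (fun s => s) x 1.
Proof. exact: is_derive_id. Qed.

Lemma derD f g x d e :
  has_der f x d -> has_der g x e -> has_der (fun s => f s + g s) x (d + e).
Proof. by move=> hf hg; exact: (is_deriveD hf hg). Qed.

Lemma derN f x d : has_der f x d -> has_der (fun s => - f s) x (- d).
Proof. by move=> hf; exact: (is_deriveN hf). Qed.

Lemma derB f g x d e :
  has_der f x d -> has_der g x e -> has_der (fun s => f s - g s) x (d - e).
Proof. by move=> hf hg; exact: (is_deriveB hf hg). Qed.

Lemma derM f g x d e : has_der f x d -> has_der g x e ->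
  has_der (fun s => f s * g s) x (d * g x + f x * e).
Proof.
move=> hf hg; apply: der_eq (is_deriveM hf hg) _.
by rewrite /GRing.scale /= addrC (mulrC (g x)).
Qed.

Lemma derZ (c : R) f x d : has_der f x d -> has_der (fun s => c * f s) x (c * d).
Proof. by move=> hf; apply: der_eq (derM (der_cst c x) hf) _; rewrite mul0r add0r. Qed.

Lemma der_comp f g x d e :
  has_der f (g x) d -> has_der g x e -> has_der (fun s => f (g s)) x (d * e).
Proof. by move=> hf hg; exact: (is_derive1_comp hf hg). Qed.

Lemma der_exp f x d : has_der f x d -> has_der (fun s => expR (f s)) x (expR (f x) * d).
Proof. by move=> hf; exact: (der_comp (is_derive_expR (f x)) hf). Qed.

Lemma der_powR (a : R) f x d : 0 < f x -> has_der f x d ->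
  has_der (fun s => f s `^ a) x (a * f x `^ (a - 1) * d).
Proof. by move=> f0 hf; exact: (der_comp (@is_derive1_powR _ a _ f0) hf). Qed.

Lemma der_sum (I : Type) (r : seq I) (f : I -> R -> R) (d : I -> R) x :
  (forall i, has_der (f i) x (d i)) ->
  has_der (fun s => \sum_(i <- r) f i s) x (\sum_(i <- r) d i).
Proof.
move=> h; elim: r => [|i r ih].
  rewrite big_nil (_ : (fun _ => _) = fun=> 0); first exact: der_cst.
  by apply/funext => s; rewrite big_nil.
rewrite big_cons (_ : (fun _ => _) = fun s => f i s + \sum_(i <- r) f i s).
  exact: derD.
by apply/funext => s; rewrite big_cons.
Qed.

Lemma der_uniq f x d d' : has_der f x d -> has_der f x d' -> d = d'.
Proof. by move=> h h'; rewrite -(@derive_val _ _ _ _ _ _ _ h) -(@derive_val _ _ _ _ _ _ _ h'). Qed.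

Lemma der_near f g x d : (\forall s \near x, f s = g s) ->
  has_der f x d -> has_der g x d.
Proof.
by move=> fg hf; exact: (near_eq_is_derive fg hf).
Qed.

(** Meant for [sqpos], which is C^1 but has no single formula across the sign change: a quadratic
    remainder makes the difference quotient converge. *)
Lemma der_quadratic f x d (C : R) :
  (forall h, `|f (h + x) - f x - d * h| <= C * h ^+ 2) -> has_der f x d.
Proof.
move=> hC.
have hl : (fun h => h^-1 *: ((f \o shift x) (h *: (1 : R)) - f x)) @ 0^' --> d.
  apply/cvgrPdist_le => e e0; near=> h.
  have h0 : h != 0 by near: h; exact: nbhs_dnbhs_neq.
  rewrite /= /GRing.scale /= mulr1 distrC.
  have -> : h^-1 * (f (h + x) - f x) - d = h^-1 * (f (h + x) - f x - d * h).
    by field.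
  rewrite normrM normfV ler_pdivrMl ?normr_gt0 //.
  apply: le_trans (hC h) _.
  rewrite -real_normK ?num_real // expr2 mulrA mulrC ler_wpM2l //.
  have C0 : C <= `|C| + 1 by apply: le_trans (ler_norm C) _; rewrite lerDl.
  apply: le_trans (ler_wpM2r (normr_ge0 h) C0) _.
  rewrite -ler_pdivlMl ?ltr_wpDl // ltW //.
  near: h; apply: dnbhs0_lt; rewrite mulr_gt0 ?invr_gt0 ?ltr_wpDl //.
apply: DeriveDef; first by apply/cvg_ex; exists d.
exact: cvg_lim hl.
Unshelve. all: by end_near. Qed.

End RealDerivatives.

Section ContinuityWithin.
Context {R : realType}.

Definition cont_in (V : topologicalType) (A : set V) (f : V -> R) (x : V) :=
  f @ within A (nbhs x) --> f x.

Section Generic.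
Variables (V : topologicalType) (A : set V).
Implicit Types (f g : V -> R) (x : V).

Lemma cont_in_cst (c : R) x : cont_in A (fun=> c) x.
Proof. exact: cvg_cst. Qed.

Lemma cont_inD f g x : cont_in A f x -> cont_in A g x ->
  cont_in A (fun y => f y + g y) x.
Proof. by move=> hf hg; exact: cvgD. Qed.

Lemma cont_inN f x : cont_in A f x -> cont_in A (fun y => - f y) x.
Proof. by move=> hf; exact: cvgN. Qed.

Lemma cont_inB f g x : cont_in A f x -> cont_in A g x ->
  cont_in A (fun y => f y - g y) x.
Proof. by move=> hf hg; exact: cvgB. Qed.

Lemma cont_inM f g x : cont_in A f x -> cont_in A g x ->
  cont_in A (fun y => f y * g y) x.
Proof. by move=> hf hg; exact: cvgM. Qed.

Lemma cont_in_sum (I : Type) (r : seq I) (f : I -> V -> R) x :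
  (forall i, cont_in A (f i) x) -> cont_in A (fun y => \sum_(i <- r) f i y) x.
Proof.
move=> h; elim: r => [|i r ih].
  rewrite /cont_in big_nil (_ : (fun _ => _) = fun=> 0); first exact: cvg_cst.
  by apply/funext => s; rewrite big_nil.
rewrite (_ : (fun _ => _) = fun s => f i s + \sum_(i <- r) f i s); first exact: cont_inD.
by apply/funext => s; rewrite big_cons.
Qed.

Lemma cont_in_comp (F : R -> R) f x : {for f x, continuous F} ->
  cont_in A f x -> cont_in A (fun y => F (f y)) x.
Proof. by move=> hF hf; exact: (continuous_cvg _ hF hf). Qed.

Lemma cont_inT f x : {for x, continuous f} -> cont_in A f x.
Proof.
move=> h; apply: (@cvg_trans _ (f @ nbhs x)); last exact: h.
by apply: cvg_fmap2; exact: cvg_within.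
Qed.

Lemma cont_inW (B : set V) f x : B `<=` A -> cont_in A f x -> cont_in B f x.
Proof.
move=> BA hf; apply: cvg_trans hf; apply: cvg_fmap2.
by move=> P; rewrite /within /= => hP; apply: filterS hP => y h /BA.
Qed.

Lemma cont_inP f : {within A, continuous f} <-> forall x, A x -> cont_in A f x.
Proof. exact: subspace_continuousP. Qed.

End Generic.

Lemma der_cont (f : R -> R) x d : has_der f x d -> {for x, continuous f}.
Proof.
by move=> [hd _]; apply: differentiable_continuous; exact/derivable1_diffP.
Qed.

Lemma der_cont_in (A : set R) (f : R -> R) x d : has_der f x d -> cont_in A f x.
Proof. by move=> h; apply: cont_inT; exact: der_cont h. Qed.

Arguments der_cont_in {A f x d}.

Definition seg (a b : R) : set R := [set x | a <= x <= b].

Lemma der_mvt (a b : R) (f df : R -> R) : a < b ->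
  (forall t, a <= t <= b -> cont_in (seg a b) f t) ->
  (forall t, a < t < b -> has_der f t (df t)) ->
  exists2 c, a < c < b & f b - f a = df c * (b - a).
Proof.
move=> ab cf hf.
have [||c] := @MVT R f df a b ab.
- by move=> x; rewrite in_itv /= => hx; exact: hf.
- rewrite set_itvcc; apply/cont_inP => x; exact: cf.
by rewrite in_itv /= => hc e; exists c.
Qed.

Lemma der_nondecr (a b : R) (f df : R -> R) : a <= b ->
  (forall t, a <= t <= b -> cont_in (seg a b) f t) ->
  (forall t, a < t < b -> has_der f t (df t)) ->
  (forall t, a < t < b -> 0 <= df t) -> f a <= f b.
Proof.
rewrite le_eqVlt => /predU1P[->//|ab] cf hf h0.
have [c hc e] := der_mvt ab cf hf.
by rewrite -subr_ge0 e mulr_ge0 ?h0 // subr_ge0 ltW.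
Qed.

(** The function [delta (t - a) - f t exp (-C (t - a))] is nondecreasing. Only continuity is asked
    at the endpoints, since at time 1 a solution has just a one-sided time derivative; [delta] will
    carry the grid error. *)
Lemma gronwall (a b C delta : R) (f df : R -> R) : a <= b -> 0 <= C -> 0 <= delta ->
  (forall t, a <= t <= b -> cont_in (seg a b) f t) ->
  (forall t, a < t < b -> has_der f t (df t)) ->
  (forall t, a < t < b -> df t <= C * f t + delta) ->
  f a <= 0 -> f b <= delta * (b - a) * expR (C * (b - a)).
Proof.
move=> ab C0 d0 cf hf hle fa.
have hexp (t : R) : has_der (fun t => expR (- (C * (t - a)))) t (- C * expR (- (C * (t - a)))).
  apply: der_eq (der_exp (derN (derZ C (derB (der_id t) (der_cst a t))))) _.
  by ring.
pose F t := delta * (t - a) - f t * expR (- (C * (t - a))).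
have : F a <= F b.
  apply: (@der_nondecr a b F
    (fun t => delta - (df t - C * f t) * expR (- (C * (t - a))))); first exact: ab.
  - move=> t ht; apply: cont_inB.
      by apply: (der_cont_in (derZ delta (derB (der_id t) (der_cst a t)))).
    by apply: cont_inM; [exact: cf|exact: der_cont_in (hexp t)].
  - move=> t ht.
    apply: der_eq (derB (derZ delta (derB (der_id t) (der_cst a t))) (derM (hf t ht) (hexp t))) _.
    by ring.
  - move=> t /[dup] ht /andP[at_ tb].
    rewrite subr_ge0.
    have h1 : df t - C * f t <= delta by rewrite lerBlDl; exact: hle.
    apply: le_trans (ler_wpM2r (expR_ge0 _) h1) _.
    rewrite -[leRHS]mulr1 ler_wpM2l // expR_le1 oppr_le0 mulr_ge0 // subr_ge0 ltW //.
rewrite /F subrr !mulr0 oppr0 expR0 mulr1 sub0r => h.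
have : f b * expR (- (C * (b - a))) <= delta * (b - a) by lra.
by rewrite expRN -ler_pdivlMr ?invr_gt0 ?expR_gt0 // invrK.
Qed.

(** At the infimum of the set [f <= 0] the function is zero with positive values before it, which a
    positive derivative forbids. The derivative is demanded only at such a first zero, so facts
    deduced from positivity on the earlier interval may be used to produce it. *)
Lemma first_crossing (a b : R) (f : R -> R) : a <= b ->
  (forall t, a <= t <= b -> cont_in (seg a b) f t) -> 0 < f a ->
  (forall t, a < t <= b -> (forall s, a <= s < t -> 0 < f s) -> f t = 0 ->
     exists2 d, has_der f t d & 0 < d) ->
  forall t, a <= t <= b -> 0 < f t.
Proof.
move=> ab cf fa hcross t /andP[at_ tb]; rewrite ltNge; apply/negP => ft.
pose Z := [set s | a <= s <= b /\ f s <= 0].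
have hZ : has_inf Z.
  split; first by exists t; split; [rewrite at_|].
  by exists a => s [/andP[]].
pose z := inf Z.
have az : a <= z by apply: lb_le_inf; [exact: hZ.1|move=> s [/andP[]]].
have zt : z <= t by apply: ge_inf; [exact: hZ.2|split=> //; rewrite at_].
have zb := le_trans zt tb.
have hpos s : a <= s < z -> 0 < f s.
  move=> /andP[as_ sz]; rewrite ltNge; apply/negP => fs.
  suff : z <= s by rewrite leNgt sz.
  by apply: ge_inf; [exact: hZ.2|split=> //; rewrite as_ (le_trans (ltW sz) zb)].
have fz0 : f z <= 0.
  rewrite leNgt; apply/negP => fz.
  have /cvgrPdist_lt/(_ _ fz) : cont_in (seg a b) f z by apply: cf; rewrite az.
  rewrite near_withinE => /nbhs_ballP[e /= e0 he].
  have [s Zs sz] : exists2 s, Z s & s < z + e by exact: inf_adherent.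
  have zs : z <= s by apply: ge_inf => //; exact: hZ.2.
  case: (Zs) => hs fs.
  have : `|f z - f s| < f z.
    apply: he; last exact: hs.
    by rewrite /ball /= distrC ger0_norm ?subr_ge0 // ltrBlDl.
  by rewrite ltr_distlC => /andP[+ _]; rewrite subrr ltNge fs.
have az' : a < z.
  by rewrite lt_neqAle az andbT; apply/eqP => ez; move: fz0; rewrite -ez leNgt fa.
have fz : f z = 0.
  apply/le_anti; rewrite fz0 /= leNgt; apply/negP => fzN.
  have fzN' : 0 < - f z by rewrite oppr_gt0.
  have /cvgrPdist_lt/(_ _ fzN') : cont_in (seg a b) f z by apply: cf; rewrite az.
  rewrite near_withinE => /nbhs_ballP[e /= e0 he].
  pose s := Num.max a (z - e / 2).
  have sz : s < z by rewrite gt_max az' /= gtrBl divr_gt0.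
  have as_ : a <= s by rewrite le_max lexx.
  have zs : z - e / 2 <= s by rewrite le_max lexx orbT.
  have : `|f z - f s| < - f z.
    apply: he; last by rewrite /seg /= as_ (le_trans (ltW sz) zb).
    by rewrite /ball /= ger0_norm ?subr_ge0 ?ltW //; lra.
  have := hpos s; rewrite as_ sz => /(_ isT).
  by move: fzN; rewrite ltr_norml => ? ? /andP[]; lra.
have [|d [hd <-] d0] := hcross z _ hpos fz; first by rewrite az' zb.
have hcv : (fun h => h^-1 *: ((f \o shift z) (h *: (1 : R)) - f z)) @ 0^' --> 'D_1 f z.
  by have := hd; rewrite /derivable /derive.
move/cvgrPdist_lt/(_ _ d0): hcv.
rewrite near_withinE => /nbhs_ballP[e /= e0 he].
pose h := Num.min (e / 2) (z - a).
have h0 : 0 < h by rewrite lt_min divr_gt0 // subr_gt0.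
have he2 : h <= e / 2 by rewrite ge_min lexx.
have hza : h <= z - a by rewrite ge_min lexx orbT.
have : `|'D_1 f z - (- h)^-1 *: (f (- h *: 1 + z) - f z)| < 'D_1 f z.
  apply: he; last by rewrite oppr_eq0 gt_eqF.
  by rewrite /ball /= sub0r opprK gtr0_norm //; lra.
rewrite fz subr0 /GRing.scale /= mulr1.
have fp : 0 < f (- h + z) by apply: hpos; apply/andP; split; lra.
have : 0 < h^-1 * f (- h + z) by rewrite mulr_gt0 ?invr_gt0.
rewrite invrN mulNr opprK ltr_norml => ? /andP[]; lra.
Qed.

End ContinuityWithin.
Arguments der_cont_in {R A f x d}.

(** * The barrier for the Riccati equation *)

Section BarrierAlgebra.
Context {R : realType}.
Implicit Types (p q nu lam eta alpha tau x X F phi : R).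

(** The strict inequality [d phi/ds + (nu/lam) tau phi < 1 - phi^2] for [phi = 1 - (k tau + D x)],
    with [tau = t^(alpha-1)], [x = exp (-(lam/2) A)] and [ds = lam t^(-alpha) dt]. The terms linear
    in [tau] leave the margin [2 eta tau/lam]; the other terms in [tau] alone carry a further factor
    [b/lam], and those with [D x] have the good sign. *)
Lemma barrier_scalar (alpha nu lam eta k D tau x : R) :
  0 <= alpha < 1 -> 0 < eta -> let b := `|nu| / 2 + eta in
  2 <= lam -> 2 * b <= lam -> b ^+ 2 + b <= lam * eta ->
  lam * k = nu / 2 + eta -> 0 <= D -> 0 < tau <= 1 -> 0 <= x ->
  k * tau + D * x <= 1 ->
  nu / lam * tau * (1 - (k * tau + D * x)) + ((1 - alpha) * k * tau ^+ 2 / lam + D * x / 2)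
  < 1 - (1 - (k * tau + D * x)) ^+ 2.
Proof.
move=> /andP[a0 a1] e0 b l2 lb lbe hk D0 /andP[t0 t1] x0 hd.
have l0 : 0 < lam by lra.
have b0 : eta <= b by rewrite /b lerDr divr_ge0.
have Dx0 : 0 <= D * x by rewrite mulr_ge0.
have hb : `|nu / 2 + eta| <= b.
  by rewrite /b (le_trans (ler_normD _ _)) // normrM (gtr0_norm e0) (@ger0_norm _ 2^-1) ?invr_ge0.
have hb' : `|nu / 2 - eta| <= b.
  rewrite /b (le_trans (ler_normB _ _)) // normrM (gtr0_norm e0) (@ger0_norm _ 2^-1) ?invr_ge0 //.
set y := D * x in Dx0 hd *.
have ek : k = (nu / 2 + eta) / lam by rewrite -hk mulrAC divff ?mul1r // gt_eqF.
rewrite -subr_gt0.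
set d := k * tau + y in hd *.
have -> : 1 - (1 - d) ^+ 2 - (nu / lam * tau * (1 - d) + ((1 - alpha) * k * tau ^+ 2 / lam + y / 2))
  = tau / lam * (2 * eta + d * (nu / 2 - eta) - (1 - alpha) * k * tau)
    + y * (3 / 2 - d).
  by rewrite /d ek; field; rewrite gt_eqF.
have -> : tau / lam * (2 * eta + d * (nu / 2 - eta) - (1 - alpha) * k * tau) =
  tau / lam * (2 * eta + k * tau * (nu / 2 - eta) - (1 - alpha) * k * tau) +
  y * (tau / lam * (nu / 2 - eta)).
  by rewrite /d; ring.
rewrite -addrA -mulrDr.
have hkl : `|k| <= b / lam by rewrite ek normrM (gtr0_norm (x:=lam^-1)) ?invr_gt0 // ler_wpM2r // invr_ge0 ltW.
have bl : b / lam <= 1 / 2 by rewrite ler_pdivrMr //; lra.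
have b0' : 0 <= b by lra.
have h1 : 0 < 2 * eta + k * tau * (nu / 2 - eta) - (1 - alpha) * k * tau.
  have e1 : `|k * tau * (nu / 2 - eta)| <= b / lam * b.
    rewrite !normrM -mulrA ler_pM // ?mulr_ge0 // (gtr0_norm t0).
    by rewrite -[leRHS]mul1r ler_pM // ltW.
  have e2 : `|(1 - alpha) * k * tau| <= b / lam.
    rewrite !normrM (gtr0_norm t0) gtr0_norm ?subr_gt0 //.
    rewrite -[leRHS]mulr1 ler_pM ?mulr_ge0 //; try lra.
    by rewrite -[leRHS]mul1r ler_pM //; lra.
  have e3 : b / lam * b + b / lam <= eta.
    rewrite (_ : _ + _ = (b ^+ 2 + b) / lam); last by field; rewrite gt_eqF.
    by rewrite ler_pdivrMr // mulrC.
  move: e1 e2; rewrite !ler_norml => /andP[? ?] /andP[? ?]; lra.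
have h2 : 0 <= tau / lam * (nu / 2 - eta) + (3 / 2 - d).
  have : `|tau / lam * (nu / 2 - eta)| <= 1 / 2.
    rewrite normrM (@ger0_norm _ (tau / lam)); last by rewrite divr_ge0 // ltW.
    apply: le_trans bl; rewrite mulrAC ler_pM2r ?invr_gt0 //.
    by rewrite -[leRHS]mul1r ler_pM // ltW.
  by rewrite ler_norml => /andP[? ?]; lra.
apply: ltr_wpDr; first exact: mulr_ge0.
by rewrite mulr_gt0 // divr_gt0.
Qed.

(** Passes from the barrier [phi] for [X = 0] to [F phi] with [F = sqrt (1 + kap X)]. Raising the
    barrier costs [kap X phi^2], a change in the lower-order terms and the growth of [F], altogether
    at most [kap X (5 + 2 p) = X]; this is how [kap] is chosen. *)
Lemma barrier_algebra (alpha nu lam p q tau X F phi dphi : R) :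
  let kap := (5 + 2 * p)^-1 in
  0 <= alpha <= 1 -> 1 < p -> 0 <= q -> 1 <= lam -> 0 < tau <= 1 -> 0 <= X ->
  1 <= F -> F ^+ 2 = 1 + kap * X -> 0 < phi <= 3 / 2 ->
  nu / lam * tau * phi + dphi < 1 - phi ^+ 2 ->
  0 < 1 + X - (F * phi) ^+ 2 - nu / lam * tau * (F * phi)
      - kap * X / (2 * F) * ((p - 1) * (F * phi - 1) + (2 * alpha - q) * tau / lam) * phi
      - F * dphi.
Proof.
move=> kap /andP[a0 a1] p1 q0 l1 /andP[t0 t1] X0 F1 hF /andP[f0 f1] hB.
have k0 : 0 < kap by rewrite invr_gt0; lra.
have kX : 0 <= kap * X by rewrite mulr_ge0 // ltW.
have F0 : 0 < F by lra.
have hF1 : F - 1 <= kap * X / 2 by nra.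
set B := nu / lam * tau * phi + dphi in hB.
have -> : 1 + X - (F * phi) ^+ 2 - nu / lam * tau * (F * phi)
      - kap * X / (2 * F) * ((p - 1) * (F * phi - 1) + (2 * alpha - q) * tau / lam) * phi
      - F * dphi =
  1 + X - F ^+ 2 * phi ^+ 2 - F * B
   - kap * X / (2 * F) * ((p - 1) * (F * phi - 1) + (2 * alpha - q) * tau / lam) * phi.
  by rewrite /B; ring.
have hd : kap * X / (2 * F) * ((p - 1) * (F * phi - 1) + (2 * alpha - q) * tau / lam) * phi
   <= kap * X * (9 / 8 * (p - 1) + 3 / 2).
  have h1 : (2 * alpha - q) * tau / lam <= 2.
    rewrite ler_pdivrMr; last lra.
    have : (2 * alpha - q) * tau <= 2 by nra.
    by nra.
  have h2 : (p - 1) * (F * phi - 1) + (2 * alpha - q) * tau / lam <= (p - 1) * (F * (3 / 2)) + 2 * F.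
    have : F * phi - 1 <= F * (3 / 2) by nra.
    by nra.
  have -> : kap * X * (9 / 8 * (p - 1) + 3 / 2) =
    kap * X / (2 * F) * ((p - 1) * (F * (3 / 2)) + 2 * F) * (3 / 2).
    by field; rewrite gt_eqF.
  apply: (@le_trans _ _ (kap * X / (2 * F) * ((p - 1) * (F * (3 / 2)) + 2 * F) * phi)).
    rewrite ler_wpM2r //; first exact: ltW.
    by rewrite ler_wpM2l // divr_ge0 //; lra.
  rewrite ler_wpM2l //.
  apply: mulr_ge0; first by rewrite divr_ge0 //; lra.
  nra.
have hk : kap * (5 + 2 * p) = 1 by rewrite mulVf // gt_eqF //; lra.
rewrite hF.
have hphi2 : phi ^+ 2 <= 9 / 4 by nra.
have h3 : (F - 1) * B <= kap * X / 2.
  have B1 : B <= 1 by nra.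
  nra.
have h4 : kap * X * phi ^+ 2 <= kap * X * (9 / 4) by rewrite ler_wpM2l.
have h5 : X = kap * X * (5 + 2 * p) by rewrite mulrAC hk mul1r.
nra.
Qed.

End BarrierAlgebra.

(** * Lifespan of the ordinary differential inequality *)

Section SoundDistance.
Context {R : realType}.
Implicit Types (alpha t : R).

Definition sound alpha t : R := (t `^ (1 - alpha) - 1) / (1 - alpha).

Lemma powR_sub1 (a t : R) : 0 < t -> t `^ (a - 1) = t `^ a / t.
Proof.
move=> t0; rewrite powRB ?powRr1 ?ltW //.
by apply/implyP => _; rewrite gt_eqF.
Qed.

Lemma der_pow (a t : R) : 0 < t -> has_der (fun t => t `^ a) t (a * t `^ a / t).
Proof.
move=> t0; apply: der_eq (@is_derive1_powR _ a t t0) _.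
by rewrite powR_sub1 // mulrA.
Qed.

Lemma powR_gt0D (t a b : R) : 0 < t -> t `^ (a + b) = t `^ a * t `^ b.
Proof. by move=> t0; rewrite powRD //; apply/implyP => _; rewrite gt_eqF. Qed.

Lemma der_sound alpha t : alpha < 1 -> 0 < t -> has_der (sound alpha) t (t `^ (- alpha)).
Proof.
move=> a1 t0.
have := derM (derB (der_pow (1 - alpha) t0) (der_cst 1 t)) (der_cst (1 - alpha)^-1 t).
move/der_eq; apply; rewrite (_ : 1 - alpha = - alpha + 1) 1?addrC // powR_gt0D // powRr1 ?ltW //.
by field; rewrite (gt_eqF t0) andbT gt_eqF // addrC subr_gt0.
Qed.

Lemma sound1 alpha : sound alpha 1 = 0.
Proof. by rewrite /sound powR1 subrr mul0r. Qed.

Lemma sound_ge0 alpha t : alpha < 1 -> 1 <= t -> 0 <= sound alpha t.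
Proof.
move=> a1 t1; rewrite divr_ge0 ?subr_ge0 ?(ltW a1) //.
by rewrite -[leLHS](powRr0 t) ler_powR // subr_ge0 ltW.
Qed.

Lemma sound_le alpha s t : alpha < 1 -> 0 <= s -> s <= t -> sound alpha s <= sound alpha t.
Proof.
move=> a1 s0 st; rewrite ler_pM2r ?invr_gt0 ?subr_gt0 // lerD2r.
by rewrite ge0_ler_powR ?nnegrE ?subr_ge0 ?(ltW a1) // (le_trans s0 st).
Qed.

Lemma sound_ge alpha t : 0 <= alpha -> alpha < 1 -> 1 <= t -> t `^ (1 - alpha) - 1 <= sound alpha t.
Proof.
move=> a0 a1 t1; rewrite ler_pdivlMr ?subr_gt0 // ler_piMr //; last lra.
by rewrite subr_ge0 -[leLHS](powRr0 t) ler_powR // subr_ge0 ltW.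
Qed.

End SoundDistance.

Section RiccatiBarrier.
Context {R : realType}.
Variables (alpha mu p q eta lam phi1 : R).
Hypotheses (ha : 0 <= alpha < 1) (hp : 1 < p) (hq : 0 <= q) (heta : 0 < eta).
Let b := `|mu - alpha| / 2 + eta.
Hypotheses (hl2 : 2 <= lam) (hlb : 2 * b <= lam) (hlbe : b ^+ 2 + b <= lam * eta).
Hypothesis hphi1 : 0 < phi1 <= 1 / 2.

(* In the time s with ds = lam t^(-alpha) dt, the ratio f = t^alpha G'/(lam G) satisfies
   f' + f^2 + ((mu - alpha)/lam) tau f >= 1 + X with tau = t^(alpha-1), and
   X = (c/lam^2) t^(2 alpha - q) exp (-(p-1) lam A) G^(p-1) grows at the rate
   (p-1)(f-1) + (2 alpha - q) tau/lam. The barrier is sqrt (1 + kap X) * phi, where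
   phi rises from phi1 at t = 1 to 1 - k tau, where lam k = (mu - alpha)/2 + eta, so
   that only a factor t^(-eta) is lost in the growth of G. *)
Let kap := (5 + 2 * p)^-1.
Definition drift_rate : R := ((mu - alpha) / 2 + eta) / lam.
Let k := drift_rate.
Let D := 1 - k - phi1.
Let tau (t : R) := t `^ (alpha - 1).
Let x (t : R) := expR (- (lam / 2) * sound alpha t).
Let phi (t : R) := 1 - (k * tau t + D * x t).

Let a0 : 0 <= alpha. Proof. by case/andP: ha. Qed.
Let a1 : alpha < 1. Proof. by case/andP: ha. Qed.
Let l0 : 0 < lam. Proof. by apply: lt_le_trans hl2. Qed.
Let b0 : eta <= b. Proof. by rewrite /b lerDr divr_ge0. Qed.

Lemma norm_drift_rate : `|k| <= 1 / 2.
Proof.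
rewrite /k /drift_rate normrM (@gtr0_norm _ lam^-1) ?invr_gt0 // ler_pdivrMr //.
apply: (@le_trans _ _ b); last by have := hlb; lra.
rewrite /b (le_trans (ler_normD _ _)) // normrM (gtr0_norm heta).
by rewrite (@ger0_norm _ 2^-1) ?invr_ge0.
Qed.

Let D0 : 0 <= D <= 3 / 2.
Proof.
have := norm_drift_rate; rewrite ler_norml /D => /andP[? ?].
by case/andP: hphi1 => ? ?; apply/andP; split; lra.
Qed.

Let tau01 t : 1 <= t -> 0 < tau t <= 1.
Proof.
move=> t1; rewrite powR_gt0 ?(lt_le_trans ltr01) //=.
by rewrite -[leRHS](powRr0 t) ler_powR // subr_le0 ltW.
Qed.

(** With [lam >= 2], [exp ((lam/2) A) >= 1 + A >= t^(1-alpha)]: the transient dies at least as fast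
    as [tau]. *)
Let x_tau t : 1 <= t -> 0 < x t <= tau t.
Proof.
move=> t1; rewrite expR_gt0 /=.
have t0 : 0 < t by rewrite (lt_le_trans ltr01).
have hA := sound_ge a0 a1 t1.
have A0 := sound_ge0 a1 t1.
rewrite /tau (_ : alpha - 1 = - (1 - alpha)); last by ring.
rewrite powRN /x mulNr expRN lef_pV2 ?posrE ?expR_gt0 ?powR_gt0 //.
apply: le_trans (expR_ge1Dx _).
have := hl2; nra.
Qed.

(** [phi] is the convex combination of 1, [1 - k] and [phi1] with weights [1 - tau], [tau - x] and
    [x]; the bounds follow from [|k| <= 1/2] and [phi1 <= 1/2]. *)
Lemma barrier_profile t : 1 <= t -> phi1 <= phi t <= 3 / 2.
Proof.
move=> t1; have /andP[t0 t1'] := tau01 t1; have /andP[x0 xt] := x_tau t1.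
have := norm_drift_rate; rewrite ler_norml => /andP[k1 k2].
case/andP: hphi1 => f0 f1.
have -> : phi t = 1 - (k * (tau t - x t) + (1 - phi1) * x t).
  by rewrite /phi /D; ring.
have h1 : - (1 / 2) * (tau t - x t) <= k * (tau t - x t).
  by rewrite ler_wpM2r // subr_ge0.
have h2 : k * (tau t - x t) <= 1 / 2 * (tau t - x t).
  by rewrite ler_wpM2r // subr_ge0.
have h3 : 0 <= (1 - phi1) * x t by rewrite mulr_ge0 ?(ltW x0) //; lra.
have h4 : (1 / 2 - phi1) * (tau t - x t) >= 0 by rewrite mulr_ge0 ?subr_ge0 //; lra.
have h5 : (1 - phi1) * (1 - tau t) >= 0 by rewrite mulr_ge0 ?subr_ge0 //; lra.
by apply/andP; split; lra.
Qed.

Let phi_at1 : phi 1 = phi1.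
Proof. by rewrite /phi /tau /x /D sound1 powR1 mulr0 expR0; ring. Qed.

Let der_tau t : 0 < t -> has_der tau t ((alpha - 1) * tau t / t).
Proof. exact: der_pow. Qed.

Let der_x t : 0 < t -> has_der x t (- (lam / 2) * t `^ (- alpha) * x t).
Proof.
move=> t0; apply: der_eq (der_exp (derZ _ (der_sound a1 t0))) _.
by rewrite mulrC.
Qed.

Let der_phi t : 0 < t -> has_der phi t
  ((1 - alpha) * k * tau t / t + lam / 2 * t `^ (- alpha) * (D * x t)).
Proof.
move=> t0.
apply: der_eq (derB (der_cst 1 t) (derD (derZ k (der_tau t0)) (derZ D (der_x t0)))) _.
by ring.
Qed.

Variables (T1 c g0 : R) (G G1 G2 : R -> R).
Hypotheses (hT1 : 1 <= T1) (hc : 0 < c) (hg0 : 0 < g0).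
Hypothesis contG : forall t, 1 <= t <= T1 -> cont_in (seg 1 T1) G t.
Hypothesis contG1 : forall t, 1 <= t <= T1 -> cont_in (seg 1 T1) G1 t.
Hypothesis derG : forall t, 1 < t <= T1 -> has_der G t (G1 t).
Hypothesis derG1 : forall t, 1 < t <= T1 -> has_der G1 t (G2 t).
Hypothesis hG : g0 <= G 1.
Hypothesis hX1 : c * G 1 `^ (p - 1) <= lam ^+ 2.
Hypothesis hG1 : 2 * lam * phi1 * G 1 <= G1 1.
(** Assumed only where [G] is at least [g0]: there the nonlinear term is bounded below and can
    absorb the error of the grid. *)
Hypothesis ineq : forall t, 1 < t <= T1 -> g0 <= G t ->
  lam ^+ 2 * t `^ (- alpha) ^+ 2 * G t
   + c * t `^ (- q) * expR (- ((p - 1) * lam) * sound alpha t) * G t `^ p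
  <= G2 t + mu / t * G1 t.

Let M (t : R) := c / lam ^+ 2 * (t `^ (2 * alpha - q) * expR (- ((p - 1) * lam) * sound alpha t)).
Let X (H : R -> R) t := M t * H t `^ (p - 1).
Let F H t := Num.sqrt (1 + kap * X H t).
(** [Psi G > 0] says that the Riccati ratio lies above the barrier [F phi], multiplied by
    [lam t^(-alpha) G] to avoid a quotient. The argument [H] is [G] or a truncation of it. *)
Let Psi H t := G1 t - lam * t `^ (- alpha) * (F H t * phi t) * H t.

Let kap0 : 0 < kap. Proof. by rewrite invr_gt0; have := hp; lra. Qed.

Let M0 t : 0 < t -> 0 < M t.
Proof.
move=> t0; rewrite /M mulr_gt0 // ?divr_gt0 ?exprn_gt0 //.
by rewrite mulr_gt0 ?powR_gt0 ?expR_gt0.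
Qed.

Let der_M t : 0 < t -> has_der M t
  (M t * ((2 * alpha - q) / t - (p - 1) * lam * t `^ (- alpha))).
Proof.
move=> t0.
apply: der_eq (derZ _ (derM (der_pow (2 * alpha - q) t0)
  (der_exp (derZ _ (der_sound a1 t0))))) _.
rewrite /M; field; rewrite !gt_eqF //.
Qed.

Let der_X H h t : 0 < t -> 0 < H t -> has_der H t h -> has_der (X H) t
  (X H t * ((p - 1) * (h / H t - lam * t `^ (- alpha)) + (2 * alpha - q) / t)).
Proof.
move=> t0 H0 hH.
apply: der_eq (derM (der_M t0) (der_powR (p - 1) H0 hH)) _.
by rewrite /X (powR_sub1 (p - 1) H0); field; rewrite !gt_eqF.
Qed.

Let X0 H t : 0 < t -> 0 <= X H t.
Proof. by move=> t0; rewrite mulr_ge0 ?powR_ge0 // ltW // M0. Qed.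

Let F1 H t : 0 < t -> 1 <= F H t.
Proof.
by move=> t0; rewrite -[leLHS]sqrtr1 ler_wsqrtr // lerDl mulr_ge0 ?X0 ?(ltW kap0).
Qed.

Let FX H t : 0 < t -> F H t ^+ 2 = 1 + kap * X H t.
Proof.
move=> t0; rewrite /F sqr_sqrtr //; apply: addr_ge0 => //.
by rewrite mulr_ge0 ?X0 ?(ltW kap0).
Qed.

Let der_F H h t : 0 < t -> 0 < H t -> has_der H t h -> has_der (F H) t
  (kap * X H t / (2 * F H t) *
   ((p - 1) * (h / H t - lam * t `^ (- alpha)) + (2 * alpha - q) / t)).
Proof.
move=> t0 H0 hH.
have h1 : 0 < 1 + kap * X H t.
  by rewrite ltr_pwDl // mulr_ge0 ?X0 ?(ltW kap0).
have hd := derD (der_cst 1 t) (derZ kap (der_X t0 H0 hH)).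
apply: der_eq (@der_comp R Num.sqrt (fun s => 1 + kap * X H s) t _ _ (is_derive1_sqrt h1) hd) _.
rewrite -/(F H t); field.
by rewrite !gt_eqF // (lt_le_trans ltr01) // F1.
Qed.

Let der_Psi H h t : 1 < t <= T1 -> 0 < H t -> has_der H t h -> has_der (Psi H) t
  (G2 t - (lam * (- alpha * t `^ (- alpha) / t) * (F H t * phi t) * H t
    + lam * t `^ (- alpha) * (kap * X H t / (2 * F H t) *
   ((p - 1) * (h / H t - lam * t `^ (- alpha)) + (2 * alpha - q) / t) * phi t
     + F H t * ((1 - alpha) * k * tau t / t + lam / 2 * t `^ (- alpha) * (D * x t))) * H t
   + lam * t `^ (- alpha) * (F H t * phi t) * h)).
Proof.
move=> ht H0 hH; have t0 : 0 < t by case/andP: ht => ? _; lra.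
apply: der_eq (derB (derG1 ht) (derM (derM (derZ lam (der_pow (- alpha) t0))
  (derM (der_F t0 H0 hH) (der_phi t0))) hH)) _.
by ring.
Qed.

Let der_Psi_gt0 t d : 1 < t <= T1 -> g0 <= G t ->
  G1 t = lam * t `^ (- alpha) * (F G t * phi t) * G t ->
  has_der (Psi G) t d -> 0 < d.
Proof.
move=> ht gG e hd.
have t1 : 1 <= t by case/andP: ht => /ltW.
have t0 : 0 < t by lra.
have G0 : 0 < G t by exact: lt_le_trans gG.
rewrite (der_uniq hd (der_Psi ht G0 (derG ht))).
have at0 : 0 < t `^ (- alpha) by rewrite powR_gt0.
have etau : tau t = (t * t `^ (- alpha))^-1.
  rewrite -[X in X * _]powRr1 ?ltW // -powR_gt0D // -powRN; congr (_ `^ _); ring.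
have hin := ineq ht gG.
have eXG : c * t `^ (- q) * expR (- ((p - 1) * lam) * sound alpha t) * G t `^ p
   = lam ^+ 2 * t `^ (- alpha) ^+ 2 * X G t * G t.
  rewrite /X /M powR_sub1 //.
  have -> : t `^ (2 * alpha - q) = t `^ (- q) / t `^ (- alpha) ^+ 2.
    rewrite (_ : 2 * alpha - q = alpha + alpha - q); last by ring.
    rewrite !powR_gt0D // (powRN t alpha); field.
    by rewrite gt_eqF // powR_gt0.
  by field; rewrite !gt_eqF //=.
have /andP[ph1 ph2] := barrier_profile t1.
have hphi : 0 < phi t <= 3 / 2 by case/andP: hphi1 => ? ?; rewrite ph2 andbT; lra.
have hsc : (mu - alpha) / lam * tau t * phi t
    + ((1 - alpha) * k * tau t ^+ 2 / lam + D * x t / 2) < 1 - phi t ^+ 2.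
  apply: (barrier_scalar ha heta hl2 hlb hlbe).
  - by rewrite mulrC divfK // gt_eqF.
  - by case/andP: D0.
  - exact: tau01.
  - by case/andP: (x_tau t1) => /ltW.
  - by case/andP: hphi => + _; rewrite /phi; lra.
have hal : 0 <= alpha <= 1 by rewrite a0 ltW.
have l1 : 1 <= lam by have := hl2; lra.
have := barrier_algebra hal hp hq l1 (tau01 t1) (X0 G t0) (F1 G t0) (FX G t0) hphi hsc.
rewrite -/kap => hb.
(* The factor [lam^2 t^(-2 alpha) G] converts the inequality for the ratio, in the time s, back to
   one for [Psi] in the time t. *)
have {hb} hb := mulr_gt0 (mulr_gt0 (mulr_gt0 (exprn_gt0 2 l0) (exprn_gt0 2 at0)) G0) hb.
apply: lt_le_trans hb _.
rewrite -subr_ge0.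
move: hin; rewrite eXG -subr_ge0.
move/le_trans; apply.
rewrite le_eqVlt; apply/orP; left; apply/eqP.
rewrite e etau; field.
by rewrite !gt_eqF //= (lt_le_trans ltr01) // F1.
Qed.


(* Truncating G from below keeps the powers of G continuous before G >= g0 is known. *)
Let Gh (t : R) := Num.max g0 (G t).

Let Gh0 t : 0 < Gh t. Proof. by rewrite lt_max hg0. Qed.

Let cont_Psi t : 1 <= t <= T1 -> cont_in (seg 1 T1) (Psi Gh) t.
Proof.
move=> ht; have t0 : 0 < t by case/andP: ht => ? _; lra.
have hGh : cont_in (seg 1 T1) Gh t.
  apply: (@cont_in_comp _ _ _ (fun y => Num.max g0 y)); last exact: contG.
  by apply: (@continuous_max _ _ (cst g0) id) => //; exact: cvg_cst.
apply: cont_inB; first exact: contG1.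
apply: cont_inM => //; apply: cont_inM.
  exact: (der_cont_in (derZ lam (der_pow (- alpha) t0))).
apply: cont_inM; last exact: der_cont_in (der_phi t0).
apply: (@cont_in_comp _ _ _ Num.sqrt); first exact: sqrt_continuous.
apply: cont_inD; first exact: cont_in_cst.
apply: cont_inM; first exact: cont_in_cst.
apply: cont_inM; first exact: der_cont_in (der_M t0).
apply: (@cont_in_comp _ _ _ (fun y => y `^ (p - 1))) => //.
exact: (der_cont (der_pow (p - 1) (Gh0 t))).
Qed.

Let phi_gt0 t : 1 <= t -> 0 < phi t.
Proof. by move=> t1; case/andP: (barrier_profile t1) => h _; case/andP: hphi1 => ? _; lra. Qed.

Let G1_gt0 t : 1 <= t -> 0 < Psi Gh t -> 0 < G1 t.
Proof.
move=> t1; rewrite subr_gt0; apply: le_lt_trans.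
have t0 : 0 < t by lra.
rewrite !mulr_ge0 ?powR_ge0 ?(ltW l0) ?(ltW (Gh0 _)) ?(ltW (phi_gt0 _)) //.
by rewrite sqrtr_ge0.
Qed.

(** Closes the bootstrap: as long as [Psi Gh] is positive, [G] stays above its initial value, where
    the differential inequality is available. *)
Let G_incr t : 1 < t <= T1 -> (forall s, 1 <= s < t -> 0 < Psi Gh s) -> G 1 < G t.
Proof.
move=> /andP[t1 tT] hpos.
have [|s hs|s hs e] := @der_mvt _ 1 t G G1 t1.
- move=> s /andP[s1 st]; apply: (@cont_inW _ _ (seg 1 T1)).
    by move=> r /andP[r1 rt]; rewrite /seg /= r1 (le_trans rt).
  by apply: contG; rewrite s1 (le_trans st).
- by apply: derG; case/andP: hs => s1 st; rewrite s1 ltW // (lt_le_trans st).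
- case/andP: hs => s1 st.
  rewrite -subr_gt0 e mulr_gt0 ?subr_gt0 //.
  by apply: G1_gt0; [exact: ltW|apply: hpos; rewrite ltW].
Qed.

(** [hX1] means [X <= 1] at time 1, so [F^2 <= 1 + kap <= 2]; hence the factor 2 in [hG1] puts the
    initial ratio above the barrier. *)
Let F_at1 : F G 1 < 2.
Proof.
have h : X G 1 <= 1.
  rewrite /X /M sound1 mulr0 expR0 powR1 !mulr1 mulrAC ler_pdivrMr ?exprn_gt0 //.
  by rewrite mul1r.
have := FX G ltr01; have := F1 G ltr01; have := kap0; have k1 : kap <= 1.
  by rewrite invf_le1; have := hp; lra.
have := X0 G ltr01; nra.
Qed.

Let Psi_gt0 t : 1 <= t <= T1 -> 0 < Psi Gh t.
Proof.
apply: (first_crossing hT1 cont_Psi).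
  have e : Gh 1 = G 1 by apply/max_idPr.
  have eF : F Gh 1 = F G 1 by rewrite /F /X e.
  rewrite /Psi e eF phi_at1 powR1 mulr1 subr_gt0.
  apply: lt_le_trans hG1.
  have := F_at1; case/andP: hphi1 => f0 _ hF.
  have -> : lam * (F G 1 * phi1) * G 1 = F G 1 * (lam * phi1 * G 1) by ring.
  rewrite -!mulrA ltr_pM2r // !mulr_gt0 //.
  exact: lt_le_trans hG.
move=> s hs hpos e.
have Gs := G_incr hs hpos.
have gGs : g0 < G s by exact: le_lt_trans Gs.
have hd := der_Psi hs (lt_trans hg0 gGs) (derG hs).
(* Since [G s > g0], the truncation is inactive near [s] and the derivative of [Psi G] is also that
   of [Psi Gh]. *)
have eGh : \forall r \near s, Psi G r = Psi Gh r.
  have hc' := der_cont (derG hs).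
  have hn : \forall r \near s, g0 < G r by exact: (hc' _ (lt_nbhsr gGs)).
  apply: filterS hn => r gr.
  have eG : Gh r = G r by apply/max_idPr/ltW.
  by rewrite /Psi /F /X eG.
eexists; first exact: der_near eGh hd.
have eG : Gh s = G s by apply/max_idPr/ltW.
apply: (der_Psi_gt0 hs (ltW gGs) _ hd).
by apply/eqP; rewrite -subr_eq0 -e /Psi /F /X eG.
Qed.

Lemma riccati_barrier t : 1 <= t <= T1 ->
  g0 <= G t /\ lam * t `^ (- alpha) * (F G t * phi t) * G t < G1 t.
Proof.
move=> /andP[t1 tT].
have gG : g0 <= G t.
  move: t1; rewrite le_eqVlt => /predU1P[<-//|t1].
  apply: le_trans hG (ltW (G_incr _ _)); first by rewrite t1.
  by move=> s /andP[s1 st]; apply: Psi_gt0; rewrite s1 (ltW (lt_le_trans st tT)).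
split=> //.
have eG : Gh t = G t by apply/max_idPr.
have : 0 < Psi Gh t by apply: Psi_gt0; rewrite t1.
by rewrite /Psi /F /X eG subr_gt0.
Qed.

(** * Decay of [V] and the bound on the existence time *)

Let s := 2 * alpha - q - (p - 1) * ((mu - alpha) / 2 + eta).

(* V^(-2) is X with the linear part of its growth divided out, so that V decreases
   exactly because of the excess of sqrt (1 + kap X) over 1. *)
Let V (t : R) := (c / lam ^+ 2) `^ (- (1 / 2)) *
  (t `^ (- ((p - 1) * (lam * k) / 2)) * expR ((p - 1) / 2 * (lam * sound alpha t + 2 * D * x t))
   * G t `^ (- ((p - 1) / 2))).

Let cl0 : 0 < c / lam ^+ 2. Proof. by rewrite divr_gt0 ?exprn_gt0. Qed.

Let Gpos t : 1 <= t <= T1 -> 0 < G t.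
Proof. by move=> /riccati_barrier[h _]; exact: lt_le_trans h. Qed.

Let V0 t : 1 <= t <= T1 -> 0 < V t.
Proof.
move=> ht; have t0 : 0 < t by case/andP: ht => ? _; lra.
by rewrite !mulr_gt0 ?powR_gt0 ?expR_gt0 // Gpos.
Qed.

(** The power of [t] and the exponential in [V] come from a primitive of [lam t^(-alpha) phi]:
    [t^(-alpha) tau = 1/t] gives the power, and [2 D x] has derivative [-lam t^(-alpha) D x]. *)
Let der_V t : 1 < t <= T1 -> has_der V t
  ((p - 1) / 2 * V t * (lam * t `^ (- alpha) * (1 - k * tau t - D * x t) - G1 t / G t)).
Proof.
move=> ht; have t0 : 0 < t by case/andP: ht => ? _; lra.
have ht' : 1 <= t <= T1 by case/andP: ht => /ltW -> ->.
have G0 := Gpos ht'.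
apply: der_eq (derZ _ (derM (derM (der_pow _ t0)
  (der_exp (derZ ((p - 1) / 2) (derD (derZ lam (der_sound a1 t0)) (derZ (2 * D) (der_x t0))))))
  (der_powR (- ((p - 1) / 2)) G0 (derG ht)))) _.
have at0 : 0 < t `^ (- alpha) by rewrite powR_gt0.
have etau : tau t = (t * t `^ (- alpha))^-1.
  rewrite -[X in X * _]powRr1 ?ltW // -powR_gt0D // -powRN; congr (_ `^ _); ring.
rewrite (powR_sub1 (- ((p - 1) / 2)) G0) /V etau; field.
by rewrite !gt_eqF.
Qed.

(** Equality holds up to the factor [exp (2 (p-1) D x) >= 1]. *)
Let XV t : 1 <= t <= T1 -> t `^ s / V t ^+ 2 <= X G t.
Proof.
move=> ht; have t0 : 0 < t by case/andP: ht => ? _; lra.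
have G0 := Gpos ht.
rewrite ler_pdivrMr ?exprn_gt0 ?V0 //.
have sq (y a : R) : 0 < y -> (y `^ (- (a / 2))) ^+ 2 = (y `^ a)^-1.
  by move=> y0; rewrite expr2 -powR_gt0D // -powRN; congr (_ `^ _); field.
have sqe (a : R) : expR ((p - 1) / 2 * a) ^+ 2 = expR ((p - 1) * a).
  by rewrite expr2 -expRD; congr expR; field.
rewrite /V !exprMn sqe !sq // powRr1 ?(ltW cl0) // /X /M.
have -> : t `^ s = t `^ (2 * alpha - q) / t `^ ((p - 1) * (lam * k)).
  rewrite -powRN -powR_gt0D //; congr (_ `^ _).
  by rewrite /s /k /drift_rate; field; rewrite gt_eqF.
rewrite [leRHS](_ : _ = t `^ (2 * alpha - q) / t `^ ((p - 1) * (lam * k)) *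
   (expR (- ((p - 1) * lam) * sound alpha t) *
   expR ((p - 1) * (lam * sound alpha t + 2 * D * x t)))).
  rewrite ler_peMr ?divr_ge0 ?powR_ge0 // -expRD.
  apply: le_trans (expR_ge1Dx _); rewrite lerDl.
  have -> : - ((p - 1) * lam) * sound alpha t + (p - 1) * (lam * sound alpha t + 2 * D * x t)
     = (p - 1) * 2 * (D * x t) by ring.
  case/andP: D0 => D0' _.
  by rewrite !mulr_ge0 ?expR_ge0 //; have := hp; lra.
field; rewrite !gt_eqF ?powR_gt0 //.
Qed.


Let c1 := (p - 1) * lam * phi1 * kap / 6.

Let c1_gt0 : 0 < c1.
Proof.
case/andP: hphi1 => f0 _.
by rewrite divr_gt0 // mulr_gt0 ?kap0 // mulr_gt0 // mulr_gt0 ?subr_gt0.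
Qed.

(** [sqrt (1 + kap X) - 1] behaves like [X] for small [X] and like [sqrt X] for large [X]; the cases
    split at [X = 1]. The argument [z] will be [t^s/V^2], the known lower bound of [X]. *)
Let excess t z : 1 <= t <= T1 -> 0 <= z <= X G t ->
  kap / 3 * Num.min z (Num.sqrt z) <= F G t - 1.
Proof.
move=> ht /andP[z0 zX]; have t0 : 0 < t by case/andP: ht => ? _; lra.
have hF2 := FX G t0; have hF1 := F1 G t0; have k1 : kap <= 1.
  by rewrite invf_le1; have := hp; lra.
have k0 := kap0; have X0' := X0 G t0.
have [X1|X1] := lerP (X G t) 1.
  apply: (@le_trans _ _ (kap / 3 * X G t)).
    by rewrite ler_wpM2l ?divr_ge0 ?(ltW k0) // (le_trans _ zX) // ge_min lexx.
  have kX1 : kap * X G t <= 1 by rewrite -[leRHS]mulr1 ler_pM // ltW.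
  have F2 : F G t <= 2 by nra.
  have : (F G t - 1) * (F G t + 1) = kap * X G t by nra.
  nra.
apply: (@le_trans _ _ (kap / 3 * Num.sqrt (X G t))).
  rewrite ler_wpM2l ?divr_ge0 ?(ltW k0) //.
  by rewrite ge_min ler_wsqrtr ?orbT.
have S1 : 1 < Num.sqrt (X G t) by rewrite -[ltLHS]sqrtr1 ltr_sqrt // (lt_trans ltr01).
have S2 := sqr_sqrtr X0'.
set S := Num.sqrt _ in S1 S2 *.
have kX : kap * X G t <= S ^+ 2 by rewrite S2 ler_piMl.
have FS : F G t <= 2 * S by nra.
have e : (F G t - 1) * (F G t + 1) = kap * (S * S) by rewrite -expr2 S2; nra.
have : kap * (S * S) <= (F G t - 1) * (3 * S).
  by rewrite -e ler_wpM2l ?subr_ge0 //; lra.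
rewrite mulrA mulrA ler_pM2r; last lra.
lra.
Qed.

Let slope t := (p - 1) / 2 * V t * (lam * t `^ (- alpha) * (1 - k * tau t - D * x t) - G1 t / G t).

(** The barrier gives [V' <= -((p-1)/2) V lam t^(-alpha) phi (F - 1)]; then [phi >= phi1] and
    [excess] with [z = t^s/V^2] produce [c1]. *)
Let slope_le t : 1 <= t <= T1 ->
  slope t <= - (c1 * t `^ (- alpha) * Num.min (t `^ s / V t) (t `^ (s / 2))).
Proof.
move=> ht; have t0 : 0 < t by case/andP: ht => ? _; lra.
have t1 : 1 <= t by case/andP: ht.
have [gG hb] := riccati_barrier ht.
have G0 := Gpos ht; have Vt := V0 ht.
have at0 : 0 < t `^ (- alpha) by rewrite powR_gt0.
have hG1' : lam * t `^ (- alpha) * (F G t * phi t) <= G1 t / G t.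
  by rewrite ler_pdivlMr // ltW.
have hz0 : 0 <= t `^ s / V t ^+ 2 by rewrite divr_ge0 ?powR_ge0 ?exprn_ge0 // ltW.
have hex := excess ht (introT andP (conj hz0 (XV ht))).
have -> : Num.min (t `^ s / V t) (t `^ (s / 2)) =
   V t * Num.min (t `^ s / V t ^+ 2) (Num.sqrt (t `^ s / V t ^+ 2)).
  rewrite minr_pMr ?(ltW Vt) //; congr (Num.min _ _).
    by field; rewrite gt_eqF.
  rewrite sqrtrM ?powR_ge0 // sqrtrV ?exprn_ge0 ?(ltW Vt) // sqrtr_sqr gtr0_norm //.
  by rewrite -powR12_sqrt ?powR_ge0 // -powRrM mulrCA divff ?mulr1 // gt_eqF.
set m := Num.min _ _ in hex *.
have m0 : 0 <= m by rewrite le_min hz0 sqrtr_ge0.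
have [f1 f2] := andP (barrier_profile t1).
apply: (@le_trans _ _ ((p - 1) / 2 * V t * (lam * t `^ (- alpha) * (phi t * (1 - F G t))))).
  rewrite /slope ler_wpM2l //.
    by rewrite mulr_ge0 ?(ltW Vt) // divr_ge0 //; have := hp; lra.
  by rewrite /phi in hG1' *; lra.
have hh : phi t * (1 - F G t) <= - (phi1 * (kap / 3 * m)).
  have e1 : phi1 * (F G t - 1) <= phi t * (F G t - 1).
    by rewrite ler_wpM2r // subr_ge0 F1.
  have e2 : phi1 * (kap / 3 * m) <= phi1 * (F G t - 1).
    by rewrite ler_wpM2l //; case/andP: hphi1 => /ltW.
  lra.
have h0 : 0 <= (p - 1) / 2 * V t * (lam * t `^ (- alpha)).
  apply: mulr_ge0; last by rewrite mulr_ge0 // ltW.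
  by apply: mulr_ge0; [rewrite divr_ge0 ?subr_ge0 ?(ltW hp)|exact: ltW].
have := ler_wpM2l h0 hh.
rewrite !mulrA; move/le_trans; apply.
by rewrite /c1 le_eqVlt; apply/orP; left; apply/eqP; field.
Qed.

Let slope_le0 t : 1 <= t <= T1 -> slope t <= 0.
Proof.
move=> ht; apply: le_trans (slope_le ht) _.
rewrite oppr_le0; apply: mulr_ge0; first by rewrite mulr_ge0 ?powR_ge0 // ltW.
by rewrite le_min divr_ge0 ?powR_ge0 // ltW // V0.
Qed.

Let cont_V t : 1 <= t <= T1 -> cont_in (seg 1 T1) V t.
Proof.
move=> ht; have t0 : 0 < t by case/andP: ht => ? _; lra.
apply: cont_inM; first exact: cont_in_cst.
apply: cont_inM.
  apply: der_cont_in; apply: derM (der_pow _ t0) _.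
  exact: (der_exp (derZ ((p - 1) / 2) (derD (derZ lam (der_sound a1 t0)) (derZ (2 * D) (der_x t0))))).
apply: (@cont_in_comp _ _ _ (fun y => y `^ (- ((p - 1) / 2)))); last exact: contG.
exact: (der_cont (der_pow (- ((p - 1) / 2)) (Gpos ht))).
Qed.

Let V_noninc t : 1 <= t <= T1 -> V t <= V 1.
Proof.
move=> /andP[t1 tT]; rewrite -lerN2.
have sub r : 1 < r < t -> 1 <= r <= T1.
  by move=> /andP[/ltW -> rt]; rewrite (le_trans (ltW rt)).
apply: (@der_nondecr _ 1 t (fun t => - V t) (fun t => - slope t)); first exact: t1.
- move=> r /andP[r1 rt]; apply: cont_inN; apply: (@cont_inW _ _ (seg 1 T1)).
    by move=> y /andP[y1 yt]; rewrite /seg /= y1 (le_trans yt).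
  by apply: cont_V; rewrite r1 (le_trans rt).
- move=> r hr; apply: derN; apply: der_V.
  by case/andP: hr => -> rt; rewrite (le_trans (ltW rt)).
- by move=> r hr; rewrite oppr_ge0 slope_le0 // sub.
Qed.

(** The loss [2^(-|e|)] lets one statement serve both signs of the exponent. *)
Let powR_half (r T e : R) : 0 < T -> T / 2 <= r <= T -> 2 `^ (- `|e|) * T `^ e <= r `^ e.
Proof.
move=> T0 /andP[hr rT]; have r0 : 0 < r by lra.
have [e0|e0] := lerP 0 e.
  apply: (@le_trans _ _ ((T / 2) `^ e)).
    rewrite powRM ?(ltW T0) ?invr_ge0 // mulrC ler_wpM2l ?powR_ge0 //.
    by rewrite (ger0_norm e0) -(@powR_inv1 _ 2) // -powRrM mulN1r.
  by rewrite ge0_ler_powR ?nnegrE //; lra.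
rewrite (ltr0_norm e0) opprK.
apply: (@le_trans _ _ (T `^ e)).
  by rewrite ler_piMl ?powR_ge0 // -[leRHS](powRr0 2) ler_powR ?ler1n // ltW.
rewrite -[e]opprK !(powRN _ (- e)) lef_pV2 ?posrE ?powR_gt0 //.
by rewrite ge0_ler_powR ?nnegrE ?oppr_ge0 ?(ltW e0) ?(ltW r0) ?(ltW T0).
Qed.

Let E := 1 + alpha - q - (p - 1) * ((mu - alpha) / 2 + eta).
Hypothesis hE : 0 < E.

Let Es : E = 1 - alpha + s. Proof. by rewrite /E /s; ring. Qed.

(** [c1] reduced by the loss of [powR_half] and by the length [T1/2] of the interval used in
    [V1_large]. *)
Let c2 := c1 * 2 `^ (- `|s|) / 2.

Let c2_gt0 : 0 < c2. Proof. by rewrite divr_gt0 // mulr_gt0 ?powR_gt0 //. Qed.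

(** As [V] stays positive and does not increase, its drop over [[T1/2, T1]] is at most [V 1]; the
    mean value theorem replaces the integration of powers. If the first entry of the minimum is
    active, [V(1)^2 >= c2 T1^(1-alpha+s)], with exponent [E]. If the second is,
    [V(1) >= c2 T1^(1-alpha+s/2)], whose square has exponent [E + 1 - alpha]. *)
Let V1_large : 2 <= T1 -> Num.min c2 (c2 ^+ 2) * T1 `^ E <= V 1 ^+ 2.
Proof.
move=> T2; have T0 : 0 < T1 by lra.
have hT : T1 / 2 < T1 by lra.
have [|r hr|r hr e] := @der_mvt _ (T1 / 2) T1 V slope hT.
- move=> r /andP[r1 rT]; apply: (@cont_inW _ _ (seg 1 T1)).
    by move=> y /andP[y1 yT]; rewrite /seg /= yT andbT; lra.
  by apply: cont_V; rewrite rT andbT; lra.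
- by apply: der_V; case/andP: hr => ? ?; apply/andP; split; lra.
have hr' : T1 / 2 <= r <= T1 by case/andP: hr => ? ?; apply/andP; split; lra.
have hr1 : 1 <= r <= T1 by case/andP: hr => ? ?; apply/andP; split; lra.
have hT1' : 1 <= T1 <= T1 by rewrite lexx hT1.
have hT2' : 1 <= T1 / 2 <= T1 by apply/andP; split; lra.
have V1 : 0 < V 1 by apply: V0; rewrite lexx.
have hsl := slope_le hr1.
have r0 : 0 < r by case/andP: hr => ? ?; lra.
set m := Num.min (T1 `^ s / V 1) (T1 `^ (s / 2)).
have m0 : 0 <= m by rewrite le_min divr_ge0 ?powR_ge0 // ltW.
have k2 : 0 <= 2 `^ (- `|s|) :> R by exact: powR_ge0.
have hm : 2 `^ (- `|s|) * m <= Num.min (r `^ s / V r) (r `^ (s / 2)).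
  rewrite le_min; apply/andP; split.
    apply: (@le_trans _ _ (2 `^ (- `|s|) * (T1 `^ s / V 1))).
      by rewrite ler_wpM2l // ge_min lexx.
    rewrite mulrA; apply: ler_pM; rewrite ?mulr_ge0 ?powR_ge0 ?invr_ge0 ?(ltW V1) //.
      exact: powR_half.
    by have Vr := V0 hr1; rewrite lef_pV2 ?posrE //; exact: V_noninc.
  apply: (@le_trans _ _ (2 `^ (- `|s / 2|) * T1 `^ (s / 2))); last exact: powR_half.
  apply: ler_pM => //.
    rewrite ler_powR ?ler1n // lerN2 normrM (@ger0_norm _ 2^-1) ?invr_ge0 //.
    by rewrite ler_pdivrMr // ler_peMr // ler1n.
  by rewrite ge_min lexx orbT.
have ha' : T1 `^ (- alpha) <= r `^ (- alpha).
  rewrite !powRN lef_pV2 ?posrE ?powR_gt0 //.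
  by rewrite ge0_ler_powR ?nnegrE ?(ltW r0) ?(ltW T0) //; case/andP: hr'.
have hV1 : c2 * T1 `^ (1 - alpha) * m <= V 1.
  have hlow : c1 * T1 `^ (- alpha) * (2 `^ (- `|s|) * m) <= - slope r.
    rewrite lerNr; apply: le_trans hsl _; rewrite lerN2.
    apply: ler_pM; [by rewrite mulr_ge0 ?powR_ge0 // ltW|by rewrite mulr_ge0| |exact: hm].
    by rewrite ler_wpM2l // ltW.
  have hV2 := V_noninc hT2'; have hVT := V0 hT1'.
  apply: (@le_trans _ _ (- slope r * (T1 / 2))); last by lra.
  apply: le_trans (ler_wpM2r _ hlow); last by lra.
  rewrite /c2 (_ : 1 - alpha = - alpha + 1); last by ring.
  by rewrite powR_gt0D // powRr1 ?(ltW T0) // le_eqVlt; apply/orP; left; apply/eqP; field.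
have [hmin|hmin] := lerP (T1 `^ s / V 1) (T1 `^ (s / 2)).
  move: hV1; rewrite /m (min_idPl hmin) mulrA ler_pdivrMr // => hV1.
  apply: le_trans hV1; rewrite -mulrA -powR_gt0D // -Es.
  by rewrite ler_wpM2r ?powR_ge0 // ge_min lexx.
move: hV1; rewrite /m (min_idPr (ltW hmin)) -mulrA -powR_gt0D // => hV1.
apply: (@le_trans _ _ ((c2 * T1 `^ (1 - alpha + s / 2)) ^+ 2)); last first.
  by rewrite lerXn2r ?nnegrE ?(ltW V1) // mulr_ge0 ?powR_ge0 // ltW.
have c22 : 0 < c2 ^+ 2 by exact: exprn_gt0.
rewrite (exprMn_comm _ (mulrC c2 _)); apply: ler_pM.
- by rewrite le_min; apply/andP; split; exact: ltW.
- exact: powR_ge0.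
- by rewrite ge_min lexx orbT.
- rewrite expr2 -powR_gt0D // ler_powR // Es.
  by have := a1; lra.
Qed.

(** One summand for [T1 <= 2], the other from [V1_large]. Neither [T1], [c], [g0] nor [G] enters, so
    the constant can be fixed before the solution and the grid. *)
Definition lifespan_const : R :=
  lam ^+ 2 * (2 `^ E + expR ((p - 1) * (2 * D)) / Num.min c2 (c2 ^+ 2)).

Lemma ode_lifespan_bound : T1 `^ E * (c * g0 `^ (p - 1)) <= lifespan_const.
Proof.
have T0 : 0 < T1 by exact: lt_le_trans hT1.
have hg : c * g0 `^ (p - 1) <= c * G 1 `^ (p - 1).
  rewrite ler_wpM2l ?(ltW hc) // ge0_ler_powR ?nnegrE ?(ltW hg0) ?subr_ge0 ?(ltW hp) //.
  by rewrite (le_trans (ltW hg0)).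
have c20 : 0 < Num.min c2 (c2 ^+ 2) by rewrite lt_min c2_gt0 exprn_gt0.
have hconst : 0 <= lam ^+ 2 * (expR ((p - 1) * (2 * D)) / Num.min c2 (c2 ^+ 2)).
  by rewrite mulr_ge0 ?divr_ge0 ?expR_ge0 ?(ltW c20) // exprn_ge0 // ltW.
have hconst2 : 0 <= lam ^+ 2 * 2 `^ E by rewrite mulr_ge0 ?powR_ge0 // exprn_ge0 // ltW.
have [T2|T2] := lerP T1 2.
  apply: (@le_trans _ _ (2 `^ E * lam ^+ 2)); last by rewrite /lifespan_const mulrDr; lra.
  apply: ler_pM; rewrite ?powR_ge0 ?mulr_ge0 ?powR_ge0 ?(ltW hc) //.
    by rewrite ge0_ler_powR ?nnegrE ?(ltW hE) ?(ltW T0).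
  exact: le_trans hX1.
have h := V1_large (ltW T2).
have G10 : 0 < G 1 by exact: lt_le_trans hG.
(* At time 1 [V^2] is explicit, with [x 1 = 1] contributing [exp ((p-1) 2 D)]; so the lower bound on
   [V 1] becomes an upper bound on [T1]. *)
have eV : V 1 ^+ 2 * (c * G 1 `^ (p - 1)) = lam ^+ 2 * expR ((p - 1) * (2 * D)).
  have sq (y a : R) : 0 < y -> (y `^ (- (a / 2))) ^+ 2 = (y `^ a)^-1.
    by move=> y0; rewrite expr2 -powR_gt0D // -powRN; congr (_ `^ _); field.
  have sqe (a : R) : expR ((p - 1) / 2 * a) ^+ 2 = expR ((p - 1) * a).
    by rewrite expr2 -expRD; congr expR; field.
  rewrite /V !exprMn sqe !sq // powRr1 ?(ltW cl0) // powR1 /x sound1 !mulr0 add0r expR0 mulr1.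
  by field; rewrite !gt_eqF ?powR_gt0.
apply: (@le_trans _ _ (lam ^+ 2 * (expR ((p - 1) * (2 * D)) / Num.min c2 (c2 ^+ 2)))); last first.
  by rewrite /lifespan_const mulrDr; lra.
rewrite [leRHS]mulrA ler_pdivlMr //.
apply: (@le_trans _ _ (V 1 ^+ 2 * (c * G 1 `^ (p - 1)))); last by rewrite eV.
rewrite mulrAC (mulrC (T1 `^ E)); apply: ler_pM => //.
- by rewrite mulr_ge0 ?powR_ge0 // ltW.
- by rewrite mulr_ge0 ?powR_ge0 // ltW.
Qed.
End RiccatiBarrier.

(** * Riemann sums on a grid *)

Section PowerTangent.
Context {R : realType}.

(** Young's inequality with exponents [p] and [p/(p-1)], applied to [y] and [m^(p-1)]. *)
Lemma powR_tangent (p m y : R) : 1 < p -> 0 < m -> 0 <= y ->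
  p * m `^ (p - 1) * y - (p - 1) * m `^ p <= y `^ p.
Proof.
move=> p1 m0 y0.
have p0 : 0 < p by lra.
have q0 : 0 < p / (p - 1) by rewrite divr_gt0 // subr_gt0.
have hpq : p^-1 + (p / (p - 1))^-1 = 1.
  by field; rewrite !gt_eqF // subr_gt0.
have := conjugate_powR y0 (powR_ge0 m (p - 1)) p0 q0 hpq.
rewrite -powRrM (_ : (p - 1) * (p / (p - 1)) = p); last first.
  by field; rewrite gt_eqF // subr_gt0.
rewrite -(ler_pM2l p0) mulrDr.
rewrite (_ : p * (y `^ p / p) = y `^ p); last by field; rewrite gt_eqF.
rewrite (_ : p * (m `^ p / (p / (p - 1))) = (p - 1) * m `^ p); last first.
  by field; rewrite !gt_eqF // subr_gt0.
rewrite (mulrC y) mulrA; lra.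
Qed.

End PowerTangent.

Section Grid.
Context {R : realType}.
Variables (n : nat) (L : R) (N : nat).
Hypothesis L0 : 0 < L.

Definition step : R := 2 * L / N.+1%:R.
(** Left endpoints of the cells; [node N.+1 = L] is the right face and lies outside the grid. *)
Definition node (m : nat) : R := - L + step * m%:R.
Definition gpt (k : {ffun 'I_n -> 'I_N.+1}) : 'rV[R]_n := \row_j node (k j).
Definition gsum (f : 'rV[R]_n -> R) : R := step ^+ n * \sum_k f (gpt k).
Definition lsum (a : R -> R) : R := step * \sum_(m < N.+1) a (node m).
Definition in_box (x : 'rV[R]_n) := forall j, `|x 0 j| <= L.

Let h0 : 0 < step. Proof. by rewrite divr_gt0 // mulr_gt0. Qed.

Lemma node0 : node 0 = - L. Proof. by rewrite /node mulr0 addr0. Qed.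

Lemma node_max : node N.+1 = L.
Proof. by rewrite /node /step mulfVK ?pnatr_eq0 //; ring. Qed.

Lemma nodeS m : node m.+1 = node m + step.
Proof. by rewrite /node -addn1 natrD mulrDr mulr1 addrA. Qed.

Lemma node_box m : (m <= N.+1)%N -> `|node m| <= L.
Proof.
move=> mN; rewrite ler_norml; apply/andP; split.
  by rewrite /node lerDl mulr_ge0 // ltW.
by rewrite -[leRHS]node_max /node lerD2l ler_wpM2l ?ler_nat // ltW.
Qed.

Lemma gpt_box k : in_box (gpt k).
Proof. by move=> j; rewrite mxE node_box // ltnW. Qed.

Lemma gsumD f g : gsum (fun x => f x + g x) = gsum f + gsum g.
Proof. by rewrite /gsum big_split mulrDr. Qed.

Lemma gsumZ c f : gsum (fun x => c * f x) = c * gsum f.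
Proof. by rewrite /gsum -mulr_sumr mulrCA. Qed.

Lemma gsumB f g : gsum (fun x => f x - g x) = gsum f - gsum g.
Proof. by rewrite /gsum sumrB mulrBr. Qed.

Lemma gsum_sum (I : Type) (r : seq I) (F : I -> 'rV[R]_n -> R) :
  gsum (fun x => \sum_(i <- r) F i x) = \sum_(i <- r) gsum (F i).
Proof. by rewrite /gsum exchange_big /= mulr_sumr. Qed.

Lemma gsum_le f g : (forall x, in_box x -> f x <= g x) -> gsum f <= gsum g.
Proof.
move=> fg; rewrite ler_wpM2l ?exprn_ge0 ?(ltW h0) //.
by apply: ler_sum => k _; apply: fg; exact: gpt_box.
Qed.

Lemma eq_gsum f g : (forall x, in_box x -> f x = g x) -> gsum f = gsum g.
Proof. by move=> fg; congr (_ * _); apply: eq_bigr => k _; apply: fg; exact: gpt_box. Qed.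

Lemma gsum_ge0 f : (forall x, in_box x -> 0 <= f x) -> 0 <= gsum f.
Proof.
move=> f0; rewrite mulr_ge0 ?exprn_ge0 ?(ltW h0) //.
by apply: sumr_ge0 => k _; apply: f0; exact: gpt_box.
Qed.

Lemma gsum_cst c : gsum (fun=> c) = (2 * L) ^+ n * c.
Proof.
rewrite /gsum sumr_const card_ffun !card_ord -[c *+ _]mulr_natl mulrA; congr (_ * _).
by rewrite natrX -exprMn /step mulfVK // pnatr_eq0.
Qed.

Lemma gsum_prod (a : 'I_n -> R -> R) :
  gsum (fun x : 'rV[R]_n => \prod_j a j (x 0 j)) = \prod_j lsum (a j).
Proof.
rewrite /gsum /lsum big_split /= prodr_const card_ord; congr (_ * _).
rewrite bigA_distr_bigA /=; apply: eq_bigr => k _.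
by apply: eq_bigr => j _; rewrite mxE.
Qed.

Lemma der_gsum (f : R -> 'rV[R]_n -> R) (d : 'rV[R]_n -> R) (t : R) :
  (forall x, has_der (fun s => f s x) t (d x)) -> has_der (fun s => gsum (f s)) t (gsum d).
Proof. by move=> hf; apply: derZ; apply: der_sum => k; exact: hf. Qed.

Lemma cont_in_gsum (A : set R) (f : R -> 'rV[R]_n -> R) (t : R) :
  (forall x, cont_in A (fun s => f s x) t) -> cont_in A (fun s => gsum (f s)) t.
Proof.
move=> hf; apply: cont_inM; first exact: cont_in_cst.
by apply: cont_in_sum => k; exact: hf.
Qed.

(* Shifting one index cyclically permutes the grid, and the wrap-around is
   harmless because f vanishes on the two faces it identifies. *)
Lemma gsum_div (i : 'I_n) (f g : 'rV[R]_n -> R) (w : R) :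
  (forall x s, has_der (fun s => f (x + s *: delta_mx 0 i)) s (g (x + s *: delta_mx 0 i))) ->
  (forall x : 'rV[R]_n, `|x 0 i| = L -> f x = 0) ->
  (forall x y : 'rV[R]_n, in_box x -> in_box y -> (forall j, `|x 0 j - y 0 j| <= step) ->
     `|g x - g y| <= w) ->
  `|gsum g| <= (2 * L) ^+ n * w.
Proof.
move=> hf f0 hw.
pose S (k : {ffun 'I_n -> 'I_N.+1}) : {ffun 'I_n -> 'I_N.+1} :=
  [ffun j => if j == i then ordS (k j) else k j].
have Sinj : injective S.
  move=> k1 k2 /ffunP e; apply/ffunP => j; have := e j; rewrite !ffunE.
  by case: eqP => // _; exact: ordS_inj.
have hsum : \sum_k (f (gpt k + step *: delta_mx 0 i) - f (gpt k)) = 0.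
  rewrite sumrB; apply/eqP; rewrite subr_eq0; apply/eqP.
  rewrite [RHS](reindex_inj Sinj) /=; apply: eq_bigr => k _.
  have [kN|kN] := ltnP (k i) N.
    congr f; apply/rowP => j; rewrite !mxE eqxx /= ffunE.
    case: eqVneq => [->|_]; last by rewrite mulr0 addr0.
    by rewrite mulr1 /= modn_small // nodeS.
  have ek : val (k i) = N by apply/eqP; rewrite eqn_leq kN -ltnS ltn_ord.
  rewrite !f0 // !mxE ?eqxx.
    by rewrite ffunE eqxx /= ek modnn node0 normrN gtr0_norm.
  by rewrite mulr1 -nodeS ek node_max gtr0_norm.
have hpt k : `|step * g (gpt k) - (f (gpt k + step *: delta_mx 0 i) - f (gpt k))| <= step * w.
  have [|s _|c hc] := @der_mvt _ 0 step (fun s => f (gpt k + s *: delta_mx 0 i))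
    (fun s => g (gpt k + s *: delta_mx 0 i)) h0.
  - by move=> s _; exact: der_cont_in (hf (gpt k) s).
  - exact: hf.
  rewrite scale0r addr0 subr0 => ->; rewrite (mulrC _ step) -mulrBr normrM gtr0_norm //.
  rewrite ler_wpM2l ?(ltW h0) //; apply: hw; first exact: gpt_box.
    move=> j; rewrite !mxE eqxx /=; case: eqVneq => [->|_]; last first.
      by rewrite mulr0 addr0 node_box // ltnW.
    rewrite mulr1; case/andP: hc => c0 c1.
    have := node_box (ltnW (ltn_ord (k i))); have := @node_box (k i).+1 (ltn_ord _).
    by rewrite nodeS !ler_norml => /andP[_ ?] /andP[? _]; apply/andP; split; lra.
  move=> j; rewrite !mxE eqxx /= opprD addrA subrr sub0r normrN.
  case/andP: hc => c0 c1; case: eqVneq => _; last by rewrite mulr0 normr0 ltW.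
  by rewrite mulr1 gtr0_norm // ltW.
have : `|step * \sum_k g (gpt k)| <= \sum_(k : {ffun 'I_n -> 'I_N.+1}) step * w.
  have -> : step * \sum_k g (gpt k) = \sum_k (step * g (gpt k)
      - (f (gpt k + step *: delta_mx 0 i) - f (gpt k))).
    by rewrite sumrB hsum subr0 mulr_sumr.
  by apply: le_trans (ler_norm_sum _ _ _) _; apply: ler_sum => k _; exact: hpt.
rewrite -mulr_sumr normrM gtr0_norm // ler_pM2l // => hg.
rewrite /gsum normrM gtr0_norm ?exprn_gt0 // -gsum_cst /gsum.
by rewrite ler_wpM2l // exprn_ge0 // ltW.
Qed.

Lemma telescope_nodes (Phi : R -> R) :
  \sum_(m < N.+1) (Phi (node m + step) - Phi (node m)) = Phi L - Phi (- L).
Proof.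
have := telescope_sumr (fun m => Phi (node m)) (leq0n N.+1).
rewrite node_max node0 => <-; rewrite big_mkord.
by apply: eq_bigr => m _; rewrite nodeS.
Qed.

Lemma lsum_le_telescope (a Phi : R -> R) (c : R) :
  (forall s, step * a s <= c * (Phi (s + step) - Phi s)) ->
  lsum a <= c * (Phi L - Phi (- L)).
Proof.
move=> ha; rewrite -telescope_nodes mulr_sumr /lsum mulr_sumr.
by apply: ler_sum => m _; exact: ha.
Qed.

(** The clamp of [s] to [[y - r, y + r]] increases by [2 r] over the box; a cell adds at most
    [step], and nothing unless its node is within [r + step <= 2 r] of [y]. *)
Lemma lsum_count (y r : R) : 0 < r -> step <= r -> - L <= y - r -> y + r <= L ->
  2 * r <= lsum (fun s => (`|s - y| <= 2 * r)%R%:R).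
Proof.
move=> r0 hr Ly yL.
pose Phi s := Num.min (Num.max s (y - r)) (y + r).
have e : 2 * r = Phi L - Phi (- L).
  rewrite /Phi (max_idPl _); last lra.
  by rewrite (min_idPr yL) (max_idPr Ly) (min_idPl _); lra.
rewrite [leLHS]e -telescope_nodes /lsum mulr_sumr.
apply: ler_sum => m _; rewrite /Phi.
case: (lerP `|node m - y| (2 * r)) => [_|]; rewrite ?mulr1 ?mulr0.
  have := h0; move: (node m) => s hs; case: (lerP s (y - r)) => ?; case: (lerP (s + step) (y - r)) => ?;
    by repeat match goal with |- context [Num.min ?a ?b] => case: (lerP a b) => ? end; lra.
have := h0; rewrite real_ltr_normr ?num_real // => hs /orP[] hm.
  rewrite !(max_idPl _) ?(min_idPr _) //; lra.
rewrite !(max_idPr _) ?subrr //; lra.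
Qed.

(** Comparison with the increments of [S atan ((s - y)/S)], [S = sqrt rho], whose total variation is
    below [pi S] whatever the box. One has [exp (-z^2) <= 1/(1 + z^2)], and within a cell [z] moves
    by at most 1, which costs the factor 3. *)
Lemma lsum_gauss (lam rho y : R) : 2 <= lam -> 1 <= rho -> step <= 1 ->
  lsum (fun s => expR (- (lam * (s - y) ^+ 2 / (2 * rho)))) <= 3 * pi * Num.sqrt rho.
Proof.
move=> l2 r1 s1.
pose S := Num.sqrt rho.
have S1 : 1 <= S by rewrite -[leLHS]sqrtr1 ler_wsqrtr.
have S0 : 0 < S by lra.
have eS : rho = S ^+ 2 by rewrite sqr_sqrtr //; lra.
pose Phi s := S * atan ((s - y) / S).
apply: (@le_trans _ _ (3 * (Phi L - Phi (- L)))); last first.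
  rewrite -mulrA ler_wpM2l // -/S (mulrC pi) -mulrBr ler_wpM2l ?(ltW S0) //.
  have := atan_ltpi2 ((L - y) / S); have := atan_gtNpi2 ((- L - y) / S); lra.
apply: lsum_le_telescope => s.
have hd t : has_der Phi t (1 + ((t - y) / S) ^+ 2)^-1.
  have hlin : has_der (fun t => (t - y) / S) t (1 / S).
    apply: der_eq (derM (derB (der_id t) (der_cst y t)) (der_cst S^-1 t)) _; ring.
  apply: der_eq (derZ S (@der_comp R atan (fun t => (t - y) / S) t _ _
    (is_derive1_atan ((t - y) / S)) hlin)) _.
  by rewrite mul1r mulrCA divff ?mulr1 // gt_eqF.
have [|t _|c /andP[c0 c1] ->] := @der_mvt _ s (s + step) Phi _ _ _ (fun t _ => hd t).
- by rewrite ltrDl.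
- exact: der_cont_in (hd t).
rewrite [X in _ * (_ * X)](_ : _ = step); last by ring.
rewrite mulrA mulrC ler_pM2r //.
set z := (s - y) / S.
have hz : ((c - y) / S) ^+ 2 <= 2 * z ^+ 2 + 2.
  have -> : (c - y) / S = z + (c - s) / S by rewrite /z; field; rewrite gt_eqF.
  have w0 : 0 <= (c - s) / S by rewrite divr_ge0 ?(ltW S0) //; lra.
  have w1 : (c - s) / S <= 1 by rewrite ler_pdivrMr //; lra.
  have := sqr_ge0 (z - (c - s) / S); nra.
apply: (@le_trans _ _ (expR (- (z ^+ 2)))).
  rewrite ler_expR lerN2 eS /z.
  rewrite (_ : ((s - y) / S) ^+ 2 = 2 * (s - y) ^+ 2 / (2 * S ^+ 2)); last first.
    by field; rewrite gt_eqF.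
  by rewrite ler_pM2r ?invr_gt0 ?mulr_gt0 ?exprn_gt0 // ler_wpM2r ?sqr_ge0.
have z2 := sqr_ge0 z.
apply: (@le_trans _ _ (1 + z ^+ 2)^-1).
  rewrite expRN lef_pV2 ?posrE ?expR_gt0 ?expR_ge1Dx //; lra.
rewrite -[leLHS]mul1r ler_pdivrMr; last lra.
rewrite -mulrA mulrC -mulrA ler_pdivlMl; last by have := sqr_ge0 ((c - y) / S); lra.
nra.
Qed.

Lemma enorm_ge0 (x : 'rV[R]_n) : 0 <= enorm x. Proof. exact: sqrtr_ge0. Qed.

Lemma enorm_sqr (x : 'rV[R]_n) : enorm x ^+ 2 = \sum_j x 0 j ^+ 2.
Proof. by rewrite sqr_sqrtr //; apply: sumr_ge0 => j _; exact: sqr_ge0. Qed.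

(* On |x| <= rho, 2 rho x_0 <= 2 rho^2 - |x - rho e_0|^2, which dominates the plane
   wave by a product of one-dimensional Gaussians. *)
Lemma gsum_wave_mass (i0 : 'I_n) (lam rho : R) : 2 <= lam -> 1 <= rho -> step <= 1 ->
  gsum (fun x => (enorm x <= rho)%R%:R * expR (lam * x 0 i0))
  <= expR (lam * rho) * (3 * pi * Num.sqrt rho) ^+ n.
Proof.
move=> l2 r1 s1.
pose a (j : 'I_n) (s : R) := expR (- (lam * (s - rho *+ (j == i0)) ^+ 2 / (2 * rho))).
apply: (@le_trans _ _ (expR (lam * rho) * \prod_j lsum (a j))); last first.
  rewrite ler_wpM2l ?expR_ge0 //.
  rewrite -[X in _ <= _ ^+ X]card_ord -prodr_const; apply: ler_prod => j _.
  rewrite lsum_gauss // andbT mulr_ge0 ?(ltW h0) //.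
  by apply: sumr_ge0 => m _; exact: expR_ge0.
rewrite -gsum_prod -gsumZ; apply: gsum_le => x _.
have [hx|_] := boolP (enorm x <= rho); last first.
  by rewrite mul0r mulr_ge0 ?expR_ge0 // prodr_ge0 // => j _; exact: expR_ge0.
rewrite mul1r -expR_sum -expRD ler_expR -lerBlDl.
have e : \sum_j (x 0 j - rho *+ (j == i0)) ^+ 2 = enorm x ^+ 2 - 2 * rho * x 0 i0 + rho ^+ 2.
  rewrite enorm_sqr (bigD1 i0) //= [in RHS](bigD1 i0) //= eqxx mulr1n.
  rewrite (eq_bigr (fun j => x 0 j ^+ 2)); first by rewrite ?mulr1n; ring.
  by move=> j /negbTE ->; rewrite subr0.
rewrite sumrN -mulr_suml -mulr_sumr e.
have hx2 : enorm x ^+ 2 <= rho ^+ 2.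
  by rewrite lerXn2r ?nnegrE ?enorm_ge0 //; lra.
rewrite lerNr ler_pdivrMr; last lra.
nra.
Qed.

(** The weight is not normalized: the tangent is taken at [m = S/M], and [gsum w <= M] enters
    through the negative term of [powR_tangent]. *)
Lemma gsum_jensen (p M : R) (w y : 'rV[R]_n -> R) : 1 < p -> 0 < M ->
  (forall x, 0 <= w x) -> (forall x, 0 <= y x) -> gsum w <= M ->
  gsum (fun x => w x * y x) `^ p <= M `^ (p - 1) * gsum (fun x => w x * y x `^ p).
Proof.
move=> p1 M0 w0 y0 wM.
set S := gsum (fun x => w x * y x).
have S0 : 0 <= S by apply: gsum_ge0 => x _; rewrite mulr_ge0.
have hr0 : 0 <= M `^ (p - 1) * gsum (fun x => w x * y x `^ p).
  by rewrite mulr_ge0 ?powR_ge0 //; apply: gsum_ge0 => x _; rewrite mulr_ge0 ?powR_ge0.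
move: S0; rewrite le_eqVlt => /predU1P[<-|S0].
  by rewrite powR0 // gt_eqF //; lra.
pose m := S / M; have m0 : 0 < m by rewrite divr_gt0.
have h : p * m `^ (p - 1) * S - (p - 1) * m `^ p * M <= gsum (fun x => w x * y x `^ p).
  apply: (@le_trans _ _ (p * m `^ (p - 1) * S - (p - 1) * m `^ p * gsum w)).
    rewrite lerD2l lerN2 ler_wpM2l // mulr_ge0 ?powR_ge0 //; lra.
  rewrite -!gsumZ -gsumB; apply: gsum_le => x _.
  have := ler_wpM2l (w0 x) (powR_tangent p1 m0 (y0 x)).
  by apply: le_trans; rewrite le_eqVlt; apply/orP; left; apply/eqP; ring.
have h2 := ler_wpM2l (powR_ge0 M (p - 1)) h.
apply: le_trans h2.
have eS : S = m * M by rewrite /m divfK // gt_eqF.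
have em : m `^ p = m `^ (p - 1) * m.
  by rewrite mulrC mulr_powRB1 // ?ltW //; lra.
have eM : M `^ p = M `^ (p - 1) * M.
  by rewrite mulrC mulr_powRB1 // ?ltW //; lra.
rewrite {1}eS powRM ?(ltW m0) ?(ltW M0) // eM em eS.
by rewrite le_eqVlt; apply/orP; left; apply/eqP; ring.
Qed.

(** The indicator of a cube is a product, so its grid sum factors into one-dimensional counts. The
    bound is the same for all fine grids. *)
Lemma gsum_lower (f : 'rV[R]_n -> R) (y : 'rV[R]_n) (r m : R) :
  0 < r -> step <= r -> (forall j, - L <= y 0 j - r) -> (forall j, y 0 j + r <= L) ->
  0 <= m -> (forall x, 0 <= f x) -> (forall x : 'rV[R]_n, (forall j, `|x 0 j - y 0 j| <= 2 * r) -> m <= f x) ->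
  (2 * r) ^+ n * m <= gsum f.
Proof.
move=> r0 hr hL1 hL2 m0 f0 fm.
apply: (@le_trans _ _ (gsum (fun x => m * \prod_j (`|x 0 j - y 0 j| <= 2 * r)%R%:R))).
  rewrite gsumZ (gsum_prod (fun j s => (`|s - y 0 j| <= 2 * r)%R%:R)) mulrC ler_wpM2l //.
  rewrite -[X in _ ^+ X <= _]card_ord -prodr_const; apply: ler_prod => j _.
  by rewrite mulr_ge0 ?(ltW r0) //= lsum_count.
apply: gsum_le => x _.
have [/forallP hx|/forallPn[j hj]] := boolP [forall j, `|x 0 j - y 0 j| <= 2 * r].
  by rewrite big1 ?mulr1; [exact: fm|move=> j _; rewrite hx].
by rewrite (bigD1 j) //= (negbTE hj) mul0r mulr0.
Qed.

End Grid.

Lemma step_small (R : realType) (L d : R) : 0 < d -> exists N, step L N <= d.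
Proof.
move=> d0; exists (Num.truncn (2 * L / d)).
rewrite /step ler_pdivrMr // (mulrC d) -ler_pdivrMr //.
by apply: ltW; apply: truncnS_gt.
Qed.

(** * Calculus on the slab *)

Section SlabCalculus.
Context {R : realType} {n : nat}.

Lemma dist_half (a b c e : R) : `|c - a| < e / 2 -> `|c - b| < e / 2 -> `|a - b| <= e.
Proof.
by move=> h1 h2; have := ler_distD c a b; rewrite (distrC a c); lra.
Qed.

Implicit Types (f : R * 'rV[R]_n -> R) (T : \bar R) (t : R) (x : 'rV[R]_n).

Let cvg_within_full (S : set R) (g : R -> R) (l : R) :
  (\forall h \near 0^', S h) -> g @ within S 0^' --> l -> g @ 0^' --> l.
Proof.
move=> hS hg P hP; have := hg P hP; rewrite /within /= /nbhs /=.
by move=> h; near=> y; near: y; move: hS h; apply: filterS2 => y Sy; apply.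
Unshelve. all: by end_near. Qed.

Let has_derI (g : R -> R) (s l : R) :
  (fun h => h^-1 *: (g (h + s) - g s)) @ 0^' --> l -> has_der g s l.
Proof.
move=> hl.
have e : (fun h => h^-1 *: ((g \o shift s) (h *: (1 : R)) - g s)) =
   (fun h => h^-1 *: (g (h + s) - g s)).
  by apply/funext => h /=; rewrite /GRing.scale /= mulr1.
apply: DeriveDef; first by rewrite /derivable e; apply/cvg_ex; exists l.
by rewrite /derive e; exact: cvg_lim hl.
Qed.

(** For [1 < t < T] all small increments stay in the slab, so the relative derivative is the
    ordinary one. As [T] may be infinite, a real [T'] is inserted. *)
Lemma der_dt T f t x : 1 < t -> (t%:E < T)%E ->
  derivable_in (slab T) f (t, x) (st_t R n) ->
  has_der (fun s => f (s, x)) t (dt T f (t, x)).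
Proof.
move=> t1 tT hd; apply: has_derI.
have e : (fun h => h^-1 *: (f (h + t, x) - f (t, x))) =
  (fun h : R => h^-1 *: ((f \o shift (t, x)) (h *: st_t R n) - f (t, x))).
  apply/funext => h /=; congr (_ *: (f _ - _)).
  rewrite /st_t; congr pair; first by rewrite /= /GRing.scale /= mulr1.
  by rewrite /= scaler0 add0r.
rewrite e; apply: cvg_within_full hd.
have [T' T'T tT'] : exists2 T' : R, (T'%:E <= T)%E & t < T'.
  case: T tT => [r||] //=; first by rewrite lte_fin => tr; exists r.
  by move=> _; exists (t + 1); rewrite ?leey // ltrDl.

have d0 : 0 < Num.min (t - 1) (T' - t) by rewrite lt_min !subr_gt0 t1.
near=> h.
have : `|h| < Num.min (t - 1) (T' - t) by near: h; exact: dnbhs0_lt.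
rewrite lt_min => /andP[]; rewrite !ltr_norml => /andP[h1 _] /andP[_ h2].
split; rewrite /= /GRing.scale /= mulr1; first lra.
by apply: lt_le_trans T'T; rewrite lte_fin; lra.
Unshelve. all: by end_near. Qed.

Lemma der_dx T f t x (i : 'I_n) s : 1 <= t -> (t%:E < T)%E ->
  (forall y, derivable_in (slab T) f (t, y) (st_x R i)) ->
  has_der (fun s => f (t, x + s *: delta_mx 0 i)) s (dx T i f (t, x + s *: delta_mx 0 i)).
Proof.
move=> t1 tT hd; apply: has_derI.
have e : (fun h => h^-1 *: (f (t, x + (h + s) *: delta_mx 0 i) - f (t, x + s *: delta_mx 0 i))) =
  (fun h : R => h^-1 *: ((f \o shift (t, x + s *: delta_mx 0 i)) (h *: st_x R i) - f (t, x + s *: delta_mx 0 i))).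
  apply/funext => h /=; congr (_ *: (f _ - _)).
  rewrite /st_x; congr pair; first by rewrite /= /GRing.scale /= mulr0 add0r.
  by rewrite /= scalerDl addrCA.
rewrite e; apply: cvg_within_full (hd _).
by near=> h; split; rewrite /= /GRing.scale /= mulr0 add0r.
Unshelve. all: by end_near. Qed.

Lemma cont_in_ballP (A : set (R * 'rV[R]_n)) f z : cont_in A f z ->
  forall e, 0 < e -> exists2 d, 0 < d & forall s y, A (s, y) -> `|s - z.1| < d ->
    (forall j, `|y 0 j - z.2 0 j| < d) -> `|f (s, y) - f z| < e.
Proof.
move=> hc e e0; have /cvgrPdist_lt/(_ _ e0) := hc.
rewrite near_withinE => /nbhs_ballP[d /= d0 hd].
exists d => // s y As hs hy; rewrite distrC; apply: hd => //.
split; first by rewrite /ball /= distrC.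
by split => // i j; rewrite (ord1 i) /ball /= distrC.
Qed.

Lemma cont_in_time (A : set (R * 'rV[R]_n)) f (B : set R) t x :
  (forall s, B s -> A (s, x)) -> cont_in A f (t, x) -> cont_in B (fun s => f (s, x)) t.
Proof.
move=> BA hc; apply/cvgrPdist_lt => e e0.
have [d d0 hd] := cont_in_ballP hc e0.
rewrite near_withinE; apply/nbhs_ballP; exists d => //= s hs Bs.
rewrite distrC; apply: hd; [exact: BA|by rewrite distrC|].
by move=> j; rewrite subrr normr0.
Qed.

Definition cylinder (t1 L : R) : set (R * 'rV[R]_n) :=
  [set z | 1 <= z.1 <= t1 /\ in_box L z.2].

Lemma compact_cylinder t1 L : compact (cylinder t1 L).
Proof.
have -> : cylinder t1 L = `[1, t1]%classic `*` [set v : 'rV[R]_n | forall i, `[- L, L]%classic (v 0 i)].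
  rewrite predeqE => -[s y]; rewrite /cylinder /= in_itv /=; split => -[h1 h2]; split=> //.
    by move=> i; rewrite /= in_itv /= -ler_norml; exact: h2.
  by move=> i; have := h2 i; rewrite /= in_itv /= -ler_norml.
apply: compact_setX; first exact: segment_compact.
by apply: (@rV_compact R n (fun=> `[- L, L]%classic)) => i; exact: segment_compact.
Qed.

(** The modulus is uniform in [t], so that one grid can serve all times in [[1, t1]]. *)
Lemma unif_cont_cylinder t1 L f :
  (forall z, cylinder t1 L z -> cont_in (cylinder t1 L) f z) ->
  forall e, 0 < e -> exists2 d, 0 < d & forall t x y, 1 <= t <= t1 ->
    in_box L x -> in_box L y -> (forall j, `|x 0 j - y 0 j| <= d) ->
    `|f (t, x) - f (t, y)| <= e.
Proof.
move=> hf e e0.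
pose P (d : R) (z : R * 'rV[R]_n) := cylinder t1 L z -> forall y : 'rV[R]_n, in_box L y ->
   (forall j, `|z.2 0 j - y 0 j| <= d) -> `|f z - f (z.1, y)| <= e.
have hP : \forall d \near 0^'+, cylinder t1 L `<=` P d.
  apply: (iffLR (compact_near_coveringP _) (@compact_cylinder t1 L)) => z Kz.
  have e2 : 0 < e / 2 by rewrite divr_gt0.
  have [d d0 hd] := cont_in_ballP (hf z Kz) e2.
  have d2 : 0 < d / 2 by rewrite divr_gt0.
  exists (ball z (d / 2), [set r | r < d / 2]) => /=.
    by split; [exact: nbhsx_ballx|exact: nbhs_right_lt].
  move=> [[s x] r] /= [[hs [_ hx]] hr] Kx y Ly hxy.
  have hs' : `|s - z.1| < d / 2 by rewrite distrC; exact: hs.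
  have h1 : `|f (s, x) - f z| < e / 2.
    apply: hd => //; first by apply: lt_trans hs' _; lra.
    by move=> j; have := hx 0 j; rewrite /ball /= distrC; lra.
  have h2 : `|f (s, y) - f z| < e / 2.
    apply: hd; [by case: Kx => ? _|by apply: lt_trans hs' _; lra|].
    move=> j; have := hx 0 j; rewrite /ball /= => hxj.
    have := hxy j; have := ler_distD (x 0 j) (y 0 j) (z.2 0 j).
    rewrite (distrC (y 0 j) (x 0 j)) (distrC (x 0 j) (z.2 0 j)); lra.
  have := ler_distD (f z) (f (s, x)) (f (s, y)).
  by rewrite (distrC (f z) (f (s, y))); lra.
near (0 : R)^'+ => d.
exists d => [|t x y ht hx hy hxy].
  near: d; exact: nbhs_right_gt.
by apply: (near hP d _ (t, x)).
Unshelve. all: by end_near. Qed.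

Lemma bounded_cylinder t1 L f :
  (forall z, cylinder t1 L z -> cont_in (cylinder t1 L) f z) ->
  exists2 M, 0 < M & forall z, cylinder t1 L z -> `|f z| <= M.
Proof.
move=> hf.
pose P (M : R) (z : R * 'rV[R]_n) := cylinder t1 L z -> `|f z| <= M.
have hP : \forall M \near +oo, cylinder t1 L `<=` P M.
  apply: (iffLR (compact_near_coveringP _) (@compact_cylinder t1 L)) => z Kz.
  have [d d0 hd] := cont_in_ballP (hf z Kz) ltr01.
  exists (ball z d, [set r | `|f z| + 1 < r]) => /=.
    by split; [exact: nbhsx_ballx|apply: nbhs_pinfty_gt; exact: num_real].
  move=> [[s x] r] /= [[hs [_ hx]] hr] Kx.
  have h1 : `|f (s, x) - f z| < 1.
    apply: hd => //; first by rewrite distrC; exact: hs.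
    by move=> j; have := hx 0 j; rewrite /ball /= distrC.
  by have := ler_distD (f z) (f (s, x)) 0; rewrite !subr0; lra.
near (+oo : set_system R) => M; exists M; first by near: M; apply: nbhs_pinfty_gt; exact: num_real.
by move=> z Kz; apply: (near hP M _ z).
Unshelve. all: by end_near. Qed.



Section C2.
Variables (T : \bar R) (u : R * 'rV[R]_n -> R).
Hypothesis hu : Ck_slab 2 T u.

Let coord_x (i : 'I_n) : (st_t R n |` range (@st_x R n)) (st_x R i).
Proof. by right; exists i. Qed.

Let coord_t : (st_t R n |` range (@st_x R n)) (st_t R n).
Proof. by left. Qed.

Let inslab t x : 1 <= t -> (t%:E < T)%E -> slab T (t, x).
Proof. by []. Qed.

Lemma C2_cont z : slab T z -> cont_in (slab T) u z.
Proof. by case: hu => /cont_inP h _; exact: h. Qed.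

Lemma C2_cont_dt z : slab T z -> cont_in (slab T) (dt T u) z.
Proof. by case: hu => _ /(_ _ coord_t)[_ [/cont_inP h _]]; exact: h. Qed.

Lemma C2_cont_dx i z : slab T z -> cont_in (slab T) (dx T i u) z.
Proof. by case: hu => _ /(_ _ (coord_x i))[_ [/cont_inP h _]]; exact: h. Qed.

Lemma C2_cont_dtx i z : slab T z -> cont_in (slab T) (dt T (dx T i u)) z.
Proof.
by case: hu => _ /(_ _ (coord_x i))[_ [_ /(_ _ coord_t)[_ [/cont_inP h _]]]]; exact: h.
Qed.

Lemma C2_cont_dxt i z : slab T z -> cont_in (slab T) (dx T i (dt T u)) z.
Proof.
by case: hu => _ /(_ _ coord_t)[_ [_ /(_ _ (coord_x i))[_ [/cont_inP h _]]]]; exact: h.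
Qed.

Lemma C2_cont_dxx i z : slab T z -> cont_in (slab T) (dx T i (dx T i u)) z.
Proof.
by case: hu => _ /(_ _ (coord_x i))[_ [_ /(_ _ (coord_x i))[_ [/cont_inP h _]]]]; exact: h.
Qed.

Lemma C2_dt t x : 1 < t -> (t%:E < T)%E -> has_der (fun s => u (s, x)) t (dt T u (t, x)).
Proof.
move=> t1 tT; apply: der_dt => //.
by case: hu => _ /(_ _ coord_t)[h _]; apply: h; apply: inslab => //; exact: ltW.
Qed.

Lemma C2_dtt t x : 1 < t -> (t%:E < T)%E ->
  has_der (fun s => dt T u (s, x)) t (dt T (dt T u) (t, x)).
Proof.
move=> t1 tT; apply: der_dt => //.
case: hu => _ /(_ _ coord_t)[_ [_ /(_ _ coord_t)[h _]]].
by apply: h; apply: inslab => //; exact: ltW.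
Qed.

Lemma C2_dtx i t x : 1 < t -> (t%:E < T)%E ->
  has_der (fun s => dx T i u (s, x)) t (dt T (dx T i u) (t, x)).
Proof.
move=> t1 tT; apply: der_dt => //.
case: hu => _ /(_ _ (coord_x i))[_ [_ /(_ _ coord_t)[h _]]].
by apply: h; apply: inslab => //; exact: ltW.
Qed.

Lemma C2_dx i t x s : 1 <= t -> (t%:E < T)%E ->
  has_der (fun s => u (t, x + s *: delta_mx 0 i)) s (dx T i u (t, x + s *: delta_mx 0 i)).
Proof.
move=> t1 tT; apply: der_dx => // y.
by case: hu => _ /(_ _ (coord_x i))[h _]; apply: h; exact: inslab.
Qed.

Lemma C2_dxt i t x s : 1 <= t -> (t%:E < T)%E ->
  has_der (fun s => dt T u (t, x + s *: delta_mx 0 i)) s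
    (dx T i (dt T u) (t, x + s *: delta_mx 0 i)).
Proof.
move=> t1 tT; apply: der_dx => // y.
by case: hu => _ /(_ _ coord_t)[_ [_ /(_ _ (coord_x i))[h _]]]; apply: h; exact: inslab.
Qed.

Lemma C2_dxx i t x s : 1 <= t -> (t%:E < T)%E ->
  has_der (fun s => dx T i u (t, x + s *: delta_mx 0 i)) s
    (dx T i (dx T i u) (t, x + s *: delta_mx 0 i)).
Proof.
move=> t1 tT; apply: der_dx => // y.
by case: hu => _ /(_ _ (coord_x i))[_ [_ /(_ _ (coord_x i))[h _]]]; apply: h; exact: inslab.
Qed.

(** The second difference of [u] over a small rectangle in the variables t and x_i is evaluated by
    the mean value theorem in both orders; each gives a mixed derivative at a nearby point, and both
    are continuous. *)
Lemma C2_schwarz i t x : 1 < t -> (t%:E < T)%E ->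
  dt T (dx T i u) (t, x) = dx T i (dt T u) (t, x).
Proof.
move=> t1 tT; have sl : slab T (t, x) by apply: inslab => //; exact: ltW.
apply/eqP; rewrite -subr_eq0 -normr_le0; apply/ler_addgt0Pr => e e0; rewrite add0r.
have e2 : 0 < e / 2 by rewrite divr_gt0.
have [d1 d10 hd1] := cont_in_ballP (@C2_cont_dtx i _ sl) e2.
have [d2 d20 hd2] := cont_in_ballP (@C2_cont_dxt i _ sl) e2.
have [T' T'T tT'] : exists2 T' : R, (T'%:E <= T)%E & t < T'.
  case: T tT => [r||] //=; first by rewrite lte_fin => tr; exists r.
  by move=> _; exists (t + 1); rewrite ?leey // ltrDl.
(* Half of the minimum keeps all intermediate points strictly inside both continuity balls and
   [t + d] below [T']. *)
pose d := Num.min (Num.min d1 d2) (T' - t) / 2.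
have m0 : 0 < Num.min (Num.min d1 d2) (T' - t) by rewrite !lt_min d10 d20 subr_gt0.
have d0 : 0 < d by rewrite divr_gt0.
have hm : Num.min (Num.min d1 d2) (T' - t) <= T' - t by rewrite ge_min lexx orbT.
have hm1 : Num.min (Num.min d1 d2) (T' - t) <= d1 by rewrite !ge_min lexx.
have hm2 : Num.min (Num.min d1 d2) (T' - t) <= d2 by rewrite !ge_min lexx orbT.
have dT : t + d < T' by rewrite /d; lra.
have dd1 : d < d1 by rewrite /d; lra.
have dd2 : d < d2 by rewrite /d; lra.
have sT s : s <= t + d -> (s%:E < T)%E.
  by move=> hs; apply: lt_le_trans T'T; rewrite lte_fin (le_lt_trans hs).
have td : t < t + d by rewrite ltrDl.
have near_x s (j : 'I_n) : 0 < s < d -> `|(x + s *: delta_mx 0 i) 0 j - x 0 j| < d.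
  move=> /andP[s0 sd]; rewrite !mxE eqxx /= addrAC subrr add0r.
  by case: (j == i); rewrite ?mulr1 ?mulr0 ?normr0 // gtr0_norm.
have sder s y : t <= s <= t + d -> has_der (fun s => u (s, y)) s (dt T u (s, y)).
  by move=> /andP[ts sd]; apply: C2_dt; [exact: lt_le_trans ts|exact: sT].
have [s hs es] : exists2 s, t < s < t + d &
  u (t + d, x + d *: delta_mx 0 i) - u (t + d, x)
   - (u (t, x + d *: delta_mx 0 i) - u (t, x)) =
   (dt T u (s, x + d *: delta_mx 0 i) - dt T u (s, x)) * (t + d - t).
  apply: (@der_mvt _ t (t + d) (fun s => u (s, x + d *: delta_mx 0 i) - u (s, x))
    (fun s => dt T u (s, x + d *: delta_mx 0 i) - dt T u (s, x))); first exact: td.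
  - by move=> s hs; exact: der_cont_in (derB (sder _ _ hs) (sder _ _ hs)).
  - by move=> s /andP[/ltW h1 /ltW h2]; apply: derB; apply: sder; rewrite h1.
have s1 : 1 < s by case/andP: hs => h _; exact: lt_trans h.
have ssT : (s%:E < T)%E by case/andP: hs => _ /ltW; exact: sT.
have [r hr er] : exists2 r, 0 < r < d &
   dt T u (s, x + d *: delta_mx 0 i) - dt T u (s, x + 0 *: delta_mx 0 i) =
   dx T i (dt T u) (s, x + r *: delta_mx 0 i) * (d - 0).
  apply: (@der_mvt _ 0 d (fun r => dt T u (s, x + r *: delta_mx 0 i))
     (fun r => dx T i (dt T u) (s, x + r *: delta_mx 0 i))); first exact: d0.
  - by move=> r _; exact: der_cont_in (@C2_dxt i _ x r (ltW s1) ssT).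
  - by move=> r _; exact: (@C2_dxt i _ x r (ltW s1) ssT).
have t1d : 1 <= t + d by rewrite (le_trans (ltW t1)) // ltW.
have [r' hr' er'] : exists2 r, 0 < r < d &
  u (t + d, x + d *: delta_mx 0 i) - u (t, x + d *: delta_mx 0 i)
   - (u (t + d, x + 0 *: delta_mx 0 i) - u (t, x + 0 *: delta_mx 0 i)) =
   (dx T i u (t + d, x + r *: delta_mx 0 i) - dx T i u (t, x + r *: delta_mx 0 i)) * (d - 0).
  have hder z : has_der (fun r => u (t + d, x + r *: delta_mx 0 i) - u (t, x + r *: delta_mx 0 i)) z
     (dx T i u (t + d, x + z *: delta_mx 0 i) - dx T i u (t, x + z *: delta_mx 0 i)).
    apply: derB; first exact: (@C2_dx i _ x z t1d (sT _ (lexx _))).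
    exact: (@C2_dx i _ x z (ltW t1) tT).
  apply: (@der_mvt _ 0 d (fun r => u (t + d, x + r *: delta_mx 0 i) - u (t, x + r *: delta_mx 0 i))
     (fun r => dx T i u (t + d, x + r *: delta_mx 0 i) - dx T i u (t, x + r *: delta_mx 0 i))).
  - exact: d0.
  - by move=> z _; exact: der_cont_in (hder z).
  - by move=> z _; exact: hder.
have [s' hs' es'] : exists2 s, t < s < t + d &
   dx T i u (t + d, x + r' *: delta_mx 0 i) - dx T i u (t, x + r' *: delta_mx 0 i) =
   dt T (dx T i u) (s, x + r' *: delta_mx 0 i) * (t + d - t).
  have hder z : t <= z <= t + d -> has_der (fun s => dx T i u (s, x + r' *: delta_mx 0 i)) z
    (dt T (dx T i u) (z, x + r' *: delta_mx 0 i)).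
    by move=> /andP[h1 h2]; apply: C2_dtx; [exact: lt_le_trans h1|exact: sT].
  apply: (@der_mvt _ t (t + d) (fun s => dx T i u (s, x + r' *: delta_mx 0 i))
    (fun s => dt T (dx T i u) (s, x + r' *: delta_mx 0 i))); first exact: td.
  - by move=> s' h; exact: der_cont_in (hder s' h).
  - by move=> s' /andP[/ltW h1 /ltW h2]; apply: hder; rewrite h1.
rewrite scale0r addr0 in er er'.
have key : dx T i (dt T u) (s, x + r *: delta_mx 0 i) =
  dt T (dx T i u) (s', x + r' *: delta_mx 0 i).
  have dd : d * d != 0 by rewrite mulf_neq0 // gt_eqF.
  apply: (mulIf dd).
  have e1 : t + d - t = d by ring.
  rewrite er e1 subr0 in es.
  rewrite es' e1 subr0 in er'.
  rewrite [LHS]mulrA [RHS]mulrA; apply: etrans (esym es) _.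
  by apply: etrans er'; ring.
have in_near q : t < q < t + d -> slab T (q, x) /\ `|q - t| < d.
  move=> /andP[h1 h2]; split.
    by apply: inslab; [exact: le_trans (ltW t1) (ltW h1)|apply: sT; exact: ltW].
  have q0 : 0 < q - t by rewrite subr_gt0; exact: h1.
  by rewrite (gtr0_norm q0) ltrBlDl; exact: h2.
have [sl1 n1] := in_near _ hs; have [sl2 n2] := in_near _ hs'.
have b1 := hd2 s (x + r *: delta_mx 0 i) sl1 (lt_trans n1 dd2)
   (fun j => lt_trans (near_x r j hr) dd2).
have b2 := hd1 s' (x + r' *: delta_mx 0 i) sl2 (lt_trans n2 dd1)
   (fun j => lt_trans (near_x r' j hr') dd1).
move: b1 b2; rewrite key.
by move=> b1 b2; exact: dist_half b2 b1.
Qed.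

End C2.
End SlabCalculus.

(** * The Euclidean norm and the squared positive part *)

Section Euclidean.
Context {R : realType}.

(** [B (A B - S^2)] is the sum of the squares [(a i B - b i S)^2]; the case [B = 0] is separate. *)
Lemma cauchy_schwarz (n : nat) (a b : 'I_n -> R) :
  \sum_i a i * b i <= Num.sqrt (\sum_i a i ^+ 2) * Num.sqrt (\sum_i b i ^+ 2).
Proof.
set S := \sum_i a i * b i; set A := \sum_i a i ^+ 2; set B := \sum_i b i ^+ 2.
have A0 : 0 <= A by apply: sumr_ge0 => i _; exact: sqr_ge0.
have B0 : 0 <= B by apply: sumr_ge0 => i _; exact: sqr_ge0.
have h : 0 <= B * (A * B - S ^+ 2).
  have -> : B * (A * B - S ^+ 2) = \sum_i (a i * B - b i * S) ^+ 2.
    rewrite (eq_bigr (fun i => B ^+ 2 * a i ^+ 2 + (- (2 * B * S) * (a i * b i) + S ^+ 2 * b i ^+ 2))).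
      by rewrite big_split big_split /= -!mulr_sumr -/A -/B -/S; ring.
    by move=> i _; ring.
  by apply: sumr_ge0 => i _; exact: sqr_ge0.
apply: le_trans (ler_norm _) _.
rewrite -sqrtrM // -sqrtr_sqr ler_wsqrtr // -subr_ge0.
move: B0; rewrite le_eqVlt => /predU1P[e|B0]; last by rewrite -(pmulr_rge0 _ B0).
have b0 i : b i = 0.
  have h2 : b i ^+ 2 = 0 by apply: (psumr_eq0P _ (esym e)) => // j _; exact: sqr_ge0.
  by apply/eqP; rewrite -sqrf_eq0 h2.
have -> : S = 0 by apply: big1 => i _; rewrite b0 mulr0.
by rewrite expr0n subr0 -e mulr0.
Qed.

Lemma enorm_triangle (n : nat) (x y : 'rV[R]_n) : enorm (x + y) <= enorm x + enorm y.
Proof.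
rewrite -(@ger0_norm _ (enorm x + _)) ?addr_ge0 ?sqrtr_ge0 // -sqrtr_sqr ler_wsqrtr //.
rewrite (eq_bigr (fun i => x 0 i ^+ 2 + (2 * (x 0 i * y 0 i) + y 0 i ^+ 2))); last first.
  by move=> i _; rewrite mxE; ring.
rewrite big_split big_split /= -mulr_sumr -!enorm_sqr.
have := cauchy_schwarz (fun i => x 0 i) (fun i => y 0 i); rewrite -/(enorm x) -/(enorm y).
lra.
Qed.

Lemma enorm_coord (n : nat) (x : 'rV[R]_n) i : `|x 0 i| <= enorm x.
Proof.
rewrite -sqrtr_sqr ler_wsqrtr // (bigD1 i) //= lerDl.
by apply: sumr_ge0 => j _; exact: sqr_ge0.
Qed.

(** The square makes the positive part C^1, so that the cone weight can be differentiated. *)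
Definition sqpos (q : R) := Num.max 0 q ^+ 2.

Lemma der_sqpos (f : R -> R) x d : has_der f x d ->
  has_der (fun s => sqpos (f s)) x (2 * Num.max 0 (f x) * d).
Proof.
move=> hf; apply: der_comp hf; apply: (@der_quadratic _ _ _ _ 1) => h.
rewrite mul1r /sqpos; move: (f x) => y.
by case: (lerP 0 (h + y)) => ?; case: (lerP 0 y) => ?; rewrite ler_norml; apply/andP; split; nra.
Qed.

End Euclidean.

(** * Solutions on a closed strip of times *)

Section StripSolution.
Context {R : realType} {n : nat}.
Local Notation V := 'rV[R]_n.

Definition strip (t1 : R) : set (R * V) := [set z | 1 <= z.1 <= t1].

Lemma cylinder_strip t1 L : cylinder t1 L `<=` strip t1.
Proof. by move=> z hz; exact: hz.1. Qed.

(** Ordinary derivatives up to a time [t1 < T], freed from the slab. A single [uit] serves as both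
    mixed derivatives, by [C2_schwarz]; time derivatives are stated for [t > 1], where they are
    two-sided. *)
Record strip_solution (alpha mu p t1 : R) (u ut utt : R * V -> R)
    (ui uit uii : 'I_n -> R * V -> R) : Prop := StripSolution {
  strip_cont : forall z, strip t1 z -> cont_in (strip t1) u z;
  strip_cont_t : forall z, strip t1 z -> cont_in (strip t1) ut z;
  strip_cont_x : forall i z, strip t1 z -> cont_in (strip t1) (ui i) z;
  strip_cont_xt : forall i z, strip t1 z -> cont_in (strip t1) (uit i) z;
  strip_cont_xx : forall i z, strip t1 z -> cont_in (strip t1) (uii i) z;
  strip_der_t : forall t x, 1 < t <= t1 -> has_der (fun s => u (s, x)) t (ut (t, x));
  strip_der_tt : forall t x, 1 < t <= t1 -> has_der (fun s => ut (s, x)) t (utt (t, x));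
  strip_der_xt : forall i t x, 1 < t <= t1 -> has_der (fun s => ui i (s, x)) t (uit i (t, x));
  strip_der_x : forall i t x s, 1 <= t <= t1 ->
    has_der (fun s => u (t, x + s *: delta_mx 0 i)) s (ui i (t, x + s *: delta_mx 0 i));
  strip_der_tx : forall i t x s, 1 < t <= t1 ->
    has_der (fun s => ut (t, x + s *: delta_mx 0 i)) s (uit i (t, x + s *: delta_mx 0 i));
  strip_der_xx : forall i t x s, 1 <= t <= t1 ->
    has_der (fun s => ui i (t, x + s *: delta_mx 0 i)) s (uii i (t, x + s *: delta_mx 0 i));
  strip_pde : forall t x, 1 < t <= t1 ->
    utt (t, x) = t `^ (- alpha) ^+ 2 * (\sum_i uii i (t, x)) - mu / t * ut (t, x)
      + enorm (\row_i ui i (t, x)) `^ p }.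

Lemma powR_sq (t a : R) : 0 < t -> 1 / t `^ (2 * a) = t `^ (- a) ^+ 2.
Proof.
by move=> t0; rewrite mul1r expr2 -powR_gt0D // -powRN; congr (_ `^ _); ring.
Qed.

Lemma classical_strip (p alpha mu eps : R) (u0 u1 : V -> R) (T : \bar R) (u : R * V -> R) t1 :
  classical_solution p alpha mu eps u0 u1 T u -> (t1%:E < T)%E ->
  strip_solution alpha mu p t1 u (dt T u) (dt T (dt T u)) (fun i => dx T i u)
    (fun i => dt T (dx T i u)) (fun i => dx T i (dx T i u)).
Proof.
move=> [hu pde _ _] hT.
have le_T t : t <= t1 -> (t%:E < T)%E by move=> ht; apply: le_lt_trans hT; rewrite lee_fin.
have sub : strip t1 `<=` slab T by move=> z /andP[z1 z2]; split => //; exact: le_T.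
split.
- by move=> z hz; apply: (cont_inW sub); apply: C2_cont => //; exact: sub.
- by move=> z hz; apply: (cont_inW sub); apply: C2_cont_dt => //; exact: sub.
- by move=> i z hz; apply: (cont_inW sub); apply: C2_cont_dx => //; exact: sub.
- by move=> i z hz; apply: (cont_inW sub); apply: C2_cont_dtx => //; exact: sub.
- by move=> i z hz; apply: (cont_inW sub); apply: C2_cont_dxx => //; exact: sub.
- by move=> t x /andP[h1 h2]; apply: C2_dt => //; exact: le_T.
- by move=> t x /andP[h1 h2]; apply: C2_dtt => //; exact: le_T.
- by move=> i t x /andP[h1 h2]; apply: C2_dtx => //; exact: le_T.
- by move=> i t x s /andP[h1 h2]; apply: C2_dx => //; exact: le_T.
- move=> i t x s /andP[h1 h2].
  have e := @C2_schwarz _ _ _ _ hu i t (x + s *: delta_mx 0 i) h1 (le_T _ h2).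
  exact: der_eq (@C2_dxt _ _ _ _ hu i t x s (ltW h1) (le_T _ h2)) (esym e).
- by move=> i t x s /andP[h1 h2]; apply: C2_dxx => //; exact: le_T.
- move=> t x /andP[h1 h2]; have t0 : 0 < t by exact: lt_trans h1.
  have := pde t x h1 (le_T t h2); rewrite powR_sq // /laplacian /grad_x => <-.
  by move: (dt _ _ _) (dt _ _ _) (\sum_i _) => A B C; ring.
Qed.

End StripSolution.
Arguments strip_cont_x {R n alpha mu p t1 u ut utt ui uit uii} _ i {z} _.
Arguments strip_cont_xt {R n alpha mu p t1 u ut utt ui uit uii} _ i {z} _.
Arguments strip_cont_xx {R n alpha mu p t1 u ut utt ui uit uii} _ i {z} _.
Arguments strip_der_t {R n alpha mu p t1 u ut utt ui uit uii} _ {t} x _.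
Arguments strip_der_tt {R n alpha mu p t1 u ut utt ui uit uii} _ {t} x _.
Arguments strip_der_xt {R n alpha mu p t1 u ut utt ui uit uii} _ i {t} x _.
Arguments strip_der_x {R n alpha mu p t1 u ut utt ui uit uii} _ i {t} x s _.
Arguments strip_der_tx {R n alpha mu p t1 u ut utt ui uit uii} _ i {t} x s _.
Arguments strip_der_xx {R n alpha mu p t1 u ut utt ui uit uii} _ i {t} x s _.
Arguments strip_pde {R n alpha mu p t1 u ut utt ui uit uii} _ {t} x _.

(** * Finite speed of propagation *)

Section EnergyInequality.
Context {R : realType}.

(* v = u_t, U = |grad u|^2, S = Laplacian of u, P^2 = the cone weight, Y = (x - x0).grad u,
   B = grad u_t . grad u and Nn = the nonlinearity; the terms a^2 (...) on the right are
   the divergence of P^2 u_t grad u. *)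
Lemma energy_pointwise (alpha mu t a P rho r v U S B Y Nn K C e : R) :
  0 <= alpha -> 0 <= mu -> 0 < t -> 0 < a -> 0 <= P -> 0 <= r -> 0 <= U ->
  (0 < P -> r <= rho) -> `|Y| <= r * Num.sqrt U -> 0 <= Nn <= Num.sqrt U * K ->
  0 <= K -> K <= C * a ->
  e = (v ^+ 2 + a ^+ 2 * U) / 2 ->
  - (4 * P * rho * a) * e
   + P ^+ 2 * (v * (a ^+ 2 * S - mu / t * v + Nn) + a ^+ 2 * B - alpha * a ^+ 2 / t * U)
  <= a ^+ 2 * (- (4 * P) * v * Y + P ^+ 2 * B + P ^+ 2 * (v * S)) + C * (P ^+ 2 * e).
Proof.
move=> al0 mu0 t0 a0 P0 r0 U0 hP hY /andP[N0 hN] K0 hK ee.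
have sU := sqr_sqrtr U0; set s := Num.sqrt U in hY hN sU.
have s0 : 0 <= s by exact: sqrtr_ge0.
have e0 : 0 <= e.
  rewrite ee divr_ge0 //; apply: addr_ge0; first exact: sqr_ge0.
  by apply: mulr_ge0; first exact: sqr_ge0.
have hve : a * (`|v| * s) <= e.
  rewrite ee -sU -[v ^+ 2]real_normK ?num_real //.
  have := sqr_ge0 (`|v| - a * s); lra.
have h1 : 0 <= 4 * P * a * (rho * e - a * (v * Y)).
  move: P0; rewrite le_eqVlt => /predU1P[<-|P0]; first by rewrite mulr0 !mul0r.
  have hr := hP P0.
  apply: mulr_ge0; first by rewrite !mulr_ge0 // ltW.
  rewrite subr_ge0.
  have hvY : v * Y <= `|v| * (r * s).
    apply: le_trans (ler_norm _) _; rewrite normrM; exact: ler_wpM2l.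
  apply: (@le_trans _ _ (r * (a * (`|v| * s)))).
    by rewrite [leRHS]mulrCA ler_wpM2l ?(ltW a0) // [leRHS]mulrCA.
  by apply: ler_pM => //; rewrite !mulr_ge0 // ltW.
have h2 : v * Nn <= C * e.
  have hvN : v * Nn <= `|v| * (s * K).
    apply: le_trans (ler_norm _) _; rewrite normrM (ger0_norm N0); exact: ler_wpM2l.
  apply: le_trans hvN _; rewrite -(ler_pM2l a0).
  have -> : a * (`|v| * (s * K)) = K * (a * (`|v| * s)) by ring.
  have -> : a * (C * e) = (C * a) * e by ring.
  by apply: ler_pM => //; rewrite !mulr_ge0 // ltW.
have h3 : 0 <= mu / t * v ^+ 2 by rewrite mulr_ge0 ?sqr_ge0 // divr_ge0 // ltW.
have h4 : 0 <= alpha * a ^+ 2 / t * U.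
  by rewrite !mulr_ge0 ?sqr_ge0 ?invr_ge0 // ltW.
have h5 : 0 <= P ^+ 2 * (mu / t * v ^+ 2 + alpha * a ^+ 2 / t * U + (C * e - v * Nn)).
  by rewrite mulr_ge0 ?sqr_ge0 // addr_ge0 ?subr_ge0 // addr_ge0.
rewrite -subr_ge0.
have -> : a ^+ 2 * (- (4 * P) * v * Y + P ^+ 2 * B + P ^+ 2 * (v * S)) + C * (P ^+ 2 * e) -
   (- (4 * P * rho * a) * e
   + P ^+ 2 * (v * (a ^+ 2 * S - mu / t * v + Nn) + a ^+ 2 * B - alpha * a ^+ 2 / t * U)) =
  4 * P * a * (rho * e - a * (v * Y)) +
  P ^+ 2 * (mu / t * v ^+ 2 + alpha * a ^+ 2 / t * U + (C * e - v * Nn)).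
  by ring.
exact: addr_ge0.
Qed.

Lemma cont_in_coord (n : nat) (A : set (R * 'rV[R]_n)) z j :
  cont_in A (fun y => y.2 0 j) z.
Proof.
apply/cvgrPdist_lt => e e0; rewrite near_withinE; apply/nbhs_ballP; exists e => //= y [_ [_ hy]] _.
exact: hy.
Qed.

Lemma cont_in_fst (n : nat) (A : set (R * 'rV[R]_n)) (F : R -> R) z d :
  has_der F z.1 d -> cont_in A (fun y => F y.1) z.
Proof.
move=> hF; apply: (@cont_in_comp _ _ _ F (fun y => y.1)); first exact: der_cont hF.
apply/cvgrPdist_lt => e e0; rewrite near_withinE; apply/nbhs_ballP; exists e => //= y [hy _] _.
exact: hy.
Qed.

End EnergyInequality.

Section FiniteSpeed.
Context {R : realType} {n : nat}.
Local Notation V := 'rV[R]_n.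
Variables (alpha mu p t1 : R) (u ut utt : R * V -> R) (ui uit uii : 'I_n -> R * V -> R).
Hypotheses (ha : 0 <= alpha < 1) (hmu : 0 <= mu) (hp : 1 < p).
Hypothesis hs : strip_solution alpha mu p t1 u ut utt ui uit uii.
Variable rad : R.
Hypothesis init_u : forall x, rad < enorm x -> u (1, x) = 0.
Hypothesis init_t : forall x, rad < enorm x -> ut (1, x) = 0.
Hypothesis init_x : forall i x, rad < enorm x -> ui i (1, x) = 0.

Section Cone.
Variables (t2 : R) (x0 : V).
Hypothesis ht2 : 1 <= t2 <= t1.
Hypothesis hx0 : sound alpha t2 + rad < enorm x0.

Let a0 : 0 <= alpha. Proof. by case/andP: ha. Qed.
Let a1 : alpha < 1. Proof. by case/andP: ha. Qed.
(** Half the gap: the ball of radius [rho 1 = A(t2) + eta] around [x0] still misses the support of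
    the data, while at time [t2] the cone keeps the positive radius [eta]. *)
Let eta := (enorm x0 - sound alpha t2 - rad) / 2.
Let eta0 : 0 < eta. Proof. by rewrite divr_gt0 //; have := hx0; lra. Qed.
(* The weight w = max (0, rho^2 - |x - x0|^2)^2 is C^1, lives in a backward cone that
   misses the data at t = 1, and satisfies w_t + t^(-alpha) |grad w| <= 0 because
   rho' = - t^(-alpha). *)
Let rho (t : R) := sound alpha t2 - sound alpha t + eta.
Let P (z : R * V) := Num.max 0 (rho z.1 ^+ 2 - \sum_j (z.2 0 j - x0 0 j) ^+ 2).
Let w z := P z ^+ 2.
Let wi i z := - (4 * P z) * (z.2 0 i - x0 0 i).
Let gi i z := wi i z * (ut z * ui i z) + w z * (uit i z * ui i z + ut z * uii i z).
Let U z := \sum_i ui i z ^+ 2.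
Let en z := (ut z ^+ 2 + z.1 `^ (- alpha) ^+ 2 * U z) / 2.
(** Beyond the reach of the cone, so that the weight vanishes on the faces of the box. *)
Let L := enorm x0 + rho 1 + 1.

Let P0 z : 0 <= P z. Proof. by rewrite le_max lexx. Qed.

Let rho_gt0 t : 1 <= t <= t2 -> 0 < rho t.
Proof.
move=> /andP[h1 h2]; have : sound alpha t <= sound alpha t2.
  by apply: sound_le => //; lra.
by rewrite /rho; have := eta0; lra.
Qed.

Let rho_le t : 1 <= t -> rho t <= rho 1.
Proof.
move=> h1; rewrite /rho sound1; have := sound_ge0 a1 h1; lra.
Qed.

Let L0 : 0 < L.
Proof.
have h : 0 < rho 1 by apply: rho_gt0; rewrite lexx; case/andP: ht2.
by rewrite /L; have := enorm_ge0 x0; lra.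
Qed.

Let der_w_x i t x s : has_der (fun s => w (t, x + s *: delta_mx 0 i)) s
  (wi i (t, x + s *: delta_mx 0 i)).
Proof.
have hj j : has_der (fun s => ((x + s *: delta_mx 0 i) 0 j - x0 0 j) ^+ 2) s
   (2 * ((x + s *: delta_mx 0 i) 0 j - x0 0 j) * (j == i)%:R).
  have h1 : has_der (fun s => (x + s *: delta_mx 0 i) 0 j - x0 0 j) s (j == i)%:R.
    have -> : (fun s => (x + s *: delta_mx 0 i) 0 j - x0 0 j) =
       fun s => s * (j == i)%:R + (x 0 j - x0 0 j).
      by apply/funext => r; rewrite !mxE eqxx /=; ring.
    by apply: der_eq (derD (derM (der_id s) (der_cst _ s)) (der_cst _ s)) _; ring.
  have -> : (fun s => ((x + s *: delta_mx 0 i) 0 j - x0 0 j) ^+ 2) =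
     fun s => ((x + s *: delta_mx 0 i) 0 j - x0 0 j) * ((x + s *: delta_mx 0 i) 0 j - x0 0 j).
    by apply/funext => r; rewrite expr2.
  by apply: der_eq (derM h1 h1) _; ring.
have := der_sqpos (derB (der_cst (rho t ^+ 2) s) (der_sum (index_enum 'I_n) hj)).
move/der_eq; apply; rewrite /wi /P /=; move: (Num.max _ _) => Q.
rewrite (bigD1 i) //= big1 => [|j /negbTE ->]; last by rewrite mulr0.
by rewrite (eqxx i) (_ : true%:R = 1) //; ring.
Qed.

Let der_w_t t x : 0 < t -> has_der (fun s => w (s, x)) t
  (- (4 * P (t, x) * rho t * t `^ (- alpha))).
Proof.
move=> t0.
have hr : has_der rho t (- t `^ (- alpha)).
  by apply: der_eq (derD (derB (der_cst _ t) (der_sound a1 t0)) (der_cst _ t)) _; ring.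
have hr2 : has_der (fun s => rho s ^+ 2) t (2 * rho t * - t `^ (- alpha)).
  have -> : (fun s => rho s ^+ 2) = (fun s => rho s * rho s).
    by apply/funext => r; rewrite expr2.
  by apply: der_eq (derM hr hr) _; ring.
have := der_sqpos (derB hr2 (der_cst (\sum_j (x 0 j - x0 0 j) ^+ 2) t)).
move/der_eq; apply; rewrite /P /=; move: (Num.max _ _) => Q; ring.
Qed.


Let P_face (i : 'I_n) (x : V) t : 1 <= t <= t2 -> `|x 0 i| = L -> P (t, x) = 0.
Proof.
move=> ht hx; apply/max_idPl; rewrite subr_le0.
have h : rho 1 <= `|x 0 i - x0 0 i|.
  have := ler_distD (x0 0 i) (x 0 i) 0; rewrite !subr0 hx.
  have := enorm_coord x0 i; rewrite /L; lra.
apply: (@le_trans _ _ ((x 0 i - x0 0 i) ^+ 2)).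
  rewrite -[leRHS]real_normK ?num_real // lerXn2r ?nnegrE //.
    exact: ltW (rho_gt0 ht).
  by apply: le_trans h; apply: rho_le; case/andP: ht.
by rewrite (bigD1 i) //= lerDl; apply: sumr_ge0 => j _; exact: sqr_ge0.
Qed.

Let cont_P z : strip t1 z -> cont_in (strip t1) P z.
Proof.
move=> hz; apply: (@cont_in_comp _ _ _ (fun y => Num.max 0 y)).
  by apply: (@continuous_max _ _ (cst 0) id) => //; exact: cvg_cst.
have z0 : 0 < z.1 by case/andP: hz => ? _; lra.
have hr : cont_in (strip t1) (fun y => rho y.1) z.
  exact: (cont_in_fst _ (derD (derB (der_cst _ z.1) (der_sound a1 z0)) (der_cst _ z.1))).
apply: cont_inB; first exact: (cont_inM hr hr).
apply: cont_in_sum => j.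
have hj := cont_inB (@cont_in_coord _ _ (strip t1) z j) (@cont_in_cst _ _ (strip t1) (x0 0 j) z).
exact: (cont_inM hj hj).
Qed.

Let cont_w z : strip t1 z -> cont_in (strip t1) w z.
Proof. by move=> hz; exact: (cont_inM (cont_P hz) (cont_P hz)). Qed.

Let cont_gi i z : strip t1 z -> cont_in (strip t1) (gi i) z.
Proof.
move=> hz.
have ct := strip_cont_t hs hz; have cx := strip_cont_x hs i hz.
have cxt := strip_cont_xt hs i hz; have cxx := strip_cont_xx hs i hz.
apply: cont_inD.
  apply: cont_inM; last exact: cont_inM.
  apply: cont_inM.
    by apply: cont_inN; apply: cont_inM; [exact: cont_in_cst|exact: cont_P].
  by apply: cont_inB; [exact: cont_in_coord|exact: cont_in_cst].
by apply: cont_inM; [exact: cont_w|apply: cont_inD; exact: cont_inM].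
Qed.

Let cont_U z : strip t1 z -> cont_in (strip t1) U z.
Proof.
move=> hz; apply: cont_in_sum => i.
exact: (cont_inM (strip_cont_x hs i hz) (strip_cont_x hs i hz)).
Qed.

Let cont_en z : strip t1 z -> cont_in (strip t1) en z.
Proof.
move=> hz; have z0 : 0 < z.1 by case/andP: hz => ? _; lra.
have ca : cont_in (strip t1) (fun y => y.1 `^ (- alpha)) z.
  exact: (cont_in_fst _ (der_pow (- alpha) z0)).
apply: cont_inM; last exact: cont_in_cst.
apply: cont_inD; first exact: (cont_inM (strip_cont_t hs hz) (strip_cont_t hs hz)).
by apply: cont_inM; [exact: (cont_inM ca ca)|exact: cont_U].
Qed.

Let der_en t x : 1 < t <= t1 -> has_der (fun s => en (s, x)) t
  (ut (t, x) * utt (t, x) + t `^ (- alpha) ^+ 2 * (\sum_i uit i (t, x) * ui i (t, x))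
   - alpha * t `^ (- alpha) ^+ 2 / t * U (t, x)).
Proof.
move=> ht; have t0 : 0 < t by case/andP: ht => ? _; lra.
have sq (f : R -> R) d : has_der f t d -> has_der (fun s => f s ^+ 2) t (2 * f t * d).
  move=> hf; have -> : (fun s => f s ^+ 2) = (fun s => f s * f s).
    by apply/funext => r; rewrite expr2.
  by apply: der_eq (derM hf hf) _; ring.
have hU := der_sum (index_enum 'I_n) (fun i => sq _ _ (strip_der_xt hs i x ht)).
apply: der_eq (derM (derD (sq _ _ (strip_der_tt hs x ht))
  (derM (sq _ _ (der_pow (- alpha) t0)) hU)) (der_cst 2^-1 t)) _.
rewrite -/(U (t, x)).
rewrite (eq_bigr (fun i => 2 * (uit i (t, x) * ui i (t, x)))); last first.
  by move=> i _; ring.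
rewrite -mulr_sumr; move: (\sum_i _) (U _) (ut _) (utt _) => A B C D.
by field; rewrite gt_eqF.
Qed.

Let inner_ge0 z : 0 <= U z. Proof. by apply: sumr_ge0 => i _; exact: sqr_ge0. Qed.

Let en_ge0 z : 0 <= en z.
Proof.
rewrite divr_ge0 //; apply: addr_ge0; first exact: sqr_ge0.
by rewrite mulr_ge0 ?sqr_ge0.
Qed.

Let grad_norm t x : enorm (\row_i ui i (t, x)) = Num.sqrt (U (t, x)).
Proof. by congr Num.sqrt; apply: eq_bigr => i _; rewrite mxE. Qed.

(** [U] is bounded on the compact cylinder, so [|grad u|^p <= K |grad u|] and the nonlinear term
    contributes at most a multiple of the energy; [t1^alpha] compensates the factor [t^(-alpha)] of
    the gradient in the energy. [C] depends on the solution, which is harmless because the weighted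
    energy starts at 0. *)
Let cone_rate : exists2 C, 0 <= C & forall t x, 1 < t <= t2 -> in_box L x ->
  - (4 * P (t, x) * rho t * t `^ (- alpha)) * en (t, x)
   + w (t, x) * (ut (t, x) * utt (t, x) + t `^ (- alpha) ^+ 2 * (\sum_i uit i (t, x) * ui i (t, x))
   - alpha * t `^ (- alpha) ^+ 2 / t * U (t, x))
  <= t `^ (- alpha) ^+ 2 * (\sum_i gi i (t, x)) + C * (w (t, x) * en (t, x)).
Proof.
have [M M0 hM] : exists2 M, 0 < M & forall z, cylinder t1 L z -> `|U z| <= M.
  by apply: bounded_cylinder => z hz; apply: (cont_inW (@cylinder_strip _ _ _ _)); apply: cont_U; exact: hz.1.
pose K := Num.sqrt M `^ (p - 1).
exists (K * t1 `^ alpha); first by rewrite mulr_ge0 ?powR_ge0.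
move=> t x /andP[h1 h2] hx.
have ht1 : 1 < t <= t1 by rewrite h1 (le_trans h2) //; case/andP: ht2.
have t0 : 0 < t by exact: lt_trans h1.
rewrite (strip_pde hs x ht1) grad_norm.
have UM : U (t, x) <= M.
  apply: le_trans (ler_norm _) (hM _ _); split => //=.
  by case/andP: ht1 => /ltW -> ->.
pose r := enorm (x - x0).
have er : r ^+ 2 = \sum_j (x 0 j - x0 0 j) ^+ 2.
  by rewrite enorm_sqr; apply: eq_bigr => j _; rewrite !mxE.
pose Y := \sum_i (x 0 i - x0 0 i) * ui i (t, x).
have -> : \sum_i gi i (t, x) = - (4 * P (t, x)) * ut (t, x) * Y
   + P (t, x) ^+ 2 * (\sum_i uit i (t, x) * ui i (t, x))
   + P (t, x) ^+ 2 * (ut (t, x) * (\sum_i uii i (t, x))).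
  rewrite /Y !mulr_sumr -!big_split /=; apply: eq_bigr => i _.
  by rewrite /gi /wi /w /=; ring.
apply: (@energy_pointwise _ alpha mu t (t `^ (- alpha)) (P (t, x)) (rho t) r _ _ _ _ Y _ K) => //.
- exact: powR_gt0.
- exact: enorm_ge0.
- rewrite lt_max ltxx /= subr_gt0 -er => hr.
  have rt : 0 < rho t by apply: rho_gt0; rewrite (ltW h1).
  by rewrite leNgt; apply/negP => h; have := enorm_ge0 (x - x0); rewrite -/r; nra.
- have rE : r = Num.sqrt (\sum_i (x 0 i - x0 0 i) ^+ 2).
    by rewrite -er sqrtr_sqr ger0_norm // enorm_ge0.
  rewrite ler_norml; apply/andP; split; last first.
    by rewrite rE; exact: (cauchy_schwarz (fun i => x 0 i - x0 0 i)).
  have := cauchy_schwarz (fun i => x 0 i - x0 0 i) (fun i => - ui i (t, x)).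
  rewrite -rE (eq_bigr (fun i => - ((x 0 i - x0 0 i) * ui i (t, x)))); last by move=> i _; rewrite mulrN.
  rewrite sumrN -/Y (eq_bigr (fun i => ui i (t, x) ^+ 2)); last by move=> i _; rewrite sqrrN.
  by rewrite -/(U (t, x)) lerNl.
- rewrite powR_ge0 /=.
  rewrite -(mulr_powRB1 (sqrtr_ge0 _)); last by have := hp; lra.
  rewrite ler_wpM2l ?sqrtr_ge0 //.
  by rewrite ge0_ler_powR ?nnegrE ?sqrtr_ge0 ?subr_ge0 ?(ltW hp) // ler_wsqrtr.
- exact: powR_ge0.
- rewrite -mulrA -[leLHS]mulr1 ler_wpM2l ?powR_ge0 // powRN.
  have [/ltW t1' tt1] := andP ht1.
  have t10 : 0 <= t1 by apply: le_trans tt1; exact: ltW.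
  by rewrite ler_pdivlMr ?powR_gt0 // mul1r ge0_ler_powR // nnegrE ltW.
Qed.

Let init_en x : w (1, x) * en (1, x) = 0.
Proof.
have [hx|hx] := lerP (rho 1) (enorm (x - x0)).
  rewrite /w /P (max_idPl _) ?expr0n ?mul0r //= subr_le0.
  have -> : \sum_j (x 0 j - x0 0 j) ^+ 2 = enorm (x - x0) ^+ 2.
    by rewrite enorm_sqr; apply: eq_bigr => j _; rewrite !mxE.
  have h : 0 < rho 1 by apply: rho_gt0; rewrite lexx; case/andP: ht2.
  by rewrite lerXn2r ?nnegrE ?enorm_ge0 // ltW.
have hr : rad < enorm x.
  have := enorm_triangle x (x0 - x); rewrite (_ : x + (x0 - x) = x0); last by rewrite addrC subrK.
  have -> : enorm (x0 - x) = enorm (x - x0).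
    by congr Num.sqrt; apply: eq_bigr => j _; rewrite !mxE; ring.
  by move: hx; rewrite /rho sound1 /eta; have := hx0; lra.
rewrite /en init_t // expr0n /= add0r /U big1 ?mulr0 ?mul0r ?mulr0 // => i _.
by rewrite init_x // expr0n.
Qed.

(** A nonzero value keeps the weighted energy above [m] on a cube around [x0], hence its grid sum
    above [(2 r)^n m] for every fine grid, while Gronwall bounds that sum by [B om], with [om] as
    small as desired. *)
Lemma cone_dt_zero t : 1 < t <= t2 -> ut (t, x0) = 0.
Proof.
move=> ht; apply/eqP/negP => /negP hne.
have [C C0 hC] := cone_rate.
have ht1 : 1 <= t <= t1.
  by case/andP: ht => /ltW -> h /=; rewrite (le_trans h) //; case/andP: ht2.
have rt : 0 < rho t by apply: rho_gt0; case/andP: ht => /ltW ->.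
pose F z := w z * en z.
have F0 : 0 < F (t, x0).
  apply: mulr_gt0.
    rewrite exprn_gt0 // lt_max /= subr_gt0 big1 ?exprn_gt0 ?orbT // => j _.
    by rewrite subrr expr0n.
  rewrite divr_gt0 //; apply: ltr_pwDl; first by rewrite lt_neqAle eq_sym sqrf_eq0 hne sqr_ge0.
  by rewrite mulr_ge0 ?sqr_ge0.
have cF : cont_in (strip t1) F (t, x0) by apply: cont_inM; [exact: cont_w|exact: cont_en].
have [|d d0 hd] := cont_in_ballP cF (e := F (t, x0) / 2); first by rewrite divr_gt0.
pose r := Num.min 1 (d / 4).
have r0 : 0 < r by rewrite lt_min ltr01 divr_gt0.
have r1 : r <= 1 by rewrite ge_min lexx.
have r4 : r <= d / 4 by rewrite ge_min lexx orbT.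
have rd : 2 * r < d by lra.
pose m := F (t, x0) / 2; have m0 : 0 < m by rewrite divr_gt0.
pose B := n%:R * (2 * L) ^+ n * (t - 1) * expR (C * (t - 1)).
have B0 : 0 <= B.
  have L2 : 0 <= 2 * L by rewrite mulr_ge0 // ltW.
  by rewrite !mulr_ge0 ?expR_ge0 ?exprn_ge0 // subr_ge0; case/andP: ht => /ltW.
(* Fixed so that [(2 r)^n m = (B + 1) om], which exceeds the Gronwall bound [B om]. *)
pose om := (2 * r) ^+ n * m / (B + 1).
have om0 : 0 < om.
  apply: divr_gt0; last by rewrite ltr_wpDl.
  by rewrite mulr_gt0 // exprn_gt0 // mulr_gt0.
have [d' d'0 hd'] : exists2 d', 0 < d' & forall i s x y, 1 <= s <= t1 ->
    in_box L x -> in_box L y -> (forall j, `|x 0 j - y 0 j| <= d') ->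
    `|gi i (s, x) - gi i (s, y)| <= om.
  have hnear : \forall d' \near (0 : R)^'+, forall i s x y, 1 <= s <= t1 ->
    in_box L x -> in_box L y -> (forall j, `|x 0 j - y 0 j| <= d') ->
    `|gi i (s, x) - gi i (s, y)| <= om.
    apply: filter_forall => i.
    have [z hz|di di0 hdi] := @unif_cont_cylinder _ _ t1 L (gi i) _ om om0.
      by apply: (cont_inW (@cylinder_strip _ _ _ _)); apply: cont_gi; exact: hz.1.
    near=> d' => s x y hs' hx hy hxy; apply: hdi => // j.
    apply: le_trans (hxy j) _; near: d'; exact: nbhs_right_le.
  near (0 : R)^'+ => d'; exists d'; first by near: d'; exact: nbhs_right_gt.
  exact: (near hnear d').
have [|N hN] := @step_small _ L (Num.min r d'); first by rewrite lt_min r0.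
have hNr : step L N <= r by apply: le_trans hN _; rewrite ge_min lexx.
have hNd : step L N <= d' by apply: le_trans hN _; rewrite ge_min lexx orbT.
have upper : gsum L N (fun x => F (t, x)) <= B * om.
  have -> : B * om = (n%:R * (2 * L) ^+ n * om) * (t - 1) * expR (C * (t - 1)).
    by rewrite /B; ring.
  have t1' : 1 <= t by case/andP: ht => /ltW.
  apply: (@gronwall _ 1 t C _ (fun s => gsum L N (fun x => F (s, x)))
    (fun s => gsum L N (fun x => - (4 * P (s, x) * rho s * s `^ (- alpha)) * en (s, x)
   + w (s, x) * (ut (s, x) * utt (s, x) + s `^ (- alpha) ^+ 2 * (\sum_i uit i (s, x) * ui i (s, x))
   - alpha * s `^ (- alpha) ^+ 2 / s * U (s, x))))).
  - exact: t1'.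
  - exact: C0.
  - have L2 : 0 <= 2 * L by rewrite mulr_ge0 // ltW.
    by apply: mulr_ge0; [rewrite mulr_ge0 ?exprn_ge0|exact: ltW].
  - move=> s /andP[s1 st]; apply: cont_in_gsum => x.
    have hst : strip t1 (s, x).
      by rewrite /strip /= s1 (le_trans st) //; case/andP: ht1.
    apply: (@cont_in_time _ _ (strip t1) F).
      move=> s' /andP[s1' st']; rewrite /strip /= s1' (le_trans st') //.
      by case/andP: ht1.
    by apply: cont_inM; [exact: cont_w|exact: cont_en].
  - move=> s /andP[s1 st]; apply: der_gsum => x.
    have s0 : 0 < s by exact: lt_trans s1.
    apply: derM; first exact: der_w_t.
    by apply: der_en; rewrite s1 (le_trans (ltW st)) //; case/andP: ht1.
  - move=> s /andP[s1 st].
    have hs2 : 1 < s <= t2 by rewrite s1 (le_trans (ltW st)) //; case/andP: ht.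
    apply: (@le_trans _ _ (gsum L N (fun x => s `^ (- alpha) ^+ 2 * (\sum_i gi i (s, x))
        + C * (w (s, x) * en (s, x))))).
      by apply: (@gsum_le _ n L N L0) => x hx; exact: hC.
    rewrite gsumD !gsumZ gsum_sum addrC lerD2l.
    have hsum : `|\sum_i gsum L N (fun x => gi i (s, x))| <= n%:R * (2 * L) ^+ n * om.
      apply: (@le_trans _ _ (\sum_(i < n) (2 * L) ^+ n * om)); last first.
        by rewrite sumr_const card_ord -[_ *+ n]mulr_natl mulrA.
      apply: le_trans (ler_norm_sum _ _ _) _; apply: ler_sum => i _.
      apply: (@gsum_div _ _ L N L0 i (fun x => w (s, x) * (ut (s, x) * ui i (s, x)))).
      + move=> x q; apply: derM; first exact: der_w_x.
        apply: derM; first by apply: (strip_der_tx hs); case/andP: hs2 => -> h; rewrite (le_trans h) //; case/andP: ht2.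
        by apply: (strip_der_xx hs); case/andP: hs2 => /ltW -> h; rewrite (le_trans h) //; case/andP: ht2.
      + move=> x hx; rewrite /w (@P_face i x s _ hx) ?expr0n ?mul0r //.
        by case/andP: hs2 => /ltW ->.
      + move=> x y hx hy hxy; apply: hd' => //.
          by case/andP: hs2 => /ltW -> h; rewrite (le_trans h) //; case/andP: ht2.
        by move=> j; exact: le_trans (hxy j) hNd.
    apply: le_trans hsum; apply: le_trans (ler_norm _) _.
    have s1' : 1 <= s by exact: ltW.
    rewrite normrM ler_piMl // ger0_norm ?sqr_ge0 // expr_le1 ?powR_ge0 //.
    by rewrite -[leRHS](powRr0 s) ler_powR // oppr_le0.
  - by rewrite (_ : (fun x => F (1, x)) = fun=> 0) ?gsum_cst ?mulr0 //; apply/funext.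
have lower : (2 * r) ^+ n * m <= gsum L N (fun x => F (t, x)).
  apply: (@gsum_lower _ _ L N L0 _ x0) => //.
  - move=> j; have := enorm_coord x0 j; rewrite ler_norml /L => /andP[? _].
    have := rho_gt0 (t := 1); rewrite lexx /=; case/andP: ht2 => -> _ /(_ isT); lra.
  - move=> j; have := enorm_coord x0 j; rewrite ler_norml /L => /andP[_ ?].
    have := rho_gt0 (t := 1); rewrite lexx /=; case/andP: ht2 => -> _ /(_ isT); lra.
  - exact: ltW.
  - by move=> x; rewrite mulr_ge0 ?sqr_ge0.
  - move=> x hx; have hh : `|F (t, x) - F (t, x0)| < F (t, x0) / 2.
      apply: hd => //=; first by rewrite subrr normr0.
      by move=> j; apply: le_lt_trans (hx j) rd.
    by move: hh; rewrite /m ltr_norml => /andP[? _]; lra.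
have : (2 * r) ^+ n * m <= B * om := le_trans lower upper.
have e : (2 * r) ^+ n * m = (B + 1) * om by rewrite /om [RHS]mulrC divfK // gt_eqF //; lra.
by rewrite e mulrDl mul1r; lra.
Unshelve. all: by end_near. Qed.

End Cone.

(** The cones over [x0 = x] with [t2 = t] make the time derivative vanish at [x] up to time [t], so
    [u] keeps its initial value there. *)
Lemma finite_speed t x : 1 <= t <= t1 -> sound alpha t + rad < enorm x -> u (t, x) = 0.
Proof.
move=> /[dup] ht /andP[h1 h2] hx.
have hrad : rad < enorm x.
  by apply: le_lt_trans hx; rewrite lerDr sound_ge0 //; case/andP: ha.
rewrite -(init_u hrad); move: h1; rewrite le_eqVlt => /predU1P[<-//|h1].
have [||c /andP[c1 c2]] := @der_mvt _ 1 t (fun s => u (s, x)) (fun s => ut (s, x)) h1.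
- move=> s /andP[s1 st]; apply: (@cont_in_time _ _ (strip t1) u).
    by move=> s' /andP[s1' st']; rewrite /strip /= s1' (le_trans st').
  by apply: (strip_cont hs); rewrite /strip /= s1 (le_trans st).
- by move=> s /andP[s1 st]; apply: (strip_der_t hs); rewrite s1 (le_trans (ltW st)).
rewrite (cone_dt_zero ht hx); last by rewrite c1 ltW.
by rewrite mul0r => /eqP; rewrite subr_eq0 => /eqP.
Qed.

End FiniteSpeed.

(** * The plane-wave functional *)

Section WaveFunctional.
Context {R : realType} {n : nat}.
Local Notation V := 'rV[R]_n.
Variables (alpha mu p t1 : R) (u ut utt : R * V -> R) (ui uit uii : 'I_n -> R * V -> R).
Hypotheses (ha : 0 <= alpha < 1) (hmu : 0 <= mu) (hp : 1 < p).
Hypothesis hs : strip_solution alpha mu p t1 u ut utt ui uit uii.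

(** The region [r < |y|] is open, so [u] vanishes on a whole interval along direction [i]. *)
Lemma gradient_vanish i t r x : 1 <= t <= t1 ->
  (forall y, r < enorm y -> u (t, y) = 0) -> r < enorm x -> ui i (t, x) = 0.
Proof.
move=> ht hr hx.
have hd := strip_der_x hs i x 0 ht.
rewrite scale0r addr0 in hd.
apply: (der_uniq hd); apply: der_near (der_cst 0 0).
have e0 : 0 < enorm x - r by rewrite subr_gt0.
near=> s; apply/esym/hr.
have hs' : `|s| < enorm x - r.
  by near: s; apply/nbhs_ballP; exists (enorm x - r) => //= y; rewrite /ball /= sub0r normrN.
have := enorm_triangle (x + s *: delta_mx 0 i) (- (s *: delta_mx 0 i)).
rewrite addrK.
have -> : enorm (- (s *: delta_mx 0 i : V)) = `|s|.
  rewrite /enorm (bigD1 i) //= big1 => [|j /negbTE hj]; last first.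
    by rewrite !mxE hj andbF mulr0 oppr0 expr0n.
  by rewrite !mxE !eqxx mulr1 sqrrN addr0 sqrtr_sqr.
lra.
Unshelve. all: by end_near. Qed.

Variables (rad lam : R) (i0 : 'I_n).
Hypotheses (hrad : 1 <= rad) (hlam : 2 <= lam).
Hypothesis hvan : forall t x, 1 <= t <= t1 -> sound alpha t + rad < enorm x -> u (t, x) = 0.
Hypothesis ht1 : 1 <= t1.

Let a0 : 0 <= alpha. Proof. by case/andP: ha. Qed.
Let a1 : alpha < 1. Proof. by case/andP: ha. Qed.
Let L := sound alpha t1 + rad + 1.
Let wave (x : V) := expR (lam * x 0 i0).
Let q := (1 - alpha) * (n%:R / 2 * (p - 1)).

Let L0 : 0 < L.
Proof. by have := sound_ge0 a1 ht1; have := hrad; rewrite /L; lra. Qed.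

Let rho (t : R) := sound alpha t + rad.

Let rho_le t : 1 <= t <= t1 -> rho t < L.
Proof.
move=> /andP[h1 h2]; have := sound_le a1 (le_trans ler01 h1) h2; rewrite /rho /L; lra.
Qed.

Let rho_ge1 t : 1 <= t -> 1 <= rho t.
Proof. by move=> h1; have := sound_ge0 a1 h1; have := hrad; rewrite /rho; lra. Qed.

Let ui_van i t x : 1 <= t <= t1 -> rho t < enorm x -> ui i (t, x) = 0.
Proof. by move=> ht; apply: gradient_vanish => // y; exact: hvan. Qed.

Let face t (x : V) i : 1 <= t <= t1 -> `|x 0 i| = L -> rho t < enorm x.
Proof.
move=> ht hx; apply: lt_le_trans (rho_le ht) _; rewrite -hx; exact: enorm_coord.
Qed.

Let der_wave i x s : has_der (fun s => wave (x + s *: delta_mx 0 i)) s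
  (lam * (i == i0)%:R * wave (x + s *: delta_mx 0 i)).
Proof.
have h : has_der (fun s => lam * (x + s *: delta_mx 0 i) 0 i0) s (lam * (i == i0)%:R).
  have -> : (fun s => lam * (x + s *: delta_mx 0 i) 0 i0) =
      fun s => lam * (s * (i == i0)%:R + x 0 i0).
    by apply/funext => r; rewrite !mxE (eqxx 0) /= (eq_sym i0) addrC.
  by apply: der_eq (derZ lam (derD (derM (der_id s) (der_cst _ s)) (der_cst _ s))) _; ring.
by apply: der_eq (der_exp h) _; rewrite mulrC.
Qed.

(** [gi i] is the derivative in direction [i] of [wave] times [ui i - lam u] if [i = i0], and times
    [ui i] otherwise; summed over [i] it expresses Green's identity for [wave] and [u]. [gw] is the
    derivative of [wave u] in direction [i0], by which [ui i0] is traded for [-lam u]. *)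
Let gi i (z : R * V) := wave z.2 * (uii i z - lam ^+ 2 * (i == i0)%:R * u z).
Let gw (z : R * V) := wave z.2 * (ui i0 z + lam * u z).

Let cont_wave z : cont_in (strip t1) (fun y => wave y.2) z.
Proof.
apply: (@cont_in_comp _ _ _ expR); first exact: continuous_expR.
by apply: cont_inM; [exact: cont_in_cst|exact: cont_in_coord].
Qed.

Let cont_gi i z : strip t1 z -> cont_in (strip t1) (gi i) z.
Proof.
move=> hz; apply: cont_inM; first exact: cont_wave.
apply: cont_inB; first exact: (strip_cont_xx hs i hz).
by apply: cont_inM; [exact: cont_in_cst|exact: (strip_cont hs hz)].
Qed.

Let cont_gw z : strip t1 z -> cont_in (strip t1) gw z.
Proof.
move=> hz; apply: cont_inM; first exact: cont_wave.
apply: cont_inD; first exact: (strip_cont_x hs i0 hz).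
by apply: cont_inM; [exact: cont_in_cst|exact: (strip_cont hs hz)].
Qed.

(** The fluxes vanish on the faces of the box, since [L] exceeds the radius of the support by at
    least 1; so [gsum_div] applies, with one step size for all times. *)
Let defects om : 0 < om -> exists2 d, 0 < d & forall N, step L N <= d ->
  forall t, 1 <= t <= t1 ->
   (forall i, `|gsum L N (fun x => gi i (t, x))| <= (2 * L) ^+ n * om) /\
   `|gsum L N (fun x => gw (t, x))| <= (2 * L) ^+ n * om.
Proof.
move=> om0.
have hnear : \forall d \near (0 : R)^'+, forall i t x y, 1 <= t <= t1 ->
    in_box L x -> in_box L y -> (forall j, `|x 0 j - y 0 j| <= d) ->
    `|gi i (t, x) - gi i (t, y)| <= om.
  apply: filter_forall => i.
  have [z hz|di di0 hdi] := @unif_cont_cylinder _ _ t1 L (gi i) _ om om0.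
    by apply: (cont_inW (@cylinder_strip _ _ _ _)); apply: cont_gi; exact: hz.1.
  near=> d => t x y ht hx hy hxy; apply: hdi => // j.
  apply: le_trans (hxy j) _; near: d; exact: nbhs_right_le.
have [z hz|dw dw0 hdw] := @unif_cont_cylinder _ _ t1 L gw _ om om0.
  by apply: (cont_inW (@cylinder_strip _ _ _ _)); apply: cont_gw; exact: hz.1.
near (0 : R)^'+ => d.
exists (Num.min d dw); first by rewrite lt_min dw0 andbT; near: d; exact: nbhs_right_gt.
move=> N hN t ht.
have hNd : step L N <= d by apply: le_trans hN _; rewrite ge_min lexx.
have hNw : step L N <= dw by apply: le_trans hN _; rewrite ge_min lexx orbT.
split=> [i|].
  apply: (@gsum_div _ _ L N L0 i (fun x => wave x * (ui i (t, x) - lam * (i == i0)%:R * u (t, x)))).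
  - move=> x s.
    apply: der_eq (derM (der_wave i x s) (derB (strip_der_xx hs i x s ht)
      (derZ (lam * (i == i0)%:R) (strip_der_x hs i x s ht)))) _.
    by rewrite /gi /=; case: (i == i0); rewrite ?mulr1n ?mulr0n; ring.
  - move=> x hx; have h := face ht hx.
    by rewrite (hvan ht h) (ui_van i ht h) mulr0 subrr mulr0.
  - move=> x y hx hy hxy; apply: (near hnear d _ i) => // j.
    exact: le_trans (hxy j) hNd.
apply: (@gsum_div _ _ L N L0 i0 (fun x => wave x * u (t, x))).
- move=> x s; apply: der_eq (derM (der_wave i0 x s) (strip_der_x hs i0 x s ht)) _.
  by rewrite /gw /= (eqxx i0) mulr1n; ring.
- by move=> x hx; rewrite (hvan ht (face ht hx)) mulr0.
- by move=> x y hx hy hxy; apply: hdw => // j; exact: le_trans (hxy j) hNw.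
Unshelve. all: by end_near. Qed.

Let mass_const := expR (lam * rad) * ((3 * pi) ^+ n * (rad + (1 - alpha)^-1) `^ (n%:R / 2)).
Let K := mass_const `^ (p - 1).

Let mass_const_gt0 : 0 < mass_const.
Proof.
have i1 : 0 < (1 - alpha)^-1 by rewrite invr_gt0 subr_gt0.
rewrite mulr_gt0 ?expR_gt0 // mulr_gt0 ?exprn_gt0 ?mulr_gt0 ?pi_gt0 // powR_gt0 //.
by have := hrad; lra.
Qed.

Let mass t := expR (lam * rho t) * (3 * pi * Num.sqrt (rho t)) ^+ n.

(** [rho t <= (rad + 1/(1-alpha)) t^(1-alpha)], and the power [n/2] of [rho] in the mass, raised to
    [p - 1], produces [q]. *)
Let mass_le t : 1 <= t -> mass t `^ (p - 1) <=
  K * (t `^ q * expR ((p - 1) * lam * sound alpha t)).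
Proof.
move=> h1; have t0 : 0 < t by exact: lt_le_trans h1.
have r0 : 0 <= rho t by apply: le_trans (rho_ge1 h1).
have p1 : 0 <= p - 1 by rewrite subr_ge0 ltW.
have i1 : 0 < (1 - alpha)^-1 by rewrite invr_gt0 subr_gt0.
have k0 : 0 <= rad + (1 - alpha)^-1 by have := hrad; lra.
have hrho : rho t <= (rad + (1 - alpha)^-1) * t `^ (1 - alpha).
  have hta : 1 <= t `^ (1 - alpha).
    by rewrite -[leLHS](powRr0 t) ler_powR // subr_ge0 ltW.
  by rewrite /rho /sound; have := hrad; nra.
have e : mass t = expR (lam * sound alpha t) * (expR (lam * rad) * ((3 * pi) ^+ n * rho t `^ (n%:R / 2))).
  have sq : Num.sqrt (rho t) ^+ n = rho t `^ (n%:R / 2).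
    by rewrite -powR12_sqrt // -powR_mulrn ?powR_ge0 // -powRrM (mulrC 2^-1).
  have er : expR (lam * rho t) = expR (lam * sound alpha t) * expR (lam * rad).
    by rewrite -expRD -mulrDr.
  by rewrite /mass exprMn sq er; ring.
have hm : mass t <= mass_const * (t `^ ((1 - alpha) * (n%:R / 2)) * expR (lam * sound alpha t)).
  rewrite e /mass_const.
  have -> : expR (lam * rad) * ((3 * pi) ^+ n * (rad + (1 - alpha)^-1) `^ (n%:R / 2)) *
     (t `^ ((1 - alpha) * (n%:R / 2)) * expR (lam * sound alpha t)) =
     expR (lam * sound alpha t) * (expR (lam * rad) * ((3 * pi) ^+ n *
      ((rad + (1 - alpha)^-1) `^ (n%:R / 2) * t `^ ((1 - alpha) * (n%:R / 2))))) by ring.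
  rewrite ler_wpM2l ?expR_ge0 // ler_wpM2l ?expR_ge0 // ler_wpM2l ?exprn_ge0 ?mulr_ge0 ?pi_ge0 //.
  rewrite (powRrM t (1 - alpha)) -powRM ?powR_ge0 //.
  by rewrite ge0_ler_powR ?nnegrE ?mulr_ge0 ?powR_ge0 // divr_ge0.
have m0 : 0 <= mass t by rewrite e !mulr_ge0 ?expR_ge0 ?exprn_ge0 ?mulr_ge0 ?powR_ge0 ?pi_ge0.
apply: (@le_trans _ _ ((mass_const * (t `^ ((1 - alpha) * (n%:R / 2)) * expR (lam * sound alpha t))) `^ (p - 1))).
  apply: ge0_ler_powR; rewrite ?nnegrE //.
  by apply: mulr_ge0; [exact: ltW|rewrite mulr_ge0 ?powR_ge0 ?expR_ge0].
rewrite powRM ?(ltW mass_const_gt0) ?mulr_ge0 ?powR_ge0 ?expR_ge0 //.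
rewrite powRM ?powR_ge0 ?expR_ge0 // -powRrM -expRM.
rewrite le_eqVlt; apply/orP; left; apply/eqP; congr (_ * (_ `^ _ * expR _)).
  by rewrite /q; ring.
by ring.
Qed.

(** [(lam/2)^p] comes from bounding the first derivative below by [G], [K] from Jensen's inequality,
    and the last 2 is the half of the nonlinear term spent on grid errors. Neither the solution nor
    [t1] enters. *)
Definition wave_const : R := (lam / 2) `^ p / (2 * K).

Lemma wave_const_gt0 : 0 < wave_const.
Proof.
apply: divr_gt0; last by rewrite mulr_gt0 // powR_gt0.
by apply: powR_gt0; rewrite divr_gt0 // (lt_le_trans _ hlam).
Qed.

Let G N t := gsum L N (fun x => wave x * u (t, x)).
Let G1 N t := gsum L N (fun x => wave x * ut (t, x)).
Let G2 N t := gsum L N (fun x => wave x * utt (t, x)).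

(** The discrete Green identity gives the linear part. The nonlinear part uses
    [|grad u| >= |ui i0|], Jensen's inequality on the support, and summation by parts, which bounds
    the sum of [wave |ui i0|] below by [(lam/2) G]. *)
Lemma wave_inequality g0 : 0 < g0 -> exists2 d, 0 < d & forall N, step L N <= d ->
  forall t, 1 < t <= t1 -> g0 <= G N t ->
  lam ^+ 2 * t `^ (- alpha) ^+ 2 * G N t
   + wave_const * t `^ (- q) * expR (- ((p - 1) * lam) * sound alpha t) * G N t `^ p
  <= G2 N t + mu / t * G1 N t.
Proof.
move=> g00.
have p1 : 0 <= p - 1 by rewrite subr_ge0 ltW.
have p0 : 0 <= p by lra.
pose weight t := t `^ (- q) * expR (- ((p - 1) * lam) * sound alpha t).
have q0 : 0 <= q by rewrite mulr_ge0 ?subr_ge0 ?(ltW a1) // mulr_ge0 // divr_ge0.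
have wt0 t : 0 < t -> 0 < weight t by move=> t0; rewrite mulr_gt0 ?powR_gt0 ?expR_gt0.
have l0 : 0 < lam by have := hlam; lra.
have weight_le t : 1 <= t <= t1 -> weight t1 <= weight t.
  move=> /andP[h1 h2]; have t0 : 0 < t by exact: lt_le_trans h1.
  apply: ler_pM; rewrite ?powR_ge0 ?expR_ge0 //.
    rewrite !powRN lef_pV2 ?posrE ?powR_gt0 // ?(lt_le_trans t0) //.
    by rewrite ge0_ler_powR ?nnegrE ?(ltW t0) // (le_trans (ltW t0)).
  rewrite ler_expR !mulNr lerN2 ler_wpM2l ?mulr_ge0 ?(ltW l0) //.
  by apply: sound_le => //; exact: ltW.
(* First entry: the error of [gw] takes at most half of [lam G]. Second entry: the errors of the
   [gi] take at most half of the nonlinear term, whose coefficient is smallest at [t1]. *)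
pose small := Num.min (lam * g0 / 2) (wave_const * weight t1 * g0 `^ p).
have small0 : 0 < small.
  rewrite lt_min; apply/andP; split; first by rewrite divr_gt0 // mulr_gt0.
  apply: mulr_gt0; last exact: powR_gt0.
  by apply: mulr_gt0; [exact: wave_const_gt0|apply: wt0; exact: lt_le_trans ht1].
pose om := small / ((n%:R + 1) * (2 * L) ^+ n).
have D0 : 0 < (n%:R + 1) * (2 * L) ^+ n.
  by apply: mulr_gt0; [rewrite ltr_wpDl|rewrite exprn_gt0 // mulr_gt0].
have om0 : 0 < om by rewrite divr_gt0.
have hom : (n%:R + 1) * ((2 * L) ^+ n * om) = small.
  by rewrite mulrA mulrC divfK // gt_eqF.
have Lom0 : 0 <= (2 * L) ^+ n * om.
  by apply: mulr_ge0; [rewrite exprn_ge0 // mulr_ge0 // ltW|exact: ltW].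
have hom1 : (2 * L) ^+ n * om <= small.
  by rewrite -hom ler_peMl // lerDr.
have homn : n%:R * ((2 * L) ^+ n * om) <= small.
  by rewrite -hom ler_wpM2r // lerDl.
have [d d0 hd] := defects om0.
exists (Num.min d 1); first by rewrite lt_min d0 ltr01.
move=> N hN t /[dup] ht /andP[h1 h2] gG.
have hNd : step L N <= d by apply: le_trans hN _; rewrite ge_min lexx.
have hN1 : step L N <= 1 by apply: le_trans hN _; rewrite ge_min lexx orbT.
have ht' : 1 <= t <= t1 by rewrite (ltW h1).
have t0 : 0 < t by exact: lt_trans h1.
have [hgi hgw] := hd N hNd t ht'.
have G0 : 0 < G N t by exact: lt_le_trans gG.
pose NL := gsum L N (fun x => wave x * enorm (\row_i ui i (t, x)) `^ p).
have eG : G2 N t + mu / t * G1 N t = t `^ (- alpha) ^+ 2 * (lam ^+ 2 * G N t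
   + \sum_i gsum L N (fun x => gi i (t, x))) + NL.
  rewrite /G2 /G1 /G /NL -gsum_sum -!gsumZ -!gsumD -gsumZ -gsumD.
  apply: eq_gsum => // x _; rewrite (strip_pde hs x ht) /gi /= -mulr_sumr sumrB.
  have -> : \sum_i lam ^+ 2 * (i == i0)%:R * u (t, x) = lam ^+ 2 * u (t, x).
    rewrite (bigD1 i0) //= (eqxx i0) mulr1n mulr1 big1 ?addr0 // => j /negbTE ->.
    by rewrite mulr0 mul0r.
  move: (wave x) (\sum_i _) (enorm _ `^ p) => W S Q; field.
  by rewrite gt_eqF.
have hsum : `|\sum_i gsum L N (fun x => gi i (t, x))| <= n%:R * ((2 * L) ^+ n * om).
  apply: (@le_trans _ _ (\sum_(i < n) (2 * L) ^+ n * om)); last first.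
    by rewrite sumr_const card_ord -[_ *+ n]mulr_natl.
  by apply: le_trans (ler_norm_sum _ _ _) _; apply: ler_sum => i _; exact: hgi.
have at1 : 0 <= t `^ (- alpha) ^+ 2 <= 1.
  rewrite sqr_ge0 expr_le1 ?powR_ge0 //.
  by rewrite -[leRHS](powRr0 t) ler_powR ?(ltW h1) // oppr_le0.
have hNL : 2 * wave_const * weight t * G N t `^ p <= NL.
  pose W x := (enorm x <= rho t)%R%:R * wave x.
  pose S := gsum L N (fun x => W x * `|ui i0 (t, x)|).
  have eW x : W x * `|ui i0 (t, x)| = wave x * `|ui i0 (t, x)|.
    rewrite /W; case: lerP => [_|h]; first by rewrite mul1r.
    by rewrite (ui_van i0 ht' h) normr0 !mulr0.
  have hS : lam / 2 * G N t <= S.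
    have h3 : - S <= gsum L N (fun x => wave x * ui i0 (t, x)).
      rewrite -mulN1r -gsumZ; apply: gsum_le => // x _.
      rewrite mulN1r eW -mulrN ler_wpM2l ?expR_ge0 //.
      by rewrite lerNl ler_normr lexx orbT.
    have h4 : gsum L N (fun x => gw (t, x)) =
        gsum L N (fun x => wave x * ui i0 (t, x)) + lam * G N t.
      by rewrite /G -gsumZ -gsumD; apply: eq_gsum => // x _; rewrite /gw /=; ring.
    have h5 : gsum L N (fun x => gw (t, x)) <= lam * g0 / 2.
      apply: le_trans (ler_norm _) _; apply: le_trans hgw _; apply: le_trans hom1 _.
      by rewrite ge_min lexx.
    have h6 : lam * g0 <= lam * G N t by rewrite ler_wpM2l // ltW.
    lra.
  have W0 x : 0 <= W x by rewrite mulr_ge0 ?expR_ge0.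
  have hJ := @gsum_jensen _ n L N L0 p (mass t) W (fun x => `|ui i0 (t, x)|) hp.
  have m0 : 0 < mass t.
    rewrite mulr_gt0 ?expR_gt0 // exprn_gt0 // mulr_gt0 ?mulr_gt0 ?pi_gt0 //.
    by rewrite sqrtr_gt0 (lt_le_trans ltr01) // rho_ge1 // ltW.
  have {hJ} hJ := hJ m0 W0 (fun x => normr_ge0 _)
    (@gsum_wave_mass _ n L N L0 i0 lam (rho t) hlam (rho_ge1 (ltW h1)) hN1).
  have hNL2 : gsum L N (fun x => W x * `|ui i0 (t, x)| `^ p) <= NL.
    apply: gsum_le => // x _; apply: ler_pM; [exact: W0|exact: powR_ge0| |].
      by rewrite /W; case: (enorm x <= rho t); rewrite ?mul1r ?mul0r ?expR_ge0.
    rewrite ge0_ler_powR ?nnegrE ?enorm_ge0 //.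
    by have := enorm_coord (\row_i ui i (t, x)) i0; rewrite mxE.
  have hSp : (lam / 2 * G N t) `^ p <= mass t `^ (p - 1) * NL.
    apply: (@le_trans _ _ (S `^ p)).
      have h7 : 0 <= lam / 2 * G N t by rewrite mulr_ge0 ?divr_ge0 ?(ltW l0) ?(ltW G0).
      by rewrite ge0_ler_powR ?nnegrE // (le_trans h7).
    by apply: le_trans hJ _; rewrite ler_wpM2l ?powR_ge0.
  have NL0 : 0 <= NL by apply: gsum_ge0 => // x _; rewrite mulr_ge0 ?expR_ge0 ?powR_ge0.
  have hK : (lam / 2 * G N t) `^ p <= K * (t `^ q * expR ((p - 1) * lam * sound alpha t)) * NL.
    by apply: le_trans hSp _; rewrite ler_wpM2r // mass_le // ltW.
  have K0 : 0 < K by rewrite powR_gt0.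
  have D1 : 0 < K * (t `^ q * expR ((p - 1) * lam * sound alpha t)).
    by rewrite !mulr_gt0 ?powR_gt0 ?expR_gt0.
  rewrite (mulrC _ NL) -ler_pdivrMr // in hK.
  apply: le_trans hK; rewrite le_eqVlt; apply/orP; left; apply/eqP.
  rewrite powRM ?(ltW G0) ?divr_ge0 ?(ltW l0) // /wave_const /weight powRN mulNr expRN.
  by field; rewrite !gt_eqF ?powR_gt0 ?expR_gt0.
have hsm : n%:R * ((2 * L) ^+ n * om) <= wave_const * weight t * G N t `^ p.
  apply: le_trans homn _; apply: (@le_trans _ _ (wave_const * weight t1 * g0 `^ p)).
    by rewrite ge_min lexx orbT.
  apply: ler_pM.
  - apply: mulr_ge0; first exact: ltW wave_const_gt0.
    by apply: ltW; apply: wt0; exact: lt_le_trans ht1.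
  - exact: powR_ge0.
  - by rewrite ler_wpM2l ?(ltW wave_const_gt0) // weight_le.
  - by rewrite ge0_ler_powR ?nnegrE ?(ltW g00) ?(ltW G0).
rewrite eG -(mulrA wave_const) -/(weight t).
move: at1 => /andP[b0 b1].
have hS2 : - (n%:R * ((2 * L) ^+ n * om)) <=
    t `^ (- alpha) ^+ 2 * \sum_i gsum L N (fun x => gi i (t, x)).
  rewrite lerNl -mulrN; apply: le_trans hsum.
  apply: le_trans (ler_norm _) _; rewrite normrM normrN ger0_norm //.
  by rewrite ler_piMl.
have e1 : lam ^+ 2 * t `^ (- alpha) ^+ 2 * G N t = t `^ (- alpha) ^+ 2 * (lam ^+ 2 * G N t).
  by ring.
rewrite e1 mulrDr -addrA lerD2l {eG}.
have e2 : 2 * wave_const * weight t * G N t `^ p = 2 * (wave_const * weight t * G N t `^ p).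
  by ring.
move: hS2 hsm hNL; rewrite e2.
move: (t `^ (- alpha) ^+ 2 * \sum_i _) (wave_const * _ * _) (n%:R * _) NL => A B X Y.
by lra.
Qed.

End WaveFunctional.

(** * Lifespan of classical solutions *)

Section Data.
Context {R : realType} {n : nat}.
Local Notation V := 'rV[R]_n.

Lemma supported_zero (v : V -> R) rad r x : supported_in_ball v rad -> rad <= r ->
  r < enorm x -> v x = 0.
Proof.
move=> hv hr hx; apply/eqP/negPn/negP => hne.
have : enorm x <= rad by apply: hv; exact: subset_closure.
by rewrite leNgt (le_lt_trans hr hx).
Qed.

Lemma cont_in_snd (A : set (R * V)) (v : V -> R) z :
  {within setT, continuous v} -> cont_in A (fun y => v y.2) z.
Proof.
move=> /cont_inP/(_ z.2 I) hv; apply/cvgrPdist_lt => e e0.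
move/cvgrPdist_lt/(_ _ e0): hv; rewrite !near_withinE => /nbhs_ballP[d /= d0 hd].
by apply/nbhs_ballP; exists d => //= y [_ hy] _; exact: hd.
Qed.

(* The thresholds m, B and d do not depend on the size L of the box. *)
Lemma data_bounds (i0 : 'I_n) (lam rad : R) (v : V -> R) :
  2 <= lam -> 1 <= rad -> {within setT, continuous v} -> (forall x, 0 <= v x) ->
  (exists x, v x != 0) -> (forall x, rad < enorm x -> v x = 0) ->
  exists m B d : R, [/\ 0 < m, 0 < B, 0 < d &
    forall L N, rad + 1 <= L -> step L N <= d ->
     m <= gsum L N (fun x => expR (lam * x 0 i0) * v x) <= B].
Proof.
move=> hlam hrad cv v0 [y hy] hv.
have vy : 0 < v y by rewrite lt_neqAle eq_sym hy v0.
have yr : enorm y <= rad by rewrite leNgt; apply/negP => /hv e; rewrite e ltxx in vy.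
have l0 : 0 < lam by lra.
have [M M0 hM] : exists2 M, 0 < M & forall z, cylinder 1 rad z -> `|v z.2| <= M.
  by apply: bounded_cylinder => z _; exact: cont_in_snd.
have vM x : v x <= M.
  have [hx|/hv ->] := lerP (enorm x) rad; last exact: ltW.
  apply: le_trans (ler_norm _) (hM (1, x) _); split; first by rewrite /= lexx.
  by move=> j; exact: le_trans (enorm_coord x j) hx.
have hc : cont_in setT v y by move/cont_inP: cv; apply.
have vy2 : 0 < v y / 2 by rewrite divr_gt0.
move/cvgrPdist_lt/(_ _ vy2): hc; rewrite near_withinE => /nbhs_ballP[d /= d0 hd].
pose r := Num.min 1 (d / 4).
have r0 : 0 < r by rewrite lt_min ltr01 divr_gt0.
have r1 : r <= 1 by rewrite ge_min lexx.
have r4 : r <= d / 4 by rewrite ge_min lexx orbT.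
pose m := expR (lam * (y 0 i0 - 2)) * (v y / 2).
have m0 : 0 < m by rewrite mulr_gt0 ?expR_gt0.
exists ((2 * r) ^+ n * m), (M * (expR (lam * rad) * (3 * pi * Num.sqrt rad) ^+ n)), (Num.min r 1).
split.
- by rewrite mulr_gt0 // exprn_gt0 // mulr_gt0.
- apply: mulr_gt0 => //; apply: mulr_gt0; first exact: expR_gt0.
  apply/exprn_gt0/mulr_gt0; first by rewrite mulr_gt0 ?pi_gt0.
  by rewrite sqrtr_gt0; lra.
- by rewrite lt_min r0 ltr01.
move=> L N hL hN.
have L0 : 0 < L by lra.
have hNr : step L N <= r by apply: le_trans hN _; rewrite ge_min lexx.
have hN1 : step L N <= 1 by apply: le_trans hN _; rewrite ge_min lexx orbT.
have yL j : - L <= y 0 j - 1 /\ y 0 j + 1 <= L.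
  have := enorm_coord y j; rewrite ler_norml => /andP[? ?]; split; lra.
apply/andP; split.
  apply: (@gsum_lower _ n L N L0 _ y) => //.
  - by move=> j; have [? _] := yL j; lra.
  - by move=> j; have [_ ?] := yL j; lra.
  - exact: ltW.
  - by move=> x; rewrite mulr_ge0 ?expR_ge0.
  - move=> x hx; apply: ler_pM; rewrite ?expR_ge0 ?(ltW vy2) //.
      rewrite ler_expR ler_wpM2l ?(ltW l0) //.
      have := hx i0; rewrite ler_norml => /andP[? _]; lra.
    have hb : `|v y - v x| < v y / 2.
      apply: hd => //; split=> // i j; rewrite (ord1 i) /ball /= distrC.
      by apply: le_lt_trans (hx j) _; lra.
    by move: hb; rewrite ltr_norml => /andP[_ ?]; lra.
apply: (@le_trans _ _ (gsum L N (fun x => M * ((enorm x <= rad)%R%:R * expR (lam * x 0 i0))))).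
  apply: gsum_le => // x _; have [hx|hx] := lerP (enorm x) rad.
    by rewrite mul1r mulrC ler_wpM2r ?expR_ge0.
  by rewrite (hv x hx) mul0r !mulr0.
by rewrite gsumZ ler_wpM2l ?(ltW M0) // gsum_wave_mass.
Qed.

End Data.

Section Lifespan.
Context {R : realType} {n : nat}.
Local Notation V := 'rV[R]_n.
Variables (alpha mu p rad : R) (u0 u1 : V -> R) (i0 : 'I_n).
Hypotheses (ha : 0 <= alpha < 1) (hmu : 0 <= mu) (hp : 1 < p) (hrad : 1 <= rad).
Hypotheses (cu0 : {within setT, continuous u0}) (cu1 : {within setT, continuous u1}).
Hypotheses (u0_ge0 : forall x, 0 <= u0 x) (u1_ge0 : forall x, 0 <= u1 x).
Hypotheses (u0_neq0 : exists x, u0 x != 0) (u1_neq0 : exists x, u1 x != 0).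
Hypotheses (van0 : forall x, rad < enorm x -> u0 x = 0) (van1 : forall x, rad < enorm x -> u1 x = 0).

(** The slack in the inequality for [E] is spent on [eta]. All constants of the bound are fixed from
    the data before [eps], [u], [t1] and the grid; [Num.min 1 eps] extends the bound to every
    [eps > 0], as finiteness of [T] requires. *)
Lemma lifespan_bound E : 0 < E ->
  E < 1 + alpha - (p - 1) * ((1 - alpha) * n%:R / 2 + (mu - alpha) / 2) ->
  exists2 C, 0 < C & forall eps (T : \bar R) u t1, 0 < eps ->
    classical_solution p alpha mu eps u0 u1 T u -> 1 < t1 -> (t1%:E < T)%E ->
    t1 <= C * (Num.min 1 eps) `^ (- ((p - 1) / E)).
Proof.
move=> E0 hE.
have p1 : 0 < p - 1 by rewrite subr_gt0.
pose eta := (1 + alpha - (p - 1) * ((1 - alpha) * n%:R / 2 + (mu - alpha) / 2) - E) / (p - 1).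
have eta0 : 0 < eta by rewrite divr_gt0 // subr_gt0.
pose q := (1 - alpha) * (n%:R / 2 * (p - 1)).
have q0 : 0 <= q.
  by case/andP: ha => _ h; rewrite mulr_ge0 ?subr_ge0 ?(ltW h) // mulr_ge0 ?divr_ge0 // ltW.
have eE : 1 + alpha - q - (p - 1) * ((mu - alpha) / 2 + eta) = E.
  by rewrite /q /eta; field; rewrite gt_eqF.
pose b := `|mu - alpha| / 2 + eta.
have b0 : 0 < b by rewrite /b ltr_wpDl // divr_ge0.
(* The sum of the three lower bounds on [lam] demanded by the barrier. *)
pose lam := 2 + 2 * b + (b ^+ 2 + b) / eta.
have hq0 : 0 <= (b ^+ 2 + b) / eta by rewrite divr_ge0 ?addr_ge0 ?sqr_ge0 // ltW.
have lam2 : 2 <= lam by rewrite /lam; lra.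
have lamb : 2 * b <= lam by rewrite /lam; lra.
have lameta : b ^+ 2 + b <= lam * eta.
  by rewrite -ler_pdivrMr // /lam; lra.
have l0 : 0 < lam by lra.
have [m0 [B0 [d0 [m0p B0p d0p hd0]]]] := data_bounds i0 lam2 hrad cu0 u0_ge0 u0_neq0 van0.
have [m1 [B1 [d1 [m1p B1p d1p hd1]]]] := data_bounds i0 lam2 hrad cu1 u1_ge0 u1_neq0 van1.
(* The data are linear in [eps], so the initial ratio [G1/G] is at least [m1/B0] for every [eps]. *)
pose phi1 := Num.min (1 / 2) (m1 / (2 * lam * B0)).
have lB0 : 0 < 2 * lam * B0 by rewrite !mulr_gt0.
have phi1p : 0 < phi1 <= 1 / 2.
  rewrite lt_min ge_min lexx andbT; apply/andP; split; first lra.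
  by rewrite divr_gt0.
have phi1B : 2 * lam * phi1 * B0 <= m1.
  rewrite mulrAC mulrC -ler_pdivlMr // ge_min lexx orbT //.
(* The second entry secures [X <= 1] at time 1 when [eps <= 1]; the factor put into [c] below does
   so for larger [eps], by lowering the coefficient of the nonlinear term. *)
pose c0 := Num.min (@wave_const R n alpha p rad lam) (lam ^+ 2 / B0 `^ (p - 1)).
have c0p : 0 < c0.
  by rewrite lt_min wave_const_gt0 //= divr_gt0 ?exprn_gt0 ?powR_gt0.
pose D := c0 * m0 `^ (p - 1).
have D0 : 0 < D by rewrite mulr_gt0 ?powR_gt0.
pose Cst := Num.max 1 (lifespan_const alpha mu p q eta lam phi1).
have Cst0 : 0 < Cst by rewrite lt_max ltr01.
exists ((Cst / D) `^ (E^-1)); first by rewrite powR_gt0 // divr_gt0.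
move=> eps T u t1 eps0 hu t11 t1T.
have hs := classical_strip hu t1T.
case: (hu) => _ _ hi0 hi1.
have iu x : rad < enorm x -> u (1, x) = 0 by move=> hx; rewrite hi0 van0 ?mulr0.
have iut x : rad < enorm x -> dt T u (1, x) = 0 by move=> hx; rewrite hi1 van1 ?mulr0.
have h11 : (1 : R) <= 1 <= t1 by apply/andP; split; [exact: lexx|exact: ltW].
have iux i x : rad < enorm x -> dx T i u (1, x) = 0.
  by move=> hx; exact: (gradient_vanish hs i h11 iu hx).
have hvan t x := @finite_speed _ _ _ _ _ _ _ _ _ _ _ _ ha hmu hp hs rad iu iut iux t x.
have [d dp hd] := wave_inequality ha hp hs i0 hrad lam2 hvan (ltW t11) (mulr_gt0 eps0 m0p).
pose L := sound alpha t1 + rad + 1.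
have hL : rad + 1 <= L.
  by rewrite /L -addrA lerDr sound_ge0 ?(ltW t11) //; case/andP: ha.
have [|N hN] := @step_small _ L (Num.min d (Num.min d0 d1)); first by rewrite !lt_min dp d0p.
have hNd : step L N <= d by apply: le_trans hN _; rewrite ge_min lexx.
have hN0 : step L N <= d0 by apply: le_trans hN _; rewrite !ge_min lexx orbT.
have hN1 : step L N <= d1 by apply: le_trans hN _; rewrite !ge_min lexx !orbT.
pose G t := gsum L N (fun x => expR (lam * x 0 i0) * u (t, x)).
pose G1 t := gsum L N (fun x => expR (lam * x 0 i0) * dt T u (t, x)).
pose G2 t := gsum L N (fun x => expR (lam * x 0 i0) * dt T (dt T u) (t, x)).
have eG : G 1 = eps * gsum L N (fun x => expR (lam * x 0 i0) * u0 x).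
  by rewrite -gsumZ; congr gsum; apply/funext => x; rewrite hi0 mulrCA.
have eG1 : G1 1 = eps * gsum L N (fun x => expR (lam * x 0 i0) * u1 x).
  by rewrite -gsumZ; congr gsum; apply/funext => x; rewrite hi1 mulrCA.
have /andP[lo0 up0] := hd0 L N hL hN0.
have /andP[lo1 up1] := hd1 L N hL hN1.
pose e1 := Num.min 1 eps.
have e1p : 0 < e1 by rewrite lt_min ltr01.
have e1e : e1 / eps <= 1 by rewrite ler_pdivrMr // mul1r ge_min lexx orbT.
pose c := c0 * (e1 / eps) `^ (p - 1).
have cp : 0 < c by rewrite mulr_gt0 // powR_gt0 // divr_gt0.
have cc0 : c <= c0.
  have e11 : 1 `^ (p - 1) = 1 :> R by rewrite powR1.
  rewrite ler_piMr ?(ltW c0p) // -[leRHS]e11.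
  by rewrite ge0_ler_powR ?nnegrE ?(ltW p1) // divr_ge0 // ltW.
have G1p : 0 <= G 1 by rewrite eG mulr_ge0 ?(ltW eps0) // (le_trans (ltW m0p)).
have hX1 : c * G 1 `^ (p - 1) <= lam ^+ 2.
  have hG : G 1 `^ (p - 1) <= (eps * B0) `^ (p - 1).
    apply: ge0_ler_powR; rewrite ?nnegrE; [exact: ltW|exact: G1p| |].
      by rewrite mulr_ge0 // ltW.
    by rewrite eG ler_wpM2l // ltW.
  apply: le_trans (ler_wpM2l (ltW cp) hG) _.
  rewrite /c -mulrA -powRM ?mulr_ge0 ?invr_ge0 ?(ltW e1p) ?(ltW eps0) ?(ltW B0p) //.
  have -> : e1 / eps * (eps * B0) = e1 * B0 by field; rewrite gt_eqF.
  apply: (@le_trans _ _ (lam ^+ 2 / B0 `^ (p - 1) * B0 `^ (p - 1))); last first.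
    by rewrite divfK // gt_eqF // powR_gt0.
  apply: ler_pM; rewrite ?powR_ge0 ?(ltW c0p) //; first by rewrite ge_min lexx orbT.
  rewrite ge0_ler_powR ?nnegrE ?(ltW p1) ?mulr_ge0 ?(ltW e1p) ?(ltW B0p) //.
  by rewrite ler_piMl ?(ltW B0p) // ge_min lexx.
have hG1 : 2 * lam * phi1 * G 1 <= G1 1.
  rewrite eG eG1 mulrCA ler_wpM2l ?(ltW eps0) //.
  apply: le_trans lo1; apply: le_trans phi1B.
  rewrite ler_wpM2l // !mulr_ge0 ?(ltW l0) //.
  by case/andP: phi1p => /ltW.
have key : t1 `^ E * (c * (eps * m0) `^ (p - 1)) <= lifespan_const alpha mu p q eta lam phi1.
  rewrite -[X in _ `^ X * _]eE.
  apply: (@ode_lifespan_bound R alpha mu p q eta lam phi1 ha hp q0 eta0 lam2 lamb lameta phi1p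
    t1 c (eps * m0) G G1 G2).
  - exact: ltW.
  - exact: cp.
  - exact: mulr_gt0.
  - move=> t ht; apply: cont_in_gsum => x; apply: cont_inM; first exact: cont_in_cst.
    by apply: (@cont_in_time _ _ (strip t1)) => //; apply: (strip_cont hs).
  - move=> t ht; apply: cont_in_gsum => x; apply: cont_inM; first exact: cont_in_cst.
    by apply: (@cont_in_time _ _ (strip t1)) => //; apply: (strip_cont_t hs).
  - move=> t ht; apply: der_gsum => x; apply: derZ; exact: (strip_der_t hs).
  - move=> t ht; apply: der_gsum => x; apply: derZ; exact: (strip_der_tt hs).
  - by rewrite eG ler_wpM2l // ltW.
  - exact: hX1.
  - exact: hG1.
  - move=> t ht hg; apply: le_trans (hd N hNd t ht hg); rewrite lerD2l.
    rewrite !ler_wpM2r ?powR_ge0 ?expR_ge0 //.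
    by apply: le_trans cc0 _; rewrite ge_min lexx.
  - by rewrite eE.
have eD : c * (eps * m0) `^ (p - 1) = D * e1 `^ (p - 1).
  rewrite /c -mulrA -powRM ?mulr_ge0 ?invr_ge0 ?(ltW e1p) ?(ltW eps0) ?(ltW m0p) //.
  have -> : e1 / eps * (eps * m0) = m0 * e1 by field; rewrite gt_eqF.
  by rewrite powRM ?(ltW m0p) ?(ltW e1p) // mulrA.
have hE1 : t1 `^ E <= Cst / D * e1 `^ (- (p - 1)).
  rewrite powRN -mulrA -invfM ler_pdivlMr ?mulr_gt0 ?powR_gt0 // -eD.
  by apply: le_trans key _; rewrite le_max lexx orbT.
have t10 : 0 <= t1 by lra.
have -> : t1 = (t1 `^ E) `^ (E^-1) by rewrite -powRrM divff ?gt_eqF // powRr1.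
apply: (@le_trans _ _ ((Cst / D * e1 `^ (- (p - 1))) `^ (E^-1))).
  by rewrite ge0_ler_powR ?nnegrE ?powR_ge0 ?invr_ge0 ?(ltW E0) // (le_trans _ hE1) ?powR_ge0.
rewrite powRM ?powR_ge0 ?divr_ge0 ?(ltW Cst0) ?(ltW D0) // -powRrM.
by rewrite mulNr.
Qed.

End Lifespan.

Section ExtendedBound.
Context {R : realType}.

(** The lifespan bound is obtained at real times [t1 < T] only; [T] itself may be infinite. *)
Lemma ereal_bound (T : \bar R) (B : R) : (1%:E < T)%E ->
  (forall t1 : R, 1 < t1 -> (t1%:E < T)%E -> t1 <= B) -> (T <= B%:E)%E.
Proof.
move=> T1 h; rewrite leNgt; apply/negP => BT.
have [t [t1 tB tT]] : exists t : R, [/\ 1 < t, B < t & (t%:E < T)%E].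
  case: T T1 BT {h} => [r||] //=.
    rewrite !lte_fin => r1 rB; exists ((Num.max 1 B + r) / 2).
    have hm : Num.max 1 B < r by rewrite gt_max r1.
    have h1 : 1 <= Num.max 1 B by rewrite le_max lexx.
    have h2 : B <= Num.max 1 B by rewrite le_max lexx orbT.
    by split; rewrite ?lte_fin; lra.
  move=> _ _; exists (Num.max 1 B + 1).
  have h1 : 1 <= Num.max 1 B by rewrite le_max lexx.
  have h2 : B <= Num.max 1 B by rewrite le_max lexx orbT.
  by split; rewrite ?ltry //; lra.
by have := h t t1 tT; rewrite leNgt tB.
Qed.

End ExtendedBound.

(** * The two exponents of the theorem as admissible rates [E] *)

Section ExponentComparison.
Context {R : realType} (n : nat).
Variables (alpha mu p : R).
Hypotheses (ha : 0 <= alpha < 1) (hmu : 0 <= mu).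

(** With [-A] the leading coefficient and [r] the root, [r gamma'(p) = p gamma'(r) + (r - p)(A r p +
    2)]. *)
Lemma gamma'_gt0 : 1 < p < pc' n alpha mu -> 0 < gamma' n p alpha mu.
Proof.
case/andP: (ha) => a0 a1 /andP[p1 pc].
have b0 : 0 < 1 - alpha by rewrite subr_gt0.
have hroot : 0 < pc' n alpha mu /\ gamma' n (pc' n alpha mu) alpha mu = 0.
  move: pc; rewrite /pc'; set P := [set q | _] => pc.
  have [[r Pr]|hno] := pselect (exists r, P r); first exact: (xgetPex 0 (ex_intro _ r Pr)).
  (* Without a root [pc'] takes its default value 0, against [1 < p]. *)
  have hx : xget 0 P = 0 by apply: xgetPN => r Pr; apply: hno; exists r.
  by move: pc; rewrite hx; lra.
move: (pc' n alpha mu) pc hroot => r pr [r0]; rewrite /gamma'.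
set A := n%:R + 1 + (mu - alpha) / _; set B := n%:R + 1 + _ => hr.
have B0 : 0 < B.
  have : 0 <= (mu + 3 * alpha) / (1 - alpha) by apply: divr_ge0; [have := hmu; lra|exact: ltW].
  by have n0 : 0 <= n%:R :> R by []; rewrite /B; lra.
have A0 : 0 < A.
  rewrite -(pmulr_rgt0 _ (exprn_gt0 2 r0)).
  have := mulr_gt0 r0 B0; lra.
rewrite -(pmulr_rgt0 _ r0).
have -> : r * (- p ^+ 2 * A + p * B + 2) =
   p * (- r ^+ 2 * A + r * B + 2) + (r - p) * (A * (r * p) + 2) by ring.
rewrite hr mulr0 add0r mulr_gt0 ?subr_gt0 // ltr_wpDl // mulr_ge0 ?(ltW A0) // mulr_ge0 ?(ltW r0) //; lra.
Qed.

(** The gap in the second inequality is [(1 - alpha)(p - 1)(p + 2)/(2 p)]. *)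
Lemma pc'_exponent : 1 < p < pc' n alpha mu ->
  let E := (1 - alpha) * gamma' n p alpha mu / (2 * p) in
  0 < E /\ E < 1 + alpha - (p - 1) * ((1 - alpha) * n%:R / 2 + (mu - alpha) / 2).
Proof.
move=> hp E; have g0 := gamma'_gt0 hp; case/andP: ha => a0 a1; case/andP: hp => p1 _.
have b0 : 0 < 1 - alpha by rewrite subr_gt0.
split; first by rewrite /E divr_gt0 ?mulr_gt0 //; lra.
rewrite /E ltr_pdivrMr; last by lra.
have -> : (1 - alpha) * gamma' n p alpha mu =
  - p ^+ 2 * ((n%:R + 1) * (1 - alpha) + (mu - alpha))
   + p * ((n%:R + 1) * (1 - alpha) + (mu + 3 * alpha)) + 2 * (1 - alpha).
  by rewrite /gamma'; field; rewrite gt_eqF.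
rewrite -subr_gt0.
have -> : (1 + alpha - (p - 1) * ((1 - alpha) * n%:R / 2 + (mu - alpha) / 2)) * (2 * p) -
  (- p ^+ 2 * ((n%:R + 1) * (1 - alpha) + (mu - alpha))
   + p * ((n%:R + 1) * (1 - alpha) + (mu + 3 * alpha)) + 2 * (1 - alpha)) =
  (1 - alpha) * ((p - 1) * (p + 2)).
  by field.
by apply: mulr_gt0 => //; apply: mulr_gt0; lra.
Qed.

(** The gap is half of [p - 1] times the denominator of [p0'], which is positive because
    [p0' > 1]. *)
Lemma p0'_exponent : 1 < p < p0' n alpha mu ->
  let E := (1 - mu - (n%:R + 1) * (1 - alpha)) * (p - 1) + 1 + alpha in
  0 < E /\ E < 1 + alpha - (p - 1) * ((1 - alpha) * n%:R / 2 + (mu - alpha) / 2).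
Proof.
move=> hp E; case/andP: ha => a0 a1; case/andP: hp => p1 hp.
rewrite /p0' -ltrBlDl in hp.
have den0 : 0 < (n%:R + 1) * (1 - alpha) + mu - 1.
  rewrite ltNge; apply/negP => h.
  have : (1 + alpha) / ((n%:R + 1) * (1 - alpha) + mu - 1) <= 0.
    by rewrite mulr_ge0_le0 ?invr_le0 //; lra.
  lra.
rewrite ltr_pdivlMr // in hp.
split; first by rewrite /E; lra.
rewrite /E -subr_gt0.
have -> : 1 + alpha - (p - 1) * ((1 - alpha) * n%:R / 2 + (mu - alpha) / 2) -
   ((1 - mu - (n%:R + 1) * (1 - alpha)) * (p - 1) + 1 + alpha) =
   (p - 1) * ((n%:R + 1) * (1 - alpha) + mu - 1) / 2.
  by field.
by rewrite divr_gt0 // mulr_gt0 // subr_gt0.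
Qed.

End ExponentComparison.

Theorem theorem3p1 (R : realType) (n : nat) (alpha mu p rad : R)
  (u0 u1 : 'rV[R]_n -> R)
  (hn : (2 <= n)%N)
  (halpha : 0 <= alpha < 1)
  (hmu : 0 <= mu)
  (hp : 1 < p < pc' n alpha mu \/ 1 < p < p0' n alpha mu)
  (hrad : 0 < rad)
  (hu0 : Ck_space 2 u0)
  (hu1 : Ck_space 1 u1)
  (u0_ge0 : forall x, 0 <= u0 x)
  (u1_ge0 : forall x, 0 <= u1 x)
  (u0_neq0 : exists x, u0 x != 0)
  (u1_neq0 : exists x, u1 x != 0)
  (supp_u0 : supported_in_ball u0 rad)
  (supp_u1 : supported_in_ball u1 rad) :
  (forall (eps : R) (T : \bar R) (u : R * 'rV[R]_n -> R),
     0 < eps -> (1%:E < T)%E ->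
     classical_solution p alpha mu eps u0 u1 T u -> (T < +oo)%E)
  /\
  exists eps0 : R, 0 < eps0 /\
  exists C : R, 0 < C /\
  forall eps : R, 0 < eps <= eps0 ->
    (1 < p < pc' n alpha mu ->
       (lifespan p alpha mu eps u0 u1 <=
        (C * eps `^ (- 2 * p * (p - 1)
                     / ((1 - alpha) * gamma' n p alpha mu)))%:E)%E)
    /\
    (1 < p < p0' n alpha mu ->
       (lifespan p alpha mu eps u0 u1 <=
        (C * eps `^ (- ((p - 1)
                     / ((1 - mu - (n%:R + 1) * (1 - alpha)) * (p - 1)
                        + 1 + alpha))))%:E)%E).
Proof.
(* Enlarging the support radius to at least 1 meets the condition [rho >= 1] of the Gaussian
   bound. *)
pose r1 := Num.max 1 rad.
have r11 : 1 <= r1 by rewrite le_max lexx.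
have rr : rad <= r1 by rewrite le_max lexx orbT.
pose i0 : 'I_n := Ordinal (ltnW hn).
have bound E : 1 < p -> 0 < E ->
    E < 1 + alpha - (p - 1) * ((1 - alpha) * n%:R / 2 + (mu - alpha) / 2) ->
    exists2 C, 0 < C & forall eps (T : \bar R) u, 0 < eps -> (1%:E < T)%E ->
      classical_solution p alpha mu eps u0 u1 T u ->
      (T <= (C * (Num.min 1 eps) `^ (- ((p - 1) / E)))%:E)%E.
  move=> p1 E0 hE.
  have [C C0 hC] := lifespan_bound i0 halpha hmu p1 r11 (proj1 hu0) (proj1 hu1) u0_ge0 u1_ge0
    u0_neq0 u1_neq0 (fun x => supported_zero supp_u0 rr) (fun x => supported_zero supp_u1 rr)
    E0 hE.
  exists C => // eps T u eps0 T1 hu; apply: ereal_bound => // t1 t11 t1T.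
  exact: hC hu t11 t1T.
pose E1 := (1 - alpha) * gamma' n p alpha mu / (2 * p).
pose E2 := (1 - mu - (n%:R + 1) * (1 - alpha)) * (p - 1) + 1 + alpha.
have b1 h := let: conj E0 hE := pc'_exponent halpha hmu h in bound E1 (proj1 (andP h)) E0 hE.
have b2 h := let: conj E0 hE := p0'_exponent halpha h in bound E2 (proj1 (andP h)) E0 hE.
split.
  move=> eps T u eps0 T1 hu.
  have [E [C _ hC]] : exists E, exists2 C, 0 < C & forall eps (T : \bar R) u, 0 < eps -> (1%:E < T)%E ->
      classical_solution p alpha mu eps u0 u1 T u ->
      (T <= (C * (Num.min 1 eps) `^ (- ((p - 1) / E)))%:E)%E.
    by case: hp => h; [exists E1; exact: b1|exists E2; exact: b2].
  exact: le_lt_trans (hC eps T u eps0 T1 hu) (ltry _).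
(* The constants must be chosen before it is known in which range [p] lies; if [p] is outside the
   range, any constant serves. Allowing every [C' >= C] lets the two bounds share a maximum. *)
have total (Q : Prop) E : (Q -> exists2 C, 0 < C & forall eps (T : \bar R) u, 0 < eps -> (1%:E < T)%E ->
      classical_solution p alpha mu eps u0 u1 T u ->
      (T <= (C * (Num.min 1 eps) `^ (- ((p - 1) / E)))%:E)%E) ->
   exists2 C, 0 < C & forall C', C <= C' -> forall eps, 0 < eps <= 1 -> Q ->
     (lifespan p alpha mu eps u0 u1 <= (C' * eps `^ (- ((p - 1) / E)))%:E)%E.
  move=> hQ; have [q|nq] := pselect Q; last by exists 1 => // C' _ eps _ /nq.
  have [C C0 hC] := hQ q; exists C => // C' CC' eps /andP[eps0 eps1] _.
  apply: ge_ereal_sup => T [T1 [u hu]].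
  apply: le_trans (hC eps T u eps0 T1 hu) _; rewrite (min_idPr eps1) lee_fin.
  by rewrite ler_wpM2r ?powR_ge0.
have [C1 C10 hC1] := total _ E1 b1.
have [C2 C20 hC2] := total _ E2 b2.
exists 1; split=> //; exists (Num.max C1 C2); split; first by rewrite lt_max C10.
move=> eps heps; split => h.
  have -> : - 2 * p * (p - 1) / ((1 - alpha) * gamma' n p alpha mu) = - ((p - 1) / E1).
    have g0 := gamma'_gt0 halpha hmu h.
    have a1 : 0 < 1 - alpha by case/andP: halpha; rewrite subr_gt0.
    have p0 : 0 < p by case/andP: h => p1 _; exact: lt_trans p1.
    by rewrite /E1; field; rewrite !gt_eqF.
  by apply: hC1 heps h; rewrite le_max lexx.
by apply: hC2 heps h; rewrite le_max lexx orbT.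
Qed.
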